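(* Let $u$ be an infinite Blaschke product with simple zeros $\{z_n\}_{n\ge1}$, and let $\hat k_n$ be the normalized reproducing kernel of $K_u$ at $z_n$. Let $A$ be a truncated Toeplitz operator on $K_u$ that admits a symbol $f\in H^\infty+\overline{H^\infty}$; that is, $A=A_f=A_\phi+A_{\overline\psi}$ with $f=\phi+\overline\psi$ and $\phi,\psi\in H^\infty$. (a) Fix $p\in[1,\infty)$ and suppose that $\{\hat k_n\}$ forms a $U+S_p$ basis. Then $A\in S_p$ if and only if $\{f(z_n)\}\in \ell^p$. (b) Suppose that $\{\hat k_n\}$ forms a $U+S_\infty$ basis. Then $A$ is compact if and only if $\{f(z_n)\}$ tends to zero.
   Context: $\mathbb D$ is the open unit disk, $H^2$ is the Hardy space of $\mathbb D$, identified with its boundary values in $L^2=L^2(\partial\mathbb D)$. $K_u=H^2\ominus uH^2$, $P_u$ is the orthogonal projection of $L^2$ onto $K_u$, and $A_\phi f=P_u(\phi f)$ is the truncated Toeplitz operator on $K_u$ with symbol $\phi$. The reproducing kernel of $K_u$ at a zero $z_n$ of $u$ is $k_n(w)=\frac{1}{1-\overline{z_n}w}$, and $\hat k_n=k_n/\|k_n\|$. For $f=\phi+\overline\psi$ with $\phi,\psi$ holomorphic, $f(z_n)=\phi(z_n)+\overline{\psi(z_n)}$. For $p<\infty$, an operator is in $S_p$ if its sequence of singular values is in $\ell^p$; in ''$U+S_\infty$'', $S_\infty$ denotes the compact operators. The sequence $\{\hat k_n\}$ forms a $U+S_p$ basis if there exist a unitary operator $U$ on $K_u$ and $K\in S_p$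 such that $\hat k_n=(U+K)e_n$ for all $n$, where $\{e_n\}$ is an orthonormal basis of $K_u$ (the choice of orthonormal basis is immaterial). *)

(* Defs.v *)
From HB Require Import structures.
From mathcomp Require Import all_boot all_order all_algebra.
From mathcomp Require Import complex.
From mathcomp Require Import all_classical all_reals all_analysis.

Set Implicit Arguments.
Unset Strict Implicit.
Unset Printing Implicit Defensive.

Import Order.TTheory GRing.Theory Num.Theory.
Import numFieldNormedType.Exports.
Import ComplexField.Normc.

Local Open Scope classical_set_scope.
Local Open Scope ring_scope.
Local Open Scope complex_scope.

(* Everything is over R[i] with R : realType. [normc] is the R-valued modulus;
   R[i]^o is R[i] as a normed space over itself, so that limits and
   derivatives in R[i]^o are the complex ones. *)

(******************************************************************************)
(* Operators on a subspace K of an ambient space V, with respect to a form    *)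
(* ip which is linear in its first argument and which makes K a complex       *)
(* Hilbert space. An operator on K is a map V -> V of which only the          *)
(* restriction to K is relevant.                                              *)
(******************************************************************************)

Section Operators.
Variables (R : realType) (V : lmodType R[i]) (ip : V -> V -> R[i]).
Variable K : set V.

Definition hnorm (x : V) : R := Num.sqrt (complex.Re (ip x x)).

Definition linear_op (T : V -> V) : Prop :=
  (forall x, K x -> K (T x)) /\
  (forall (a : R[i]) x y, K x -> K y -> T (a *: x + y) = a *: T x + T y).

Definition bounded_op (T : V -> V) : Prop :=
  linear_op T /\
  exists M : R, forall x, K x -> hnorm (T x) <= M * hnorm x.

Definition unitary_op (U : V -> V) : Prop :=
  [/\ linear_op U,
      forall x y, K x -> K y -> ip (U x) (U y) = ip x y
    & forall y, K y -> exists2 x, K x & U x = y].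

Definition adjoint_op (T T' : V -> V) : Prop :=
  bounded_op T' /\ forall x y, K x -> K y -> ip (T x) y = ip x (T' y).

Definition orthonormal_basis (e : nat -> V) : Prop :=
  [/\ forall n, K (e n),
      forall i j, ip (e i) (e j) = (i == j)%:R
    & forall x, K x -> (forall n, ip x (e n) = 0) -> x = 0].

Definition compact_op (T : V -> V) : Prop :=
  linear_op T /\
  forall x : nat -> V, (forall n, K (x n) /\ hnorm (x n) <= 1) ->
  exists2 s : nat -> nat, {homo s : m n / (m < n)%N} &
  exists2 y, K y & (fun n => hnorm (T (x (s n)) - y)) @ \oo --> (0 : R).

(* s is the nonincreasing sequence of the eigenvalues of (T^* T)^(1/2),
   counted with multiplicity; it ends with zeros when T has finite rank. The
   e n with s n != 0 are corresponding orthonormal eigenvectors of T^* T, and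
   the last clause says that no nonzero singular value has been left out. *)
Definition singular_values (T : V -> V) (s : nat -> R) : Prop :=
  [/\ forall n, 0 <= s n,
      nonincreasing_seq s
    & exists T' : V -> V, exists e : nat -> V,
      [/\ adjoint_op T T',
          forall n, K (e n) /\ T' (T (e n)) = (s n ^+ 2)%:C *: e n,
          forall i j, 0 < s i -> 0 < s j -> ip (e i) (e j) = (i == j)%:R
        & forall x, K x -> (forall n, 0 < s n -> ip x (e n) = 0) -> T x = 0]].

Definition schatten (p : R) (T : V -> V) : Prop :=
  bounded_op T /\
  exists2 s : nat -> R, singular_values T s & cvgn (series (fun n => s n `^ p)).

Definition US_basis (S : (V -> V) -> Prop) (k : nat -> V) : Prop :=
  exists U L : V -> V, exists e : nat -> V,
  [/\ unitary_op U, S L, orthonormal_basis e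
    & forall n, k n = U (e n) + L (e n)].

End Operators.

Definition ell (R : realType) (p : R) (c : nat -> R[i]) : Prop :=
  cvgn (series (fun n => normc (c n) `^ p)).

(******************************************************************************)
(* Functions on the unit circle, as functions of the angle t in [0, 2 pi],    *)
(* with the normalized measure dt / (2 pi).                                   *)
(******************************************************************************)

Section Circle.
Variable R : realType.
Notation C := R[i].

Definition angles : set R := `[0, 2 * pi]%classic.

Definition L2_energy (g : R -> C) : \bar R :=
  ((2 * pi)^-1%:E *
    \int[@lebesgue_measure R]_(t in angles) ((normc (g t)) ^+ 2)%:E)%E.

Definition L2 (g : R -> C) : Prop :=
  [/\ measurable_fun angles (fun t => complex.Re (g t)),
      measurable_fun angles (fun t => complex.Im (g t))
    & (L2_energy g < +oo)%E].

Definition circle_mean (g : R -> C) : C :=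
  Complex
    ((2 * pi)^-1 * \int[@lebesgue_measure R]_(t in angles) complex.Re (g t))
    ((2 * pi)^-1 * \int[@lebesgue_measure R]_(t in angles) complex.Im (g t)).

Definition L2_ip (g h : R -> C) : C := circle_mean (fun t => g t * (h t)^*).

Definition disk : set C := [set w | normc w < 1].

Definition holomorphic (F : C -> C) : Prop :=
  forall w, disk w -> derivable (F : C^o -> C^o) w 1.

Definition dilate (F : C -> C) (r : R) : R -> C :=
  fun t => F (r%:C * (cos t +i* sin t)).

(* The elements of H^2 are extended by 0 off the disk, so that Leibniz
   equality of maps C -> C is equality of functions on the disk. *)
Definition H2 (F : C -> C) : Prop :=
  [/\ holomorphic F,
      forall w, ~ disk w -> F w = 0
    & exists M : R, forall r, 0 <= r < 1 -> (L2_energy (dilate F r) <= M%:E)%E].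

Definition Hoo (F : C -> C) : Prop :=
  holomorphic F /\ exists M : R, forall w, disk w -> normc (F w) <= M.

(* The boundary function of F: the limit of F(r e^(it)) in L^2 of the circle
   as r -> 1-, which determines it up to a null set; a representative is
   chosen. *)
Definition boundary (F : C -> C) : R -> C :=
  xget (fun=> 0) [set g | L2 g /\
    L2_energy (fun t => dilate F r t - g t) @[r --> (1 : R)^'-] --> 0%E].

Definition H2_ip (F G : C -> C) : C := L2_ip (boundary F) (boundary G).

Definition blaschke_factor (a w : C) : C :=
  if a == 0 then w
  else (normc a)%:C / a * ((a - w) / (1 - a^* * w)).

(* u is, on the disk, an infinite Blaschke product with the distinct, hence
   simple, zeros z n *)
Definition is_blaschke (u : C -> C) (z : nat -> C) : Prop :=
  [/\ injective z,
      forall n, disk (z n),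
      cvgn (series (fun n => 1 - normc (z n)))
    & exists2 c : C, normc c = 1 & forall w, disk w ->
      (fun N => c * \prod_(n < N) blaschke_factor (z n) w : C^o) @ \oo
        --> (u w : C^o)].

(* the orthogonal complement of u H^2 in H^2 *)
Definition model_space (u : C -> C) : set (C -> C) :=
  [set F | H2 F /\ forall G, H2 G -> H2_ip F (fun w => u w * G w) = 0].

(* the orthogonal projection of L^2 onto the model space *)
Definition model_proj (u : C -> C) (g : R -> C) : C -> C :=
  xget (fun=> 0) [set F | model_space u F /\
    forall G, model_space u G ->
      L2_ip (fun t => g t - boundary F t) (boundary G) = 0].

(* the truncated Toeplitz operator whose symbol is f, given on the circle *)
Definition tto (u : C -> C) (f : R -> C) (F : C -> C) : C -> C :=
  model_proj u (fun t => f t * boundary F t).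

Definition rkernel (a : C) : C -> C :=
  fun w => if normc w < 1 then (1 - a^* * w)^-1 else 0.

Definition unit_rkernel (a : C) : C -> C :=
  fun w => (hnorm (V := C -> C) H2_ip (rkernel a))^-1%:C * rkernel a w.

End Circle.

(* Main.v *)
Require Import Defs.
From HB Require Import structures.
From mathcomp Require Import all_boot all_order all_algebra.
From mathcomp Require Import complex.
From mathcomp Require Import all_classical all_reals all_analysis.
From mathcomp Require Import measurable_realfun.
From mathcomp Require Import ring lra zify.
Import Order.TTheory GRing.Theory Num.Theory.
Import numFieldNormedType.Exports.
Import ComplexField.Normc.
Set Implicit Arguments.
Unset Strict Implicit.
Unset Printing Implicit Defensive.
Local Open Scope classical_set_scope.
Local Open Scope ring_scope.
Local Open Scope complex_scope.

(* By the reproducing property, the co-analytic part of A is diagonal along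
   k_n := khat n, with entries conj (psi (z n)), and so is the adjoint of the
   analytic part, with entries conj (phi (z n)). If k_n = (U + L) e_n with U
   unitary and L in an ideal I, an operator T which is diagonal along k_n, with
   the bounded entries d, satisfies T (U + L) = (U + L) D on the basis e, where
   D is diagonal in e; so T - U D U^* is in I. Adding up, A differs from
   U D U^*, with D of entries f (z n), by an element of I, and such a diagonal
   operator is in I iff its entries are p-summable, resp. tend to 0.

   Only the following facts about the model space are used: it is a Hilbert
   space of analytic functions, and multiplication by a boundary function of
   H^oo is bounded on L^2. They rest on Cauchy's formula for the functions
   which are merely differentiable at each point of the disk (Goursat). *)

(** Ideal membership is handled without singular values: [appr d T] bounds the rank needed to
    approximate [T] within [t] by the number of indices with [t <= d i]. Such a [d] may be unsorted,
    so a sum of operators needs no Weyl inequality, only the interleaving of two sequences, and l^p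
    and c_0 are treated at once as a [seq_ideal]. Singular values enter only at the two ends, where
    the decomposition of a compact operator is constructed. The second obstacle is that [boundary]
    picks a representative up to a null set, so it is linear only after pairing in L^2. Hence
    operators on the model space are characterized by their sesquilinear forms, and boundary
    functions are compared through [bd], the L^2 convergence of the dilates. The orthonormal basis
    supplied by the hypothesis on the kernels gives Riesz representation and adjoints, and k_n = U
    e_n + L e_n places the kernels in the model space. *)

Section Modulus.
Variable R : realType.
Implicit Types z w : R[i].

Lemma normc_ge0 z : 0 <= normc z.
Proof. by case: z => a b; rewrite sqrtr_ge0. Qed.

Lemma normcE z : `|z| = (normc z)%:C.
Proof. by case: z. Qed.

Lemma sqr_normc z : normc z ^+ 2 = complex.Re z ^+ 2 + complex.Im z ^+ 2.
Proof. by case: z => a b; rewrite sqr_sqrtr// addr_ge0// sqr_ge0. Qed.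

Lemma mulcJ z : z * conjc z = (normc z ^+ 2)%:C.
Proof.
by rewrite sqr_normc; case: z => a b /=; simpc; rewrite !expr2 (mulrC a b) addNr.
Qed.

Lemma conjcM z w : conjc (z * w) = conjc z * conjc w.
Proof. exact: rmorphM. Qed.

Lemma conjcD z w : conjc (z + w) = conjc z + conjc w.
Proof. exact: rmorphD. Qed.

Lemma conjcN z : conjc (- z) = - conjc z.
Proof. exact: rmorphN. Qed.

Lemma normc_conj z : normc (conjc z) = normc z.
Proof. by case: z => a b /=; rewrite sqrrN. Qed.

Lemma normc_real (x : R) : normc x%:C = `|x|.
Proof. by rewrite /= expr0n/= addr0 sqrtr_sqr. Qed.

Lemma normcD z w : normc (z + w) <= normc z + normc w.
Proof. exact: le_normcD. Qed.

Lemma normcB z w : normc (z - w) = normc (w - z).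
Proof. by rewrite -normcN opprB. Qed.

Lemma normc_Re z : `|complex.Re z| <= normc z.
Proof.
case: z => a b /=; rewrite -sqrtr_sqr ler_wsqrtr// lerDl sqr_ge0 //.
Qed.

Lemma normc_Im z : `|complex.Im z| <= normc z.
Proof.
case: z => a b /=; rewrite -sqrtr_sqr ler_wsqrtr// lerDr sqr_ge0 //.
Qed.

Lemma ReD z w : complex.Re (z + w) = complex.Re z + complex.Re w.
Proof. by case: z w => a b []. Qed.

Lemma ReN z : complex.Re (- z) = - complex.Re z.
Proof. by case: z. Qed.

Lemma Re_conj z : complex.Re (conjc z) = complex.Re z.
Proof. by case: z. Qed.

End Modulus.

(** * Hilbert spaces *)

Section SemiInner.
Variables (R : realType) (W : lmodType R[i]) (ip : W -> W -> R[i]).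

(** Definiteness is deliberately absent: the same lemmas serve functions in L^2 that are not
    identified almost everywhere, and only [hilbert] adds it. *)
Record semi_ip : Prop := SemiIp {
  ip_lin : forall a x y z, ip (a *: x + y) z = a * ip x z + ip y z ;
  ip_conj : forall x y, ip x y = conjc (ip y x) ;
  ip_pos : forall x, 0 <= complex.Re (ip x x) }.

Hypothesis H : semi_ip.
Local Notation N := (hnorm ip).

Lemma ip0l z : ip 0 z = 0.
Proof.
have := ip_lin H 1 0 0 z; rewrite scale1r addr0 mul1r => /eqP.
by rewrite -subr_eq0 opprD addNKr oppr_eq0 => /eqP.
Qed.

Lemma ipDl x y z : ip (x + y) z = ip x z + ip y z.
Proof. by have := ip_lin H 1 x y z; rewrite scale1r mul1r. Qed.

Lemma ipZl a x z : ip (a *: x) z = a * ip x z.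
Proof. by have := ip_lin H a x 0 z; rewrite !addr0 ip0l addr0. Qed.

Lemma ipNl x z : ip (- x) z = - ip x z.
Proof. by rewrite -scaleN1r ipZl mulN1r. Qed.

Lemma ipBl x y z : ip (x - y) z = ip x z - ip y z.
Proof. by rewrite ipDl ipNl. Qed.

Lemma ip0r z : ip z 0 = 0.
Proof. by rewrite [LHS](ip_conj H) ip0l conjc0. Qed.

Lemma ipDr x y z : ip z (x + y) = ip z x + ip z y.
Proof. by rewrite [LHS](ip_conj H) ipDl conjcD -!(ip_conj H). Qed.

Lemma ipZr a x z : ip z (a *: x) = conjc a * ip z x.
Proof. by rewrite [LHS](ip_conj H) ipZl conjcM -(ip_conj H). Qed.

Lemma ipNr x z : ip z (- x) = - ip z x.
Proof. by rewrite [LHS](ip_conj H) ipNl conjcN -(ip_conj H). Qed.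

Lemma ipBr x y z : ip z (x - y) = ip z x - ip z y.
Proof. by rewrite ipDr ipNr. Qed.

Lemma ip_suml I (r : seq I) (P : pred I) (F : I -> W) z :
  ip (\sum_(i <- r | P i) F i) z = \sum_(i <- r | P i) ip (F i) z.
Proof. by apply: (big_morph (ip^~ z)) => [x y|]; rewrite ?ipDl ?ip0l. Qed.

Lemma ip_sumr I (r : seq I) (P : pred I) (F : I -> W) z :
  ip z (\sum_(i <- r | P i) F i) = \sum_(i <- r | P i) ip z (F i).
Proof. by apply: (big_morph (ip z)) => [x y|]; rewrite ?ipDr ?ip0r. Qed.

Lemma hnorm_ge0 x : 0 <= N x.
Proof. exact: sqrtr_ge0. Qed.

Lemma hnorm_sqr x : N x ^+ 2 = complex.Re (ip x x).
Proof. by rewrite sqr_sqrtr ?(ip_pos H). Qed.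

Lemma ipxx x : ip x x = (N x ^+ 2)%:C.
Proof.
rewrite hnorm_sqr; have := ip_conj H x x; case: (ip x x) => a b /= [hb].
by congr Complex; lra.
Qed.

Lemma hnorm0 : N 0 = 0.
Proof. by rewrite /hnorm ip0l sqrtr0. Qed.

Lemma hnormZ a x : N (a *: x) = normc a * N x.
Proof.
apply: (@pexpIrn _ 2) => //; rewrite ?nnegrE ?hnorm_ge0 ?mulr_ge0 ?normc_ge0 ?hnorm_ge0 //.
rewrite exprMn; apply: (@complexI R); rewrite -ipxx ipZl ipZr mulrA mulcJ ipxx.
by rewrite -rmorphM.
Qed.

Lemma hnormN x : N (- x) = N x.
Proof. by rewrite -scaleN1r hnormZ normcN normc1 mul1r. Qed.

Lemma hnormBC x y : N (x - y) = N (y - x).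
Proof. by rewrite -hnormN opprB. Qed.

Lemma sqr_hnormD x y :
  N (x + y) ^+ 2 = N x ^+ 2 + N y ^+ 2 + complex.Re (ip x y) *+ 2.
Proof.
rewrite !hnorm_sqr ipDl !ipDr !ReD [ip y x](ip_conj H) Re_conj mulr2n; ring.
Qed.

Lemma sqr_hnormD_orth x y : ip x y = 0 -> N (x + y) ^+ 2 = N x ^+ 2 + N y ^+ 2.
Proof. by move=> h; rewrite sqr_hnormD h mul0rn addr0. Qed.

Lemma sqr_hnormB x y :
  N (x - y) ^+ 2 = N x ^+ 2 + N y ^+ 2 - complex.Re (ip x y) *+ 2.
Proof. by rewrite sqr_hnormD hnormN ipNr ReN mulNrn. Qed.

(** The squared norm of x - t<x,y>y is nonnegative for every real t. The value t = 1/|y|^2 gives the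
    inequality; when |y| = 0 the expression is affine in t, so a large t forces <x,y> = 0. *)
Lemma cauchy_schwarz x y : normc (ip x y) <= N x * N y.
Proof.
set b := normc _.
have key (t : R) : 0 <= N x ^+ 2 - 2 * t * b ^+ 2 + t ^+ 2 * b ^+ 2 * N y ^+ 2.
  have := ip_pos H (x - (t%:C * ip x y) *: y).
  rewrite -hnorm_sqr sqr_hnormB hnormZ ipZr normcM normc_real -/b.
  have -> : conjc (t%:C * ip x y) * ip x y = (t * b ^+ 2)%:C.
    by rewrite conjcM conjc_real -mulrA [conjc _ * _]mulrC mulcJ -rmorphM.
  rewrite /= !exprMn real_normK ?num_real // mulr2n.
  by move=> h; apply: (le_trans h); rewrite le_eqVlt; apply/orP; left; apply/eqP; ring.
have b0 : 0 <= b by exact: normc_ge0.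
have [y0|y0] := eqVneq (N y) 0.
  rewrite y0 mulr0; have [->//|bn0] := eqVneq b 0.
  have b2 : 0 < b ^+ 2 by rewrite exprn_gt0 // lt_def bn0.
  have := key ((N x ^+ 2 + 1) / (2 * b ^+ 2)).
  rewrite y0 expr0n /= mulr0 addr0.
  have -> : 2 * ((N x ^+ 2 + 1) / (2 * b ^+ 2)) * b ^+ 2 = N x ^+ 2 + 1.
    by field.
  lra.
have yp : 0 < N y by rewrite lt_def y0 hnorm_ge0.
rewrite -(@ler_pXn2r _ 2) ?nnegrE ?mulr_ge0 ?hnorm_ge0 //.
have := key ((N y ^+ 2)^-1).
have -> : N x ^+ 2 - 2 * (N y ^+ 2)^-1 * b ^+ 2 + (N y ^+ 2)^-1 ^+ 2 * b ^+ 2 * N y ^+ 2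
  = N x ^+ 2 - b ^+ 2 / N y ^+ 2 by field.
by rewrite subr_ge0 ler_pdivrMr ?exprn_gt0 // exprMn.
Qed.

Lemma hnormD x y : N (x + y) <= N x + N y.
Proof.
rewrite -(@ler_pXn2r _ 2) ?nnegrE ?addr_ge0 ?hnorm_ge0 // sqr_hnormD sqrrD.
have := cauchy_schwarz x y; have := normc_Re (ip x y).
have := ler_norm (complex.Re (ip x y)); rewrite !mulr2n; lra.
Qed.

Lemma hnorm_triangle y x z : N (x - z) <= N (x - y) + N (y - z).
Proof. by rewrite -[x - z](subrKA y) hnormD. Qed.

Lemma ler_dist_hnorm x y : `|N x - N y| <= N (x - y).
Proof.
rewrite ler_norml; apply/andP; split.
  by rewrite lerNl opprB lerBlDr -[in leLHS](subrK x y) hnormBC hnormD.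
by rewrite lerBlDr -[in leLHS](subrK y x) hnormD.
Qed.

Lemma sqr_hnorm_sum_orth (r : seq nat) (e : nat -> W) (c : nat -> R[i]) :
  uniq r ->
  (forall i j, i \in r -> j \in r -> i != j -> ip (e i) (e j) = 0) ->
  N (\sum_(i <- r) c i *: e i) ^+ 2 =
    \sum_(i <- r) normc (c i) ^+ 2 * N (e i) ^+ 2.
Proof.
elim: r => [|i r IH] /=; first by rewrite !big_nil hnorm0 expr0n.
move=> /andP[ir ur] he; rewrite !big_cons sqr_hnormD_orth.
  rewrite hnormZ exprMn IH // => j k jr kr; apply: he.
  - by rewrite inE jr orbT.
  - by rewrite inE kr orbT.
rewrite ipZl ip_sumr big_seq big1 ?mulr0 // => j jr.
rewrite ipZr he ?mulr0 ?inE ?eqxx ?jr ?orbT //.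
by apply: contraNneq ir => ->.
Qed.

(* In use, [P] selects the nonzero singular values; off [P] the vectors are
   null. *)
Definition porth (P : pred nat) (e : nat -> W) :=
  forall i j, ip (e i) (e j) = ((i == j) && P i)%:R.

Lemma porth_hnorm P e i : porth P e -> N (e i) = (P i)%:R.
Proof.
move=> he; rewrite /hnorm he eqxx /=.
by case: (P i); rewrite /= ?sqrtr1 ?sqrtr0.
Qed.

Lemma sqr_hnorm_porth P e (r : seq nat) c : porth P e -> uniq r ->
  N (\sum_(i <- r) c i *: e i) ^+ 2 = \sum_(i <- r) normc (c i) ^+ 2 * (P i)%:R.
Proof.
move=> he ur; rewrite sqr_hnorm_sum_orth // => [|i j _ _ /negbTE ij]; last first.
  by rewrite he ij.
apply: eq_bigr => i _; rewrite (porth_hnorm i he); congr (_ * _).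
by case: (P i); rewrite ?expr1n ?expr0n.
Qed.

(** The weight 2 - P i is the cross term, counted twice, minus the squared norm of [e i], which is 1
    on [P] and 0 off [P]. *)
Lemma bessel P e (r : seq nat) x : porth P e -> uniq r ->
  N (x - \sum_(i <- r) ip x (e i) *: e i) ^+ 2 =
  N x ^+ 2 - \sum_(i <- r) normc (ip x (e i)) ^+ 2 * (2 - (P i)%:R).
Proof.
move=> he ur; rewrite sqr_hnormB (sqr_hnorm_porth _ he) // ip_sumr.
have -> : complex.Re (\sum_(i <- r) ip x (ip x (e i) *: e i)) =
   \sum_(i <- r) normc (ip x (e i)) ^+ 2.
  rewrite (eq_bigr (fun i => (normc (ip x (e i)) ^+ 2)%:C)) => [|i _].
    by rewrite -(big_morph _ (@rmorphD _ _ (real_complex R)) (rmorph0 _)).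
  by rewrite ipZr mulrC mulcJ.
rewrite -addrA; congr (_ + _); rewrite -sumrMnl -sumrB -sumrN.
by apply: eq_bigr => i _; rewrite mulr2n; ring.
Qed.

Lemma bessel_le P e (r : seq nat) x : porth P e -> uniq r ->
  \sum_(i <- r) normc (ip x (e i)) ^+ 2 <= N x ^+ 2.
Proof.
move=> he ur; have := sqr_ge0 (N (x - \sum_(i <- r) ip x (e i) *: e i)).
rewrite (bessel _ he ur) subr_ge0 => h; apply: le_trans h.
apply: ler_sum => i _; rewrite ler_peMr ?sqr_ge0 //.
by case: (P i); rewrite ?subr0 //=; lra.
Qed.

End SemiInner.

Section Hilbert.
Variables (R : realType) (W : lmodType R[i]) (ip : W -> W -> R[i]).
Local Notation N := (hnorm ip).

(** Convergence is spelled out with epsilons because [W] is a bare module: its only topology is the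
    one of [hnorm]. *)
Definition hcvg (x : nat -> W) (y : W) :=
  forall eps : R, 0 < eps -> exists n0, forall n, (n0 <= n)%N -> N (x n - y) < eps.

Definition hcauchy (x : nat -> W) :=
  forall eps : R, 0 < eps -> exists n0, forall m n,
    (n0 <= m)%N -> (n0 <= n)%N -> N (x m - x n) < eps.

Record hilbert : Prop := Hilbert {
  hilbert_semi :> semi_ip ip ;
  hilbert_def : forall x, N x = 0 -> x = 0 ;
  hilbert_complete : forall x, hcauchy x -> exists y, hcvg x y }.

Hypothesis H : hilbert.

Lemma ip_def x : ip x x = 0 -> x = 0.
Proof. by move=> h; apply: (hilbert_def H); rewrite /hnorm h sqrtr0. Qed.

Lemma ip_eqr x y : (forall z, ip z x = ip z y) -> x = y.
Proof.
move=> h; apply/eqP; rewrite -subr_eq0; apply/eqP/ip_def.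
by rewrite (ipBr H) h subrr.
Qed.

Lemma ip_eql x y : (forall z, ip x z = ip y z) -> x = y.
Proof.
by move=> h; apply: ip_eqr => z; rewrite (ip_conj H) h -(ip_conj H).
Qed.

Lemma le_limit (a b : R) : (forall eps, 0 < eps -> a <= b + eps) -> a <= b.
Proof. by move=> h; apply/ler_addgt0Pr => e /h. Qed.

Lemma hcvg_ge (x : nat -> W) y B n0 : hcvg x y ->
  (forall n, (n0 <= n)%N -> N (x n) <= B) -> N y <= B.
Proof.
move=> xy hB; apply: le_limit => e /xy [n1 h].
have /ltW {}h := h (maxn n0 n1) (leq_maxr _ _).
have {}hB := hB (maxn n0 n1) (leq_maxl _ _).
by have := ler_dist_hnorm H (x (maxn n0 n1)) y; rewrite ler_norml; lra.
Qed.

Lemma hcvg_sub (x : nat -> W) y z : hcvg x y -> hcvg (fun n => x n - z) (y - z).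
Proof.
by move=> h e /h [n0 {}h]; exists n0 => n /h; rewrite opprB addrA subrK.
Qed.

Lemma hcvg_ip (x : nat -> W) y z c n0 : hcvg x y ->
  (forall n, (n0 <= n)%N -> ip (x n) z = c) -> ip y z = c.
Proof.
move=> xy hc; apply/eqP; rewrite -subr_eq0; apply/eqP/eq0_normc/eqP.
rewrite eq_le normc_ge0 andbT; apply: le_limit => e e0; rewrite add0r.
have z1 : 0 < N z + 1 by rewrite ltr_wpDl ?hnorm_ge0.
have [|n1 h] := xy (e / (N z + 1)); first by rewrite divr_gt0.
have := h (maxn n0 n1) (leq_maxr _ _).
rewrite -(hc (maxn n0 n1) (leq_maxl _ _)) -(ipBl H) => {}h.
apply: (le_trans (cauchy_schwarz H _ _)); rewrite (hnormBC H).
have N0 := hnorm_ge0 ip z; apply: (@le_trans _ _ (e / (N z + 1) * (N z + 1))).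
  by apply: ler_pM => //; [exact: hnorm_ge0|exact: ltW|rewrite lerDl].
by rewrite divfK // gt_eqF.
Qed.

Lemma hcvg_uniq (x : nat -> W) y z : hcvg x y -> hcvg x z -> y = z.
Proof.
move=> xy xz; apply/eqP; rewrite -subr_eq0; apply/eqP/(hilbert_def H)/eqP.
rewrite eq_le hnorm_ge0 andbT; apply: le_limit => e e0; rewrite add0r.
have e2 : 0 < e / 2 by rewrite divr_gt0.
have [n1 h1] := xy _ e2; have [n2 h2] := xz _ e2.
have {}h1 := h1 (maxn n1 n2) (leq_maxl _ _).
have {}h2 := h2 (maxn n1 n2) (leq_maxr _ _).
by have := hnorm_triangle H (x (maxn n1 n2)) y z; rewrite (hnormBC H y (x _)); lra.
Qed.

Lemma hcvg_img (T : {linear W -> W}) M (x : nat -> W) y :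
  (forall x, N (T x) <= M * N x) -> hcvg x y -> hcvg (T \o x) (T y).
Proof.
move=> hT xy e e0.
have M1 : 0 < `|M| + 1 by rewrite ltr_wpDl.
have [|n0 h] := xy (e / (`|M| + 1)); first by rewrite divr_gt0.
exists n0 => n /h {}h; rewrite /= -linearB; apply: (le_lt_trans (hT _)).
apply: (@le_lt_trans _ _ ((`|M| + 1) * N (x n - y))).
  by rewrite ler_wpM2r ?hnorm_ge0 //; have := ler_norm M; lra.
by rewrite mulrC -ltr_pdivlMr.
Qed.

Lemma adjC (T T' : W -> W) : (forall x y, ip (T x) y = ip x (T' y)) ->
  forall x y, ip (T' x) y = ip x (T y).
Proof. by move=> h x y; rewrite (ip_conj H) -h -(ip_conj H). Qed.

Lemma adj_bound (T T' : W -> W) M : (forall x y, ip (T x) y = ip x (T' y)) ->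
  (forall x, N (T x) <= M * N x) -> forall y, N (T' y) <= M * N y.
Proof.
move=> hT hM y; have [->|y0] := eqVneq (N (T' y)) 0.
  exact: le_trans (hnorm_ge0 _ _) (hM y).
have yp : 0 < N (T' y) by rewrite lt_def y0 hnorm_ge0.
rewrite -(ler_pM2l yp) -expr2 (hnorm_sqr H) -hT.
apply: (le_trans (ler_norm _)); apply: (le_trans (normc_Re _)).
apply: (le_trans (cauchy_schwarz H _ _)).
by rewrite mulrA (mulrC _ M) ler_wpM2r // hnorm_ge0.
Qed.

Section Family.
Variables (P : pred nat) (e : nat -> W).
Hypothesis he : porth ip P e.
Implicit Type c : nat -> R[i].

Local Notation psum c n := (\sum_(i < n) c i *: e i).

Lemma psum_nat c n : psum c n = \sum_(i <- iota 0 n) c i *: e i.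
Proof. by rewrite -(big_mkord xpredT (fun i => c i *: e i)) /index_iota subn0. Qed.

Lemma ip_psum c n j : (j < n)%N -> ip (psum c n) (e j) = (P j)%:R * c j.
Proof.
move=> jn; rewrite (ip_suml H) (bigD1 (Ordinal jn)) //= big1 ?addr0.
  by rewrite (ipZl H) he eqxx mulrC.
move=> i ij; rewrite (ipZl H) he -[(i : nat) == j]/(i == Ordinal jn).
by rewrite (negbTE ij) mulr0.
Qed.

(** The squared norm of a block of the series is at most the increment of the bounded monotone sums
    [u], and these come within eps^2 of their supremum. *)
Lemma hcauchy_psum c B : (forall n, \sum_(i < n) normc (c i) ^+ 2 <= B) ->
  hcauchy (fun n => psum c n).
Proof.
move=> hB.
pose u n := \sum_(i < n) normc (c i) ^+ 2.
have u_nd m n : (m <= n)%N -> u m <= u n.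
  move=> mn; rewrite /u -!(big_mkord xpredT (fun i => normc (c i) ^+ 2)).
  by rewrite (big_cat_nat (leq0n m) mn) /= lerDl sumr_ge0 // => i _; rewrite sqr_ge0.
have hs : has_sup (range u).
  by split; [exists (u 0%N), 0%N|exists B => _ [n _ <-]; exact: hB].
have le_sup n : u n <= sup (range u) by apply: ub_le_sup; [case: hs|exists n].
have key m n : (m <= n)%N -> N (psum c n - psum c m) ^+ 2 <= u n - u m.
  move=> mn; rewrite -!(big_mkord xpredT (fun i => c i *: e i)).
  rewrite (big_cat_nat (leq0n m) mn) /= addrAC subrr add0r /index_iota.
  rewrite (sqr_hnorm_porth H _ he) ?iota_uniq //.
  rewrite /u -!(big_mkord xpredT (fun i => normc (c i) ^+ 2)).
  rewrite (big_cat_nat (leq0n m) mn) /= addrAC subrr add0r.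
  apply: ler_sum => i _; rewrite ler_piMr ?sqr_ge0 //.
  by case: (P i).
move=> eps eps0.
have [_ [n0 _ <-] h] := sup_adherent (exprn_gt0 2 eps0) hs.
exists n0 => m n hm hn.
wlog mn : m n hm hn / (m <= n)%N.
  by move=> hw; case/orP: (leq_total m n) => /hw; [|rewrite (hnormBC H)]; exact.
rewrite (hnormBC H) -(@ltr_pXn2r _ 2) ?nnegrE ?hnorm_ge0 ?ltW //.
apply: (le_lt_trans (key _ _ mn)).
by have := le_sup n; have := u_nd _ _ hm; rewrite -/(u m); lra.
Qed.

Lemma riesz_fischer_ex c B : (forall n, \sum_(i < n) normc (c i) ^+ 2 <= B) ->
  exists y, hcvg (fun n => psum c n) y /\ forall j, ip y (e j) = (P j)%:R * c j.
Proof.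
move=> hB; have [y hy] := hilbert_complete H (hcauchy_psum hB).
exists y; split => // j; apply: (hcvg_ip (n0 := j.+1) hy) => n jn.
exact: ip_psum.
Qed.

Lemma sqr_hnorm_psum c n :
  N (psum c n) ^+ 2 = \sum_(i < n) normc (c i) ^+ 2 * (P i)%:R.
Proof.
rewrite psum_nat (sqr_hnorm_porth H _ he) ?iota_uniq //.
by rewrite -(big_mkord xpredT (fun i => normc (c i) ^+ 2 * (P i)%:R)) /index_iota subn0.
Qed.

Lemma bessel_ord x n : \sum_(i < n) normc (ip x (e i)) ^+ 2 <= N x ^+ 2.
Proof.
have := bessel_le H x he (iota_uniq 0 n).
by rewrite -(big_mkord xpredT (fun i => normc (ip x (e i)) ^+ 2)) /index_iota subn0.
Qed.

Lemma ip_porth0 x j : ~~ P j -> ip x (e j) = 0.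
Proof.
move=> Pj; have -> : e j = 0.
  by apply: (hilbert_def H); rewrite (porth_hnorm j he) (negbTE Pj).
exact: (ip0r H).
Qed.

(** Bessel's inequality makes the coefficients square summable, so the series converges; [y] is the
    orthogonal projection of [x] onto the closed span of the family. *)
Lemma proj_ex x : exists y,
  hcvg (fun n => psum (fun i => ip x (e i)) n) y /\ forall j, ip (x - y) (e j) = 0.
Proof.
have [y [h hy]] := riesz_fischer_ex (c := fun i => ip x (e i)) (bessel_ord x).
exists y; split=> // j; rewrite (ipBl H) hy; case: (boolP (P j)) => Pj.
  by rewrite mul1r subrr.
by rewrite ip_porth0 // mulr0 subrr.
Qed.

End Family.

Section Basis.
Variable e : nat -> W.
Hypothesis he : orthonormal_basis ip setT e.

Lemma onb_porth : porth ip xpredT e.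
Proof. by move=> i j; case: he => _ -> _; rewrite andbT. Qed.

Lemma onb_total x : (forall n, ip x (e n) = 0) -> x = 0.
Proof. by case: he => _ _; apply. Qed.

Lemma onb_expand x : hcvg (fun n => \sum_(i < n) ip x (e i) *: e i) x.
Proof.
have [y [h hy]] := proj_ex onb_porth x.
by move: h; have /eqP := onb_total hy; rewrite subr_eq0 => /eqP <-.
Qed.

Lemma lin_eq0 (T : {linear W -> W}) M : (forall x, N (T x) <= M * N x) ->
  (forall n, T (e n) = 0) -> forall x, T x = 0.
Proof.
move=> hM hT x; apply: (hcvg_uniq (hcvg_img hM (onb_expand x))) => eps eps0.
exists 0%N => n _ /=; rewrite linear_sum big1 ?subrr ?(hnorm0 H) // => i _.
by rewrite linearZ /= hT scaler0.
Qed.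

(** The coefficients of the representing vector must be the conjugates of [l (e i)]. On the partial
    sum of [c i *: e i], the bound on [l] gives S^2 <= M^2 S for S the sum of |c i|^2, hence S <=
    M^2, and Riesz-Fischer provides the vector. *)
Lemma riesz_rep (l : W -> R[i]) M :
  (forall a x y, l (a *: x + y) = a * l x + l y) ->
  (forall x, normc (l x) <= M * N x) ->
  exists z, forall x, l x = ip x z.
Proof.
move=> hl hM.
have l0 : l 0 = 0.
  have := hl 1 0 0; rewrite scale1r addr0 mul1r => /eqP.
  by rewrite -subr_eq0 opprD addNKr oppr_eq0 => /eqP.
have lD x y : l (x + y) = l x + l y by have := hl 1 x y; rewrite scale1r mul1r.
have lZ a x : l (a *: x) = a * l x by have := hl a x 0; rewrite l0 !addr0.
have ls n c : l (\sum_(i < n) c i *: e i) = \sum_(i < n) c i * l (e i).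
  rewrite (big_morph l lD l0); by apply: eq_bigr => i _; rewrite lZ.
pose c i := conjc (l (e i)).
have hB n : \sum_(i < n) normc (c i) ^+ 2 <= M ^+ 2.
  set S := \sum_(_ < _) _.
  have S0 : 0 <= S by apply: sumr_ge0 => i _; rewrite sqr_ge0.
  have [->|Sn0] := eqVneq S 0; first exact: sqr_ge0.
  have Sp : 0 < S by rewrite lt_def Sn0.
  have hS : normc (l (\sum_(i < n) c i *: e i)) = S.
    rewrite ls (eq_bigr (fun i : 'I_n => (normc (c i) ^+ 2)%:C)) => [|i _].
      rewrite -(big_morph _ (@rmorphD _ _ (real_complex R)) (rmorph0 _)).
      by rewrite normc_real ger0_norm.
    by rewrite -mulcJ /c conjcK.
  have := hM (\sum_(i < n) c i *: e i); rewrite hS => h.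
  have h2 : S ^+ 2 <= M ^+ 2 * S.
    have -> : M ^+ 2 * S = (M * N (\sum_(i < n) c i *: e i)) ^+ 2.
      rewrite exprMn (sqr_hnorm_psum onb_porth); congr (_ * _).
      by apply: eq_bigr => i _; rewrite mulr1.
    by rewrite ler_pXn2r ?nnegrE //; apply: le_trans h.
  by rewrite -(ler_pM2r Sp) -expr2.
have [z [hz zj]] := riesz_fischer_ex onb_porth (c := c) hB.
exists z => x; apply/eqP; rewrite -subr_eq0; apply/eqP/eq0_normc/eqP.
rewrite eq_le normc_ge0 andbT; apply: le_limit => eps eps0; rewrite add0r.
set K := `|M| + N z + 1.
have K0 : 0 < K by rewrite /K ltr_wpDl // addr_ge0 // hnorm_ge0.
have [|n0 h] := onb_expand x (eps := eps / K); first by rewrite divr_gt0.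
(* Both functionals agree on the partial sum [y], so their difference at [x] is controlled by the
   norm of [y - x]. *)
set y := \sum_(i < n0) ip x (e i) *: e i.
have yz : l y = ip y z.
  rewrite ls (ip_suml H); apply: eq_bigr => i _; rewrite (ipZl H); congr (_ * _).
  by rewrite (ip_conj H) zj mul1r /c conjcK.
have -> : l x - ip x z = ip (y - x) z - l (y - x).
  by rewrite -scaleN1r lD lZ (ipDl H) (ipZl H) -yz; ring.
have {}h : N (y - x) < eps / K by exact: h.
apply: (@le_trans _ _ (eps / K * K)); last by rewrite divfK // gt_eqF.
apply: (le_trans (normcD _ _)); rewrite normcN.
apply: (@le_trans _ _ (N (y - x) * K)); last by rewrite ler_wpM2r ?ltW.
have := cauchy_schwarz H (y - x) z; have := hM (y - x).
have : M * N (y - x) <= `|M| * N (y - x) by rewrite ler_wpM2r ?hnorm_ge0 ?ler_norm.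
have := hnorm_ge0 ip (y - x); rewrite /K; lra.
Qed.

Lemma adjoint_ex (T : {linear W -> W}) M : (forall x, N (T x) <= M * N x) ->
  exists T' : {linear W -> W}, forall x y, ip (T x) y = ip x (T' y).
Proof.
move=> hM.
have hex y : exists z, forall x, ip (T x) y = ip x z.
  apply: (@riesz_rep (fun x => ip (T x) y) (M * N y)) => [a u v|x].
    by rewrite linearP (ip_lin H).
  by apply: (le_trans (cauchy_schwarz H _ _)); rewrite mulrAC ler_wpM2r ?hnorm_ge0.
have [T' hT'] := choice hex.
have T'lin : linear T'.
  move=> a y z; apply: ip_eqr => x.
  by rewrite (ipDr H) (ipZr H) -!hT' (ipDr H) (ipZr H).
pose T'm := GRing.isLinear.Build _ _ _ _ T' T'lin.
pose T'l : {linear W -> W} := HB.pack T' T'm.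
by exists T'l.
Qed.

(** Riesz-Fischer produces each value from its prescribed coefficients; linearity holds because the
    coefficients in [e] determine a vector. *)
Lemma diag_ex (d : nat -> R[i]) M : (forall n, normc (d n) <= M) ->
  exists D : {linear W -> W}, [/\ forall n, D (e n) = d n *: e n,
    forall x n, ip (D x) (e n) = d n * ip x (e n) & forall x, N (D x) <= M * N x].
Proof.
move=> hd.
have M0 : 0 <= M := le_trans (normc_ge0 _) (hd 0%N).
have hle x n : \sum_(i < n) normc (d i * ip x (e i)) ^+ 2 <= (M * N x) ^+ 2.
  apply: (@le_trans _ _ (M ^+ 2 * \sum_(i < n) normc (ip x (e i)) ^+ 2)).
    rewrite mulr_sumr; apply: ler_sum => i _; rewrite normcM exprMn.
    by rewrite ler_wpM2r ?sqr_ge0 // ler_pXn2r ?nnegrE ?normc_ge0.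
  by rewrite exprMn ler_wpM2l ?sqr_ge0 // (bessel_ord onb_porth).
have hex x : exists y, (forall j, ip y (e j) = d j * ip x (e j)) /\ N y <= M * N x.
  have [y [h hy]] := riesz_fischer_ex onb_porth (c := fun i => d i * ip x (e i)) (hle x).
  exists y; split => [j|]; first by rewrite hy mul1r.
  apply: (hcvg_ge (n0 := 0) h) => n _.
  rewrite -(@ler_pXn2r _ 2) ?nnegrE ?hnorm_ge0 ?mulr_ge0 ?hnorm_ge0 //.
  rewrite (sqr_hnorm_psum onb_porth (fun i => d i * ip x (e i))).
  by under eq_bigr do rewrite mulr1; exact: hle.
have [D hD] := choice hex.
have ext y z : (forall j, ip y (e j) = ip z (e j)) -> y = z.
  move=> h; apply/eqP; rewrite -subr_eq0; apply/eqP/onb_total => n.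
  by rewrite (ipBl H) h subrr.
have Dlin : linear D.
  move=> a y z; apply: ext => j; have hj w := (hD w).1 j.
  by rewrite (ip_lin H) !hj (ip_lin H); ring.
pose Dm := GRing.isLinear.Build _ _ _ _ D Dlin.
pose Dl : {linear W -> W} := HB.pack D Dm.
exists Dl; split => [n|x n|x]; [|exact: (hD x).1|exact: (hD x).2].
apply: ext => j; rewrite [LHS](hD (e n)).1 (ipZl H) onb_porth andbT.
by case: eqP => [->|]; rewrite ?mulr0.
Qed.

End Basis.
End Hilbert.

(** * Approximation by finite rank operators *)

Section Approximation.
Variables (R : realType) (W : lmodType R[i]) (ip : W -> W -> R[i]).
Local Notation N := (hnorm ip).
Hypothesis H : hilbert ip.

Definition finite_rank (r : seq nat) (a b : nat -> W) (x : W) : W :=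
  \sum_(i <- r) ip x (a i) *: b i.

(* The rank-at-most-[#{i | t <= d i}] approximation within [t]; for [d] the
   sequence of approximation numbers this is their definition, but [d] needs
   not be sorted. *)
Definition appr (d : nat -> R) (T : W -> W) := forall t, 0 < t ->
  exists (r : seq nat) (a b : nat -> W),
    [/\ uniq r, forall i, i \in r -> t <= d i
      & forall x, N (T x - finite_rank r a b x) <= t * N x].

(** Merging two index sets: the number of terms above a level is the sum of the two numbers, exactly
    as ranks add up. This plays the role of Weyl's inequality for the approximation numbers of a
    sum. *)
Definition interleave T (u v : nat -> T) n := if odd n then v n./2 else u n./2.

Lemma interleave_even T (u v : nat -> T) n : interleave u v n.*2 = u n.
Proof. by rewrite /interleave odd_double doubleK. Qed.

Lemma interleave_odd T (u v : nat -> T) n : interleave u v n.*2.+1 = v n.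
Proof. by rewrite /interleave /= odd_double /= uphalf_double. Qed.

(** Each summand is approximated within t/2; the factor 2 turns t/2 <= d i into t <= 2 d i. *)
Lemma appr_add d d' (T T' : W -> W) : appr d T -> appr d' T' ->
  appr (fun n => 2 * interleave d d' n) (fun x => T x + T' x).
Proof.
move=> hT hT' t t0; have t2 : 0 < t / 2 by rewrite divr_gt0.
have [r [a [b [ur hr h]]]] := hT _ t2.
have [r' [a' [b' [ur' hr' h']]]] := hT' _ t2.
exists ([seq n.*2 | n <- r] ++ [seq n.*2.+1 | n <- r']), (interleave a a'),
  (interleave b b'); split.
- rewrite cat_uniq (map_inj_uniq double_inj) ur (map_inj_uniq (f := fun n => n.*2.+1)).
    rewrite ur' andbT /=.
    apply/hasPn => _ /mapP[n _ ->]; apply/mapP => -[m _ /(congr1 odd)].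
    by rewrite /= !odd_double.
  by move=> x y [] /double_inj.
- move=> i; rewrite mem_cat => /orP[] /mapP[n nr ->].
    by rewrite interleave_even; have := hr _ nr; lra.
  by rewrite interleave_odd; have := hr' _ nr; lra.
- move=> x; rewrite /finite_rank big_cat /= !big_map.
  under eq_bigr do rewrite !interleave_even.
  under [X in _ + _ - (_ + X)]eq_bigr do rewrite !interleave_odd.
  rewrite opprD addrACA; apply: (le_trans (hnormD H _ _)).
  by have := h x; have := h' x; rewrite /finite_rank; lra.
Qed.

Lemma appr_opp d T : appr d T -> appr d (fun x => - T x).
Proof.
move=> hT t /hT[r [a [b [ur hr h]]]]; exists r, a, (fun i => - b i); split=> // x.
rewrite /finite_rank -(hnormN H) opprD opprK -sumrN.
by under eq_bigr do rewrite scalerN opprK; exact: h.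
Qed.

Lemma appr_compl d T (B : {linear W -> W}) M : 0 < M ->
  (forall x, N (B x) <= M * N x) -> appr d T -> appr (fun n => M * d n) (B \o T).
Proof.
move=> M0 hB hT t t0.
have [|r [a [b [ur hr h]]]] := hT (t / M); first by rewrite divr_gt0.
exists r, a, (B \o b); split => // [i /hr|x].
  by rewrite ler_pdivrMr // mulrC.
have -> : finite_rank r a (B \o b) x = B (finite_rank r a b x).
  by rewrite linear_sum; apply: eq_bigr => i _; rewrite linearZ.
rewrite /= -linearB; apply: (le_trans (hB _)).
apply: (@le_trans _ _ (M * (t / M * N x))); first by rewrite (ler_wpM2l (ltW M0)).
by rewrite mulrA [M * _]mulrC divfK ?gt_eqF.
Qed.

Lemma appr_compr d T (C C' : W -> W) M : 0 < M ->
  (forall x, N (C x) <= M * N x) -> (forall x y, ip (C x) y = ip x (C' y)) ->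
  appr d T -> appr (fun n => M * d n) (T \o C).
Proof.
move=> M0 hC hCC' hT t t0.
have [|r [a [b [ur hr h]]]] := hT (t / M); first by rewrite divr_gt0.
exists r, (C' \o a), b; split => // [i /hr|x].
  by rewrite ler_pdivrMr // mulrC.
have -> : finite_rank r (C' \o a) b x = finite_rank r a b (C x).
  by apply: eq_bigr => i _; rewrite hCC'.
apply: (le_trans (h _)); rewrite -mulrA ler_wpM2l ?(ltW t0) //.
by rewrite mulrC ler_pdivrMr // mulrC.
Qed.

(** The adjoint of the finite rank map exchanges [a] and [b], and passing to adjoints preserves the
    norm bound on the difference. *)
Lemma appr_adj d T T' : (forall x y, ip (T x) y = ip x (T' y)) ->
  appr d T -> appr d T'.
Proof.
move=> hTT' hT t /hT[r [a [b [ur hr h]]]]; exists r, b, a; split=> // x.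
move: x; apply: (@adj_bound _ _ _ H (fun x => T x - finite_rank r a b x)
  (fun x => T' x - finite_rank r b a x)) => // x y.
rewrite (ipBl H) (ipBr H) hTT' /finite_rank (ip_suml H) (ip_sumr H); congr (_ - _).
apply: eq_bigr => i _; rewrite (ipZl H) (ipZr H) mulrC; congr (_ * _).
exact: (ip_conj H).
Qed.

(* Otherwise, by a dimension count, the finite rank map kills a nonzero
   combination of the [e i], which [T] expands by at least [s]. *)
Lemma finite_rank_lower (T : {linear W -> W}) (S r : seq nat) (e a b : nat -> W) t s :
  uniq S -> 0 <= t -> t < s ->
  (forall i, i \in S -> N (e i) = 1) ->
  (forall i j, i \in S -> j \in S -> i != j -> ip (e i) (e j) = 0) ->
  (forall i j, i \in S -> j \in S -> i != j -> ip (T (e i)) (T (e j)) = 0) ->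
  (forall i, i \in S -> s <= N (T (e i))) ->
  (forall x, N (T x - finite_rank r a b x) <= t * N x) ->
  (size S <= size r)%N.
Proof.
move=> uS t0 ts he eo To Ts hF; rewrite leqNgt; apply/negP => rS.
(* Each row holds the pairings of one [e i] with the vectors [a]. With more rows than columns, a
   nonzero row vector [v] is killed by [M]; its entries become the coefficients [c] of the
   combination. *)
pose M := \matrix_(i < size S, j < size r) ip (e (nth 0%N S i)) (a (nth 0%N r j)).
have rk : \rank (kermx M) != 0%N.
  by rewrite mxrank_ker -lt0n subn_gt0 (leq_ltn_trans (rank_leq_col M)).
have /rowV0Pn[v vM v0] : kermx M != 0 by rewrite -mxrank_eq0.
have {}vM : v *m M = 0 by apply/sub_kermxP.
pose c i := if insub (index i S) is Some k then v 0 k else 0.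
have cnth (k : 'I_(size S)) : c (nth 0%N S k) = v 0 k.
  by rewrite /c index_uniq //; case: insubP => [u _ /val_inj ->//|]; rewrite ltn_ord.
set x := \sum_(i <- S) c i *: e i.
have Fx : finite_rank r a b x = 0.
  rewrite /finite_rank big_seq big1 // => i ir.
  have ir' : (index i r < size r)%N by rewrite index_mem.
  have := congr1 (fun A : 'M[R[i]]_(1, size r) => A 0 (Ordinal ir')) vM.
  rewrite !mxE => hv.
  suff -> : ip x (a i) = 0 by rewrite scale0r.
  rewrite -hv /x (ip_suml H) (big_nth 0%N) big_mkord; apply: eq_bigr => k _.
  by rewrite (ipZl H) cnth mxE /= nth_index.
have nx : N x ^+ 2 = \sum_(i <- S) normc (c i) ^+ 2.
  rewrite (sqr_hnorm_sum_orth H) // big_seq [RHS]big_seq.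
  by apply: eq_bigr => i iS; rewrite he // expr1n mulr1.
have nTx : s ^+ 2 * N x ^+ 2 <= N (T x) ^+ 2.
  rewrite nx linear_sum.
  under [in leRHS]eq_bigr do rewrite linearZ /=.
  rewrite (sqr_hnorm_sum_orth H) // mulr_sumr big_seq [leRHS]big_seq.
  apply: ler_sum => i iS; rewrite mulrC ler_wpM2l ?sqr_ge0 //.
  by rewrite ler_pXn2r ?nnegrE ?hnorm_ge0 ?Ts //; lra.
have x0 : 0 < N x ^+ 2.
  have /rV0Pn[k vk] := v0.
  rewrite nx (big_nth 0%N) big_mkord (bigD1 k) //= cnth ltr_pwDl //.
    rewrite exprn_gt0 // lt_def normc_ge0 andbT.
    by apply: contra vk => /eqP/eq0_normc ->.
  by apply: sumr_ge0 => i _; rewrite sqr_ge0.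
have := hF x; rewrite Fx subr0 => hTx.
have : N (T x) ^+ 2 <= t ^+ 2 * N x ^+ 2.
  rewrite -exprMn ler_pXn2r ?nnegrE ?hnorm_ge0 //.
  by rewrite mulr_ge0 ?hnorm_ge0.
move=> /(le_trans nTx); rewrite ler_pM2r // leNgt => /negP; apply.
by rewrite ltr_pXn2r ?nnegrE //; lra.
Qed.

End Approximation.

(** * Comparison of counting functions; the sequence ideals l^p and c_0 *)

Section Domination.
Variable R : realType.

(** A comparison of counting functions, #{s > t} <= #{d >= t}, phrased with finite lists of indices
    so that neither sequence has to be sorted or to tend to 0. The strict inequality leaves room for
    the gap t < s of [finite_rank_lower]. *)
Definition dominated (s d : nat -> R) := forall (S : seq nat) t, uniq S -> 0 < t ->
  (forall i, i \in S -> t < s i) ->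
  exists r, [/\ uniq r, forall i, i \in r -> t <= d i & (size S <= size r)%N].

Lemma seq_argmin (s : nat -> R) (S : seq nat) :
  S = [::] \/ exists2 j, j \in S & forall i, i \in S -> s j <= s i.
Proof.
elim: S => [|k S [->|[j jS hj]]]; [by left| |]; right.
  by exists k => [|i]; rewrite inE ?eqxx // => /eqP ->.
have [kj|/ltW jk] := leP (s k) (s j).
  exists k => [|i]; rewrite inE ?eqxx // => /orP[/eqP ->//|/hj].
  exact: le_trans.
by exists j => [|i]; rewrite inE ?jS ?orbT // => /orP[/eqP ->//|/hj].
Qed.

(** The images of the [e i] are orthogonal with norms [s i]. Over a finite [S] the least value [s j]
    still exceeds [t], and with it [finite_rank_lower] bounds the size of [S] by the rank of the
    approximation. *)
Lemma appr_dominated (W : lmodType R[i]) (ip : W -> W -> R[i]) (H : hilbert ip)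
  (P : pred nat) e d s (T : {linear W -> W}) :
  porth ip P e -> (forall i j, i != j -> ip (T (e i)) (T (e j)) = 0) ->
  (forall i, hnorm ip (T (e i)) = s i) -> (forall i, ~~ P i -> s i = 0) ->
  appr ip d T -> dominated s d.
Proof.
move=> he To Ts sP hT S t uS t0 hS.
have [r [a [b [ur hr h]]]] := hT _ t0.
exists r; split => //.
have [->//|[j jS hj]] := seq_argmin s S.
have tm : t < s j by exact: hS.
have PS i : i \in S -> P i.
  by move=> /hS; apply: contraLR => /sP ->; rewrite -leNgt ltW.
apply: (finite_rank_lower (e := e) (T := T) H uS (ltW t0) tm _ _ _ _ h) => [i iS|i k _ _ /negbTE ij|i k _ _|i iS].
- by rewrite (porth_hnorm i he) PS.
- by rewrite he ij.
- exact: To.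
- by rewrite Ts hj.
Qed.

(** Greedy matching, with the index [j] of the least value matched last. At least as many indices
    satisfy d >= s j / 2 as there are elements of [S], so one is still free once the others are
    matched. Halving, the source of the factor 2, makes the level strictly smaller than every
    [s i]. *)
Lemma dominated_injection (s d : nat -> R) (S : seq nat) : dominated s d -> uniq S ->
  (forall i, i \in S -> 0 < s i) ->
  exists f : nat -> nat, {in S &, injective f} /\ forall i, i \in S -> s i <= 2 * d (f i).
Proof.
move=> hd; have [n] := ubnP (size S); elim: n S => // n IH S Sn uS Spos.
have [->|[j jS hj]] := seq_argmin s S; first by exists id.
have [|f [finj hf]] := IH (rem j S) _ (rem_uniq j uS) (fun i h => Spos i (mem_rem h)).
  by rewrite size_rem // -ltnS prednK // lt0n size_eq0; case: (S) jS.
have sj := Spos j jS.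
have [||r [ur hr Sr]] := hd S (s j / 2) uS; first by rewrite divr_gt0.
  by move=> i /hj; lra.
have [k kr kf] : exists2 k, k \in r & k \notin [seq f i | i <- rem j S].
  apply/hasP; rewrite -[has _ _]negbK -all_predC; apply/negP => /allP h.
  have : (size r <= size [seq f i | i <- rem j S])%N.
    by apply: uniq_leq_size => // i /h /=; rewrite negbK.
  rewrite size_map size_rem //; case: (S) jS Sr => //= _ S' _.
  by move=> /leq_trans h1 /h1; rewrite ltnn.
have remP i : i \in S -> i != j -> i \in rem j S by rewrite mem_rem_uniq // inE => -> ->.
exists (fun i => if i == j then k else f i); split => [i i' iS i'S|i iS].
  case: (eqVneq i j) => [->|ij]; case: (eqVneq i' j) => [->//|i'j].
  - by move=> kfi; case/mapP: kf; exists i' => //; exact: remP.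
  - by move=> kfi; case/mapP: kf; exists i => //; exact: remP.
  - by apply: finj; exact: remP.
case: (eqVneq i j) => [->|ij]; last by apply: hf; exact: remP.
by have := hr _ kr; lra.
Qed.

Definition ell_seq (p : R) (d : nat -> R) :=
  (forall n, 0 <= d n) /\ cvgn (series (fun n => d n `^ p)).

Definition null_seq (d : nat -> R) := (forall n, 0 <= d n) /\ d @ \oo --> (0 : R).

Lemma null_seqP (d : nat -> R) : null_seq d <-> (forall n, 0 <= d n) /\
  forall eps, 0 < eps -> exists n0, forall n, (n0 <= n)%N -> d n < eps.
Proof.
split=> -[d0 h]; split => //.
  move=> eps e0; move/cvgrPdist_lt: h => /(_ _ e0)[n0 _ h]; exists n0 => n /h /=.
  by rewrite sub0r normrN ger0_norm.
apply/cvgrPdist_lt => eps /h[n0 {}h]; exists n0 => // n /h /=.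
by rewrite sub0r normrN ger0_norm.
Qed.

Lemma sum_uniq_le (F : nat -> R) (S : seq nat) : uniq S -> (forall n, 0 <= F n) ->
  exists n, \sum_(i <- S) F i <= \sum_(0 <= i < n) F i.
Proof.
move=> uS F0; exists (\max_(i <- S) i.+1).
rewrite (perm_big [seq i <- index_iota 0 (\max_(i <- S) i.+1) | i \in S]); last first.
  apply: uniq_perm => //; first by rewrite filter_uniq ?iota_uniq.
  move=> i; rewrite mem_filter mem_index_iota /=.
  case: (boolP (i \in S)) => //= iS.
  by rewrite (leq_bigmax_seq (F := fun i => i.+1) i iS).
rewrite /= big_filter big_mkcond /=; apply: ler_sum => i _.
by case: ifP.
Qed.

(** Bounds over arbitrary finite sets of indices are compatible with injections and with splitting
    by parity, which partial sums are not. *)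
Lemma ell_seqP (p : R) (d : nat -> R) :
  cvgn (series (fun n => d n `^ p)) <->
  exists B, forall S : seq nat, uniq S -> \sum_(i <- S) d i `^ p <= B.
Proof.
have nd : nondecreasing_seq (series (fun n => d n `^ p)).
  move=> m n mn; rewrite /series /= (big_cat_nat (leq0n m) mn) /= lerDl.
  by apply: sumr_ge0 => i _; exact: powR_ge0.
split => [h|[B hB]].
  exists (limn (series (fun n => d n `^ p))) => S uS.
  have [n hn] := sum_uniq_le uS (fun n => powR_ge0 (d n) p).
  by apply: (le_trans hn); exact: nondecreasing_cvgn_le.
apply: nondecreasing_is_cvgn => //; exists B => _ [n _ <-].
by rewrite /series /= /index_iota hB ?iota_uniq.
Qed.

Lemma dominated_ell (p : R) s d : 1 <= p -> (forall n, 0 <= s n) ->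
  ell_seq p d -> dominated s d -> ell_seq p s.
Proof.
move=> p1 s0 [d0 /ell_seqP[B hB]] sd; split => //.
have p0 : 0 < p by lra.
apply/ell_seqP; exists (2 `^ p * B) => S uS.
(* Only indices with 0 < s i can be matched; the others contribute nothing, as p > 0. *)
have -> : \sum_(i <- S) s i `^ p = \sum_(i <- S | 0 < s i) s i `^ p.
  rewrite (bigID (fun i => 0 < s i)) /=; set a := bigop _ _ _; rewrite -[RHS]addr0; congr (a + _).
  apply: big1.
  move=> i; rewrite -leNgt => si; have -> : s i = 0 by apply/eqP; rewrite eq_le si s0.
  by rewrite powR0 // gt_eqF.
rewrite -big_filter; set S' := [seq i <- S | 0 < s i].
have uS' : uniq S' by rewrite filter_uniq.
have [i|f [finj hf]] := dominated_injection sd uS'; first by rewrite mem_filter => /andP[].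
apply: (@le_trans _ _ (2 `^ p * \sum_(i <- [seq f i | i <- S']) d i `^ p)).
  rewrite big_map mulr_sumr big_seq [leRHS]big_seq; apply: ler_sum => i iS'.
  rewrite -powRM //; apply: ge0_ler_powR; rewrite ?nnegrE ?hf //; first lra.
  by rewrite mulr_ge0.
by rewrite ler_wpM2l ?powR_ge0 // hB // map_inj_in_uniq.
Qed.

(** Were infinitely many [s m] at least eps, n0 + 1 of them would force n0 + 1 distinct indices with
    d >= eps / 2, but all those lie below n0. *)
Lemma dominated_null s d : (forall n, 0 <= s n) ->
  null_seq d -> dominated s d -> null_seq s.
Proof.
move=> s0 /null_seqP[d0 hd] sd; apply/null_seqP; split => // eps e0.
have e2 : 0 < eps / 2 by rewrite divr_gt0.
have [n0 hn0] := hd _ e2.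
apply: contrapT => h.
have {}h n : exists2 m, (n <= m)%N & eps <= s m.
  apply: contrapT => h'; apply: h; exists n => m nm.
  by rewrite ltNge; apply/negP => em; apply: h'; exists m.
have [S [uS hS Ssz]] : exists S, [/\ uniq S, forall i, i \in S -> eps <= s i & size S = n0.+1].
  elim: n0.+1 => [|k [S [uS hS Sk]]]; first by exists [::].
  have [m hm em] := h (\max_(i <- S) i.+1).
  exists (m :: S); split => /=; rewrite ?Sk //.
    rewrite uS andbT; apply/negP => mS.
    by have := leq_trans (leq_bigmax_seq (F := fun i => i.+1) m mS isT) hm; rewrite ltnn.
  by move=> i; rewrite inE => /orP[/eqP ->|/hS].
have [|r [ur hr]] := sd S (eps / 2) uS e2.
  by move=> i /hS; lra.
rewrite Ssz leqNgt => /negP; apply; rewrite ltnS -[leqRHS](size_iota 0).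
apply: uniq_leq_size => // i /hr ti; rewrite mem_iota /= add0n ltnNge.
by apply/negP => /hn0; rewrite ltNge ti.
Qed.

Lemma interleave_sum (F : nat -> R) (S : seq nat) : uniq S ->
  exists S1 S2, [/\ uniq S1, uniq S2 & \sum_(i <- S) F i =
     \sum_(i <- S1) F i.*2 + \sum_(i <- S2) F i.*2.+1].
Proof.
move=> uS; exists [seq i./2 | i <- S & ~~ odd i], [seq i./2 | i <- S & odd i]; split.
- rewrite map_inj_in_uniq ?filter_uniq // => k j; rewrite !mem_filter.
  by move=> /andP[/negbTE ok _] /andP[/negbTE oj _] h; rewrite -[k]odd_double_half -[j]odd_double_half ok oj h.
- rewrite map_inj_in_uniq ?filter_uniq // => k j; rewrite !mem_filter.
  by move=> /andP[ok _] /andP[oj _] h; rewrite -[k]odd_double_half -[j]odd_double_half ok oj h.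
- rewrite !big_map !big_filter [LHS](bigID (fun i => ~~ odd i)) /=; congr (_ + _).
    by apply: eq_bigr => k /negbTE ok; rewrite -{1}[k]odd_double_half ok.
  rewrite (eq_bigl odd) => [|k]; last by rewrite negbK.
  by apply: eq_bigr => k ok; rewrite -{1}[k]odd_double_half ok.
Qed.

Lemma ell_interleave (p : R) d d' : ell_seq p d -> ell_seq p d' ->
  ell_seq p (interleave d d').
Proof.
move=> [d0 /ell_seqP[B hB]] [d0' /ell_seqP[B' hB']]; split.
  by move=> n; rewrite /interleave; case: ifP.
apply/ell_seqP; exists (B + B') => S uS.
have [S1 [S2 [u1 u2 ->]]] := interleave_sum (fun i => interleave d d' i `^ p) uS.
apply: lerD.
  by under eq_bigr do rewrite interleave_even; exact: hB.
by under eq_bigr do rewrite interleave_odd; exact: hB'.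
Qed.

Lemma null_interleave d d' : null_seq d -> null_seq d' -> null_seq (interleave d d').
Proof.
move=> /null_seqP[d0 h] /null_seqP[d0' h']; apply/null_seqP; split.
  by move=> n; rewrite /interleave; case: ifP.
move=> eps e0; have [n0 hn] := h _ e0; have [n1 hn'] := h' _ e0.
exists (maxn n0 n1).*2 => n hn2; rewrite /interleave.
have : (maxn n0 n1 <= n./2)%N by rewrite -[leqLHS]doubleK half_leq.
by rewrite geq_max => /andP[a b]; case: ifP => _; [exact: hn'|exact: hn].
Qed.

Lemma ell_scale (p M : R) d : 0 <= M -> ell_seq p d -> ell_seq p (fun n => M * d n).
Proof.
move=> M0 [d0 /ell_seqP[B hB]]; split; first by move=> n; rewrite mulr_ge0.
apply/ell_seqP; exists (M `^ p * B) => S uS.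
under eq_bigr do rewrite powRM //.
by rewrite -mulr_sumr ler_wpM2l ?powR_ge0 ?hB.
Qed.

Lemma null_scale (M : R) d : 0 <= M -> null_seq d -> null_seq (fun n => M * d n).
Proof.
move=> M0 [d0 hd]; split; first by move=> n; rewrite mulr_ge0.
by rewrite -[0](mulr0 M); apply: cvgM => //; exact: cvg_cst.
Qed.

Lemma ell_null (p : R) d : 1 <= p -> ell_seq p d -> null_seq d.
Proof.
move=> p1 [d0 hd]; apply/null_seqP; split => // eps e0.
have /cvgrPdist_lt := cvg_series_cvg_0 hd.
have ep : 0 < eps `^ p by rewrite powR_gt0.
move=> /(_ _ ep)[n0 _ h]; exists n0 => n /h /=.
rewrite sub0r normrN ger0_norm ?powR_ge0 // => hlt; rewrite ltNge; apply/negP => le.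
move: hlt; rewrite ltNge => /negP; apply.
by apply: ge0_ler_powR; rewrite ?nnegrE //; lra.
Qed.

End Domination.

(** * Oscillation of bounded sequences along an ultrafilter *)

Section UltraCauchy.
Variables (R : realType) (U : set_system nat).
Context {UU : UltraFilter U}.

Let PU : ProperFilter U := ultra_proper.

(** Compactness of [-B, B] gives a cluster point [l]. The set where |a n - l| < eps / 2 belongs to
    the ultrafilter: otherwise its complement does, against [l] being a cluster point. *)
Lemma ultra_bounded_real (a : nat -> R) B eps : (forall n, `|a n| <= B) -> 0 < eps ->
  exists2 A, U A & forall m n, A m -> A n -> `|a m - a n| < eps.
Proof.
move=> aB e0.
have hF : ProperFilter (a @ U) by exact: fmap_proper_filter.
have /(_ (a @ U) hF)[] : compact `[- B, B]%classic by exact: segment_compact.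
  rewrite /= nbhs_filterE /=; apply: filterE => n /=.
  by rewrite in_itv /= -ler_norml.
move=> l [_ hl].
have e2 : 0 < eps / 2 by rewrite divr_gt0.
have [hA|hA] := in_ultra_setVsetC [set n | `|a n - l| < eps / 2] UU.
  exists [set n | `|a n - l| < eps / 2] => // m n /= hm hn.
  rewrite -[a m - a n](subrKA l); apply: (le_lt_trans (ler_normD _ _)).
  by rewrite (distrC l); lra.
have [] := hl [set a n | n in ~` [set n | `|a n - l| < eps / 2]] (ball l (eps / 2)).
- apply: (@filterS _ U _ _ _ _ hA) => n hn /=.
  by exists n.
- exact: nbhsx_ballx.
move=> x [[n hn <-]]; rewrite /ball /= distrC => h; case: (hn h).
Qed.

Lemma ultra_bounded_complex (a : nat -> R[i]) B eps :
  (forall n, normc (a n) <= B) -> 0 < eps ->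
  exists2 A, U A & forall m n, A m -> A n -> normc (a m - a n) < eps.
Proof.
move=> aB e0; have e2 : 0 < eps / 2 by rewrite divr_gt0.
have hr n : `|complex.Re (a n)| <= B := le_trans (normc_Re _) (aB n).
have hi n : `|complex.Im (a n)| <= B := le_trans (normc_Im _) (aB n).
have [A1 U1 h1] := ultra_bounded_real hr e2.
have [A2 U2 h2] := ultra_bounded_real hi e2.
exists (A1 `&` A2); first exact: filterI.
move=> m n [m1 m2] [n1 n2].
have := h1 _ _ m1 n1; have := h2 _ _ m2 n2.
case: (a m) (a n) => x y [x' y'] /= hy hx.
rewrite -(@ltr_pXn2r _ 2) ?nnegrE ?sqrtr_ge0 ?(ltW e0) // sqr_sqrtr ?addr_ge0 ?sqr_ge0 //.
rewrite -(real_normK (num_real (x - x'))) -(real_normK (num_real (y - y'))).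
have := normr_ge0 (x - x'); have := normr_ge0 (y - y').
move: `|x - x'| `|y - y'| hx hy => u v; nra.
Qed.

End UltraCauchy.

(** * Compact operators and approximation by finite rank *)

Section Compact.
Variables (R : realType) (W : lmodType R[i]) (ip : W -> W -> R[i]).
Local Notation N := (hnorm ip).
Hypothesis H : hilbert ip.

Lemma hcvgP x y : hcvg ip x y <-> (fun n => N (x n - y)) @ \oo --> (0 : R).
Proof.
split=> [h|/cvgrPdist_lt h].
  apply/cvgrPdist_lt => eps /h[n0 {}h]; exists n0 => // n /h /=.
  by rewrite sub0r normrN ger0_norm // hnorm_ge0.
move=> eps /h[n0 _ {}h]; exists n0 => n /h /=.
by rewrite sub0r normrN ger0_norm // hnorm_ge0.
Qed.

Definition bdd (T : W -> W) := exists2 M, 0 < M & forall x, N (T x) <= M * N x.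

Lemma linear_opP (T : W -> W) : linear_op setT T <-> linear T.
Proof.
by split=> [[_ h] a x y|h]; [apply: h|split=> [//|a x y _ _]; apply: h].
Qed.

Lemma linear_packE (T : W -> W) : linear_op setT T ->
  exists T' : {linear W -> W}, (T' : W -> W) = T.
Proof.
move=> /linear_opP hT; pose Tm := GRing.isLinear.Build _ _ _ _ T hT.
by exists (HB.pack T Tm : {linear W -> W}).
Qed.

Lemma bounded_opP (T : {linear W -> W}) : bounded_op ip setT T <-> bdd T.
Proof.
split=> [[_ [M h]]|[M _ h]].
  exists (`|M| + 1) => [|x]; first by rewrite ltr_wpDl.
  apply: (le_trans (h x I)); rewrite ler_wpM2r ?hnorm_ge0 //.
  by have := ler_norm M; lra.
split; first by apply/linear_opP; exact: linearP.
by exists M => x _.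
Qed.

(** Induction on the rank: each coefficient of the [x n] is a bounded scalar sequence, nearly
    constant on a set of the ultrafilter. The ultrafilter spares one extraction of a subsequence for
    each rank and each tolerance. *)
Lemma finite_rank_ultra (U : set_system nat) (UU : UltraFilter U) (r : seq nat) a b
  (x : nat -> W) eps : (forall n, N (x n) <= 1) -> 0 < eps ->
  exists2 A, U A & forall m n, A m -> A n ->
    N (finite_rank ip r a b (x m) - finite_rank ip r a b (x n)) <= eps.
Proof.
have PU : ProperFilter U by exact: ultra_proper.
move=> hx; elim: r eps => [|i r IH] eps e0.
  exists setT; first exact: filterT.
  by move=> m n _ _; rewrite /finite_rank !big_nil subrr (hnorm0 H) ltW.
have e2 : 0 < eps / 2 by rewrite divr_gt0.
have [A1 U1 h1] := IH _ e2.
have B0 : 0 < N (b i) + 1 by rewrite ltr_wpDl ?hnorm_ge0.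
have [||A2 U2 h2] := @ultra_bounded_complex R U UU (fun n => ip (x n) (a i)) (N (a i)) (eps / 2 / (N (b i) + 1)).
- move=> n; apply: (le_trans (cauchy_schwarz H _ _)).
  by rewrite ler_piMl ?hnorm_ge0.
- by rewrite divr_gt0.
exists (A1 `&` A2); first exact: filterI.
move=> m n [m1 m2] [n1 n2]; rewrite /finite_rank !big_cons opprD addrACA -scalerBl.
apply: (le_trans (hnormD H _ _)); rewrite (hnormZ H).
have := h1 _ _ m1 n1; rewrite /finite_rank; set u := N (_ - _) => hu.
have := h2 _ _ m2 n2; rewrite ltr_pdivlMr // => hv.
have := normc_ge0 (ip (x m) (a i) - ip (x n) (a i)); have := hnorm_ge0 ip (b i); nra.
Qed.

Lemma appr_compact d (T : {linear W -> W}) :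
  null_seq d -> appr ip d T -> compact_op ip setT T.
Proof.
move=> hd hT; split; first by apply/linear_opP; exact: linearP.
move=> x hx; have {}hx n : N (x n) <= 1 by case: (hx n).
have [U [UU oU]] := @ultraFilterLemma nat \oo _.
have PU : ProperFilter U by exact: ultra_proper.
have hA eps : 0 < eps -> exists2 A, U A & forall m n, A m -> A n ->
    N (T (x m) - T (x n)) <= eps.
  move=> e0; have e3 : 0 < eps / 3 by rewrite divr_gt0.
  have [r [a [b [_ _ h]]]] := hT _ e3.
  have [A UA hA] := finite_rank_ultra UU r a b hx e3.
  exists A => // m n Am An; have hm := h (x m); have hn := h (x n).
  have := hA m n Am An; move: hm hn.
  set u := finite_rank _ _ _ _ _; set v := finite_rank _ _ _ _ _ => hm hn huv.
  have := hnorm_triangle H u (T (x m)) (T (x n)).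
  have := hnorm_triangle H v u (T (x n)); rewrite (hnormBC H v).
  have := hx m; have := hx n; nra.
have hA' (k : nat) : exists A, U A /\ forall m n, A m -> A n ->
    N (T (x m) - T (x n)) <= k.+1%:R^-1.
  by have [|A UA h] := hA k.+1%:R^-1; [rewrite invr_gt0 ltr0n|exists A].
have [A hAk] := choice hA'.
(* Decreasing sets of the ultrafilter: on [B k] the values [T (x n)] differ by at most 1 / (k + 1).
   As the ultrafilter refines [\oo], [B k] has elements beyond any bound, and a strictly increasing
   choice of [s k] in [B k] makes the images Cauchy. *)
pose B := fix B k : set nat := if k is k'.+1 then B k' `&` A k else A 0%N.
have UB k : U (B k).
  by elim: k => [|k IH]; [case: (hAk 0%N)|apply: filterI => //; case: (hAk k.+1)].
have BA k j n : (j <= k)%N -> B k n -> A j n.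
  elim: k => [|k IH] /=; first by rewrite leqn0 => /eqP ->.
  by rewrite leq_eqVlt ltnS => /orP[/eqP -> []//|jk [Bk _]]; exact: IH.
have hex (km : nat * nat) : exists n, (km.2 < n)%N /\ B km.1 n.
  have : U (B km.1 `&` [set n | (km.2 < n)%N]).
    by apply: filterI (UB _) (oU _ _); exists km.2.+1.
  by move=> /filter_ex[n [Bn kn]]; exists n.
have [g hg] := choice hex.
pose s := fix s k := if k is k'.+1 then g (k, s k') else g (0, 0)%N.
have sB k : B k (s k).
  by case: k => [|k]; [case: (hg (0, 0)%N)|case: (hg (k.+1, s k))].
have sS k : (s k < s k.+1)%N by case: (hg (k.+1, s k)).
exists s; first by apply: homo_ltn => // ???; exact: ltn_trans.
have [|y hy] := hilbert_complete H (x := fun n => T (x (s n))).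
  move=> eps e0.
  have [k hk] : exists k : nat, k.+1%:R^-1 < eps.
    have /cvgrPdist_lt /(_ _ e0)[k _ /(_ k (leqnn k))] := @cvg_harmonic R.
    by rewrite /= sub0r normrN ger0_norm // => h; exists k.
  exists k => m n km kn; apply: le_lt_trans hk.
  by apply: (hAk k).2; apply: BA (sB _).
by exists y => //; apply/hcvgP.
Qed.

(** Were [T] unbounded, normalizing would give vectors [x n] in the unit ball with |T (x n)| >= n,
    while a convergent subsequence of the images is bounded. *)
Lemma compact_bdd (T : {linear W -> W}) : compact_op ip setT T -> bdd T.
Proof.
move=> [_ hT]; apply: contrapT => h.
have hex (n : nat) : exists x, N x <= 1 /\ n%:R <= N (T x).
  apply: contrapT => hn; apply: h; exists n.+1%:R => [|x]; first by rewrite ltr0n.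
  have [x0|x0] := eqVneq (N x) 0.
    by rewrite (hilbert_def H x0) linear0 (hnorm0 H) mulr0.
  have xp : 0 < N x by rewrite lt_def x0 hnorm_ge0.
  rewrite leNgt; apply/negP => hlt; apply: hn; exists ((N x)^-1%:C *: x).
  rewrite linearZ /= !(hnormZ H) normc_real ger0_norm ?invr_ge0 ?(ltW xp) //.
  rewrite mulVf //; split => //; rewrite mulrC ler_pdivlMr //.
  by apply: le_trans (ltW hlt); rewrite ler_wpM2r ?(ltW xp) // ler_nat.
have [x hx] := choice hex.
have [|s hs [y _ /hcvgP /(_ _ ltr01)[n0 hn]]] := hT x.
  by move=> n; split => //; case: (hx n).
have sge k : (k <= s k)%N by elim: k => // k IH; apply: leq_ltn_trans IH _; exact: hs.
pose n1 := (Num.bound (N y + 1)); pose n2 := maxn n0 n1.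
have h1 := hn n2 (leq_maxl _ _).
have h2 := (hx (s n2)).2.
have h3 : N y + 1 < n1%:R.
  by apply: le_lt_trans (archi_boundP _); rewrite ?addr_ge0 ?hnorm_ge0.
have h4 : n1%:R <= (s n2)%:R :> R.
  by rewrite ler_nat; apply: leq_trans (sge _); exact: leq_maxr.
by have := ler_dist_hnorm H (T (x (s n2))) y; rewrite ler_norml; lra.
Qed.

End Compact.

(** * Singular values *)

Section Svd.
Variables (R : realType) (W : lmodType R[i]) (ip : W -> W -> R[i]).
Local Notation N := (hnorm ip).
Hypothesis H : hilbert ip.
Variables T T' : {linear W -> W}.
Hypothesis TT' : forall x y, ip (T x) y = ip x (T' y).

(** Unlike in [singular_values], the adjoint is fixed, [s] tends to 0, and [e n] is a null vector
    whenever [s n] is 0, so that sums over all indices need no case distinction. *)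
Definition svd (s : nat -> R) (e : nat -> W) :=
  [/\ null_seq s, nonincreasing_seq s,
      porth ip (fun n => 0 < s n) e,
      forall n, T' (T (e n)) = (s n ^+ 2)%:C *: e n
    & forall x, (forall n, ip x (e n) = 0) -> T x = 0].

Lemma svd_ip s e i j : svd s e -> ip (T (e i)) (T (e j)) = ((i == j)%:R * s i ^+ 2)%:C.
Proof.
case=> [[s0 _] _ he hT _]; rewrite -(adjC H TT') hT (ipZl H) he.
have [->|_] := eqVneq i j; last by rewrite mulr0 mul0r.
rewrite mul1r /=; have [//|] := ltP 0 (s j); first by rewrite mulr1.
move=> sj; have -> : s j = 0 by apply/eqP; rewrite eq_le sj s0.
by rewrite expr0n mulr0.
Qed.

Lemma svd_hnorm s e i : svd s e -> N (T (e i)) = s i.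
Proof.
move=> hs; have s0 : 0 <= s i by case: hs => -[].
by rewrite /hnorm (svd_ip i i hs) eqxx mul1r /= sqrtr_sqr ger0_norm.
Qed.

(** Keeping the finitely many terms with t <= s i leaves an orthogonal sum of vectors of norm at
    most t |<x, e i>|, bounded by Bessel. It serves both singular value decompositions and operators
    that are diagonal in a basis. *)
Lemma diag_appr (P : pred nat) s e M : porth ip P e ->
  (forall x, N (T x) <= M * N x) ->
  (forall i j, i != j -> ip (T (e i)) (T (e j)) = 0) ->
  (forall i, N (T (e i)) = s i) -> null_seq s ->
  (forall x, (forall n, ip x (e n) = 0) -> T x = 0) -> appr ip s T.
Proof.
move=> he hM To Ts /null_seqP[s0 hs] htot t t0.
have [n0 hn0] := hs _ t0.
pose r := [seq i <- iota 0 n0 | t <= s i].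
exists r, e, (T \o e); split => [|i|x].
- by rewrite filter_uniq ?iota_uniq.
- by rewrite mem_filter => /andP[].
have [y [hy xy]] := proj_ex H he x.
(* [x - y] is orthogonal to all [e n], and [T] vanishes on such vectors. *)
have -> : T x = T y.
  by apply/eqP; rewrite -subr_eq0 -linearB; apply/eqP/htot.
have -> : finite_rank ip r e (T \o e) x = T (\sum_(i <- r) ip x (e i) *: e i).
  by rewrite linear_sum; apply: eq_bigr => i _; rewrite linearZ.
(* Beyond [n0] all [s i] are below [t], so the partial sums contain every kept term; the bound on
   their remainder passes to the limit. *)
have hc := hcvg_img hM hy.
have hc' := hcvg_sub (T (\sum_(i <- r) ip x (e i) *: e i)) hc.
apply: (hcvg_ge H (n0 := n0) hc') => n nn /=.
rewrite -linearB -(@ler_pXn2r _ 2) ?nnegrE ?hnorm_ge0 ?mulr_ge0 ?hnorm_ge0 ?(ltW t0) //.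
rewrite (psum_nat e (fun i => ip x (e i))).
have -> : \sum_(i <- iota 0 n) ip x (e i) *: e i - \sum_(i <- r) ip x (e i) *: e i =
    \sum_(i <- [seq i <- iota 0 n | s i < t]) ip x (e i) *: e i.
  rewrite (bigID (fun i => t <= s i)) /= -[X in X + _ - _]big_filter.
  have -> : [seq i <- iota 0 n | t <= s i] = r.
    rewrite /r -(subnKC nn) iotaD filter_cat add0n.
    rewrite -[RHS]cats0; congr (_ ++ _); apply/eqP; rewrite -size_eq0 size_filter.
    rewrite -leqn0 leqNgt -has_count; apply/hasPn => i.
    by rewrite mem_iota => /andP[/hn0]; rewrite ltNge.
  rewrite addrAC subrr add0r big_filter; apply: eq_bigl => i.
  by rewrite ltNge.
set r' := [seq i <- iota 0 n | s i < t]; have ur' : uniq r' by rewrite filter_uniq ?iota_uniq.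
rewrite linear_sum.
under eq_bigr do rewrite linearZ /=.
rewrite (sqr_hnorm_sum_orth H (e := T \o e)) //=; last by move=> i j _ _; exact: To.
rewrite exprMn; apply: (@le_trans _ _ (t ^+ 2 * \sum_(i <- r') normc (ip x (e i)) ^+ 2)).
  rewrite mulr_sumr big_seq [leRHS]big_seq; apply: ler_sum => i.
  rewrite mem_filter => /andP[si _]; rewrite mulrC ler_wpM2r ?sqr_ge0 //.
  by rewrite Ts ler_pXn2r ?nnegrE ?s0 ?(ltW t0) ?(ltW si).
by rewrite ler_wpM2l ?sqr_ge0 // (bessel_le H _ he).
Qed.

Lemma svd_appr M s e : (forall x, N (T x) <= M * N x) -> svd s e -> appr ip s T.
Proof.
move=> hM hs; have [ns _ he _ htot] := hs.
apply: diag_appr he hM _ _ ns htot => [i j /negbTE ij|i].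
  by rewrite (svd_ip i j hs) ij mul0r.
exact: svd_hnorm hs.
Qed.

Lemma svd_dominated s e d : svd s e -> appr ip d T -> dominated s d.
Proof.
move=> hs; have [[s0 _] _ he _ _] := hs.
apply: (appr_dominated H he) => [i j /negbTE ij|i|i].
- by rewrite (svd_ip i j hs) ij mul0r.
- exact: svd_hnorm hs.
- by rewrite -leNgt => si; apply/eqP; rewrite eq_le si s0.
Qed.

Section Construction.
Hypothesis cT : compact_op ip setT T.

Let orth (l : seq W) x := forall v, v \in l -> ip x v = 0.
Let eigen (l : seq W) := forall v, v \in l -> exists a : R[i], T' (T v) = a *: v.

(** T'T is self-adjoint, so it preserves the orthogonal complement of its eigenvectors. *)
Lemma orth_TT l x : eigen l -> orth l x -> orth l (T' (T x)).
Proof.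
move=> hl hx v vl; have [a ha] := hl v vl.
by rewrite (adjC H TT') TT' ha (ipZr H) hx // mulr0.
Qed.

(** The supremum [s] of |T x| over the unit ball of the complement of [l] is attained. For a
    maximizing sequence, |T'T x - s^2 x|^2 <= 2 s^2 (s^2 - |T x|^2) tends to 0, and along a
    subsequence T x converges to some [y]; hence x converges to v = s^-2 T' y, a maximizer and an
    eigenvector. When s = 0 the zero vector is returned. *)
Lemma eigen_step l : eigen l -> exists sv : R * W,
  [/\ 0 <= sv.1, orth l sv.2, T' (T sv.2) = (sv.1 ^+ 2)%:C *: sv.2,
      N sv.2 = (0 < sv.1)%R%:R & forall x, orth l x -> N (T x) <= sv.1 * N x].
Proof.
move=> hl; have [M M0 hM] := compact_bdd H cT.
pose S := [set N (T x) | x in [set x | N x <= 1 /\ orth l x]].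
have hS : has_sup S.
  split; first by exists 0, 0; rewrite ?linear0 ?(hnorm0 H) //; split => [|v _]; rewrite ?(hnorm0 H) ?(ip0l H).
  by exists M => _ [x [x1 _] <-]; apply: (le_trans (hM x)); rewrite ler_piMr ?(ltW M0).
set s := sup S.
have Ss x : N x <= 1 -> orth l x -> N (T x) <= s.
  by move=> x1 ox; apply: ub_le_sup; [case: hS|exists x].
have hx (n : nat) : exists x, [/\ N x <= 1, orth l x & s - n.+1%:R^-1 < N (T x)].
  have [|_ [x [x1 ox] <-] h] := @sup_adherent _ S n.+1%:R^-1 _ hS; last by exists x.
  by rewrite invr_gt0 ltr0n.
clearbody s.
have s0 : 0 <= s.
  by rewrite -(hnorm0 H) -(linear0 T) Ss ?(hnorm0 H) // => v _; rewrite (ip0l H).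
have hs x : orth l x -> N (T x) <= s * N x.
  move=> ox; have [x0|x0] := eqVneq (N x) 0.
    by rewrite (hilbert_def H x0) linear0 (hnorm0 H) mulr0.
  have xp : 0 < N x by rewrite lt_def x0 hnorm_ge0.
  rewrite -ler_pdivrMr // mulrC.
  have -> : (N x)^-1 * N (T x) = N (T ((N x)^-1%:C *: x)).
    by rewrite linearZ /= (hnormZ H) normc_real ger0_norm ?invr_ge0 ?(ltW xp).
  apply: Ss => [|v vl]; last by rewrite (ipZl H) ox // mulr0.
  by rewrite (hnormZ H) normc_real ger0_norm ?invr_ge0 ?(ltW xp) // mulVf.
have [s00|sn0] := eqVneq s 0.
  exists (s, 0); split => //=; rewrite ?s00 ?linear0 ?scaler0 ?(hnorm0 H) ?ltxx //.
  by move=> v _; rewrite (ip0l H).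
have sp : 0 < s by rewrite lt_def sn0.
have key x : N x <= 1 -> orth l x ->
    N (T' (T x) - (s ^+ 2)%:C *: x) ^+ 2 <= 2 * s ^+ 2 * (s ^+ 2 - N (T x) ^+ 2).
  move=> x1 ox.
  have hB : N (T' (T x)) <= s * N (T x).
    have [->|B0] := eqVneq (N (T' (T x))) 0; first by rewrite mulr_ge0 ?hnorm_ge0.
    have Bp : 0 < N (T' (T x)) by rewrite lt_def B0 hnorm_ge0.
    rewrite -(ler_pM2r Bp) -expr2 (hnorm_sqr H) (adjC H TT').
    apply: (le_trans (ler_norm _)); apply: (le_trans (normc_Re _)).
    apply: (le_trans (cauchy_schwarz H _ _)).
    rewrite [s * _]mulrC -mulrA ler_wpM2l ?hnorm_ge0 //.
    by apply: hs; exact: orth_TT.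
  rewrite (sqr_hnormB H) (hnormZ H) normc_real ger0_norm ?sqr_ge0 // (ipZr H).
  rewrite (adjC H TT') (ipxx H) conjc_real -rmorphM /=.
  have Tx := hs x ox; have := hnorm_ge0 ip x; have := hnorm_ge0 ip (T x).
  have := hnorm_ge0 ip (T' (T x)).
  move: (N (T' (T x))) (N (T x)) (N x) hB Tx x1 => b t n hb ht n1 b0 t0 n0.
  have b2 : b ^+ 2 <= s ^+ 2 * t ^+ 2 by rewrite -exprMn ler_pXn2r ?nnegrE ?mulr_ge0.
  have t2 : t ^+ 2 <= s ^+ 2.
    by rewrite ler_pXn2r ?nnegrE //; apply: (le_trans ht); rewrite ler_piMr.
  have n2 : (s ^+ 2 * n) ^+ 2 <= s ^+ 2 * s ^+ 2.
    by rewrite exprMn -expr2 ler_piMr ?sqr_ge0 // expr_le1.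
  have : s ^+ 2 * t ^+ 2 <= s ^+ 2 * s ^+ 2 by rewrite ler_wpM2l ?sqr_ge0.
  rewrite mulr2n; nra.
have [x {}hx] := choice hx.
have [|g hg [y _ /hcvgP hy]] := cT.2 x; first by move=> n; case: (hx n).
have gge k : (k <= g k)%N by elim: k => // k IH; apply: leq_ltn_trans IH _; exact: hg.
have [M' M'0 hM'] : exists2 M', 0 < M' & forall y, N (T' y) <= M' * N y.
  by exists M => //; exact: (adj_bound H TT' hM).
have small eps : 0 < eps -> exists n0, forall n, (n0 <= n)%N -> s - eps < N (T (x (g n))).
  move=> e0; have /cvgrPdist_lt /(_ _ e0)[k _ hk] := @cvg_harmonic R.
  exists k => n kn; have [_ _] := hx (g n); apply: le_lt_trans.
  rewrite lerD2l lerNl opprK; have := hk _ (leq_trans kn (gge n)).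
  by rewrite /= sub0r normrN ger0_norm // => /ltW.
have key2 eps : 0 < eps -> exists n0, forall n, (n0 <= n)%N ->
    N (T' (T (x (g n))) - (s ^+ 2)%:C *: x (g n)) < eps.
  move=> e0.
  (* For |T x| <= s, the bound 2 s^2 (s^2 - |T x|^2) of [key] is at most 4 s^3 (s - |T x|). *)
  have d0 : 0 < eps ^+ 2 / (4 * s ^+ 3).
    by rewrite divr_gt0 ?exprn_gt0 // mulr_gt0 // exprn_gt0.
  have [n0 hn] := small _ d0; exists n0 => n /hn {}hn.
  rewrite -(@ltr_pXn2r _ 2) ?nnegrE ?hnorm_ge0 ?(ltW e0) //.
  have [x1 ox _] := hx (g n); apply: (le_lt_trans (key _ x1 ox)).
  have Tle := Ss _ x1 ox; have T0 := hnorm_ge0 ip (T (x (g n))).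
  move: hn; rewrite ltrBlDr -ltrBlDl ltr_pdivlMr; last by rewrite mulr_gt0 // exprn_gt0.
  move: (N (T (x (g n)))) Tle T0 => t ts t0 h; apply: le_lt_trans h.
  have -> : 2 * s ^+ 2 * (s ^+ 2 - t ^+ 2) = 2 * s ^+ 2 * ((s - t) * (s + t)) by ring.
  have -> : (s - t) * (4 * s ^+ 3) = 2 * s ^+ 2 * ((s - t) * (s + s)) by ring.
  rewrite ler_wpM2l ?mulr_ge0 ?sqr_ge0 // ler_wpM2l ?subr_ge0 //; lra.
pose v := ((s ^+ 2)^-1)%:C *: T' y.
have s2 : (s ^+ 2)%:C != 0 :> R[i].
  by apply/eqP => -[] /eqP; rewrite sqrf_eq0 (negbTE sn0).
have xv : hcvg ip (fun n => x (g n)) v.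
  move=> eps e0.
  have e2 : 0 < eps * s ^+ 2 / 2 by rewrite divr_gt0 // mulr_gt0 // exprn_gt0.
  have [n1 h1] := key2 _ e2; have [n2 h2] := hcvg_img hM' hy e2.
  exists (maxn n1 n2) => n; rewrite geq_max => /andP[/h1 {}h1 /h2 /= {}h2].
  have -> : x (g n) - v = ((s ^+ 2)^-1)%:C *: ((s ^+ 2)%:C *: x (g n) - T' y).
    by rewrite scalerBr scalerA -rmorphM mulVf ?sqrf_eq0 // scale1r.
  rewrite (hnormZ H) normc_real ger0_norm ?invr_ge0 ?sqr_ge0 //.
  rewrite mulrC ltr_pdivrMr ?exprn_gt0 //.
  have := hnorm_triangle H (T' (T (x (g n)))) ((s ^+ 2)%:C *: x (g n)) (T' y).
  by rewrite (hnormBC H _ (T' (T (x (g n))))); lra.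
have ov : orth l v.
  by move=> w wl; apply: (hcvg_ip H (n0 := 0) xv) => n _; case: (hx (g n)) => _ + _; apply.
have v1 : N v <= 1.
  by apply: (hcvg_ge H (n0 := 0) xv) => n _; case: (hx (g n)).
have Tv : T v = y by apply: (hcvg_uniq H (hcvg_img hM xv) hy).
have Tvs : s <= N (T v).
  apply: le_limit => eps e0; have e2 : 0 < eps / 2 by rewrite divr_gt0.
  have [n1 h1] := small _ e2; have [n2 h2] := hy _ e2.
  have {}h1 := h1 _ (leq_maxl n1 n2); have {}h2 := h2 _ (leq_maxr n1 n2).
  have := ler_dist_hnorm H (T (x (g (maxn n1 n2)))) y.
  by rewrite Tv ler_norml; lra.
exists (s, v); split => //=.
- apply/eqP; rewrite -subr_eq0; apply/eqP/(hilbert_def H)/eqP.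
  rewrite -sqrf_eq0 eq_le sqr_ge0 andbT; apply: (le_trans (key v v1 ov)).
  rewrite pmulr_rle0 ?subr_le0 ?mulr_gt0 ?exprn_gt0 //.
  by rewrite ler_pXn2r ?nnegrE ?hnorm_ge0.
- rewrite sp; apply/eqP; rewrite eq_le v1 /=.
  by have := le_trans Tvs (hs v ov); rewrite -{1}[s]mulr1 ler_pM2l.
Qed.

(** [eigen_step] is iterated on the list of vectors already found. If [s] stayed above some eps, the
    orthogonal vectors [T (e n)], of norm at least eps, would have no convergent subsequence; and a
    vector orthogonal to all [e n] satisfies |T x| <= s n |x| for every n, so T x = 0. *)
Lemma svd_ex : exists s e, svd s e.
Proof.
(* The implication sits under the existential so that choice yields a function defined on all
   lists. *)
have hstep l : exists sv : R * W, eigen l ->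
  [/\ 0 <= sv.1, orth l sv.2, T' (T sv.2) = (sv.1 ^+ 2)%:C *: sv.2,
      N sv.2 = (0 < sv.1)%R%:R & forall x, orth l x -> N (T x) <= sv.1 * N x].
  have [hl|hl] := pselect (eigen l); last by exists (0, 0).
  by have [sv hsv] := eigen_step hl; exists sv.
have [f hf] := choice hstep.
pose l := fix l n := if n is m.+1 then rcons (l m) (f (l m)).2 else [::].
have el n : eigen (l n).
  elim: n => [v|n IH v] //=; rewrite mem_rcons inE => /orP[/eqP ->|/IH //].
  by have [_ _ -> _ _] := hf _ IH; eexists.
pose s n := (f (l n)).1; pose e n := (f (l n)).2.
have hP n := hf _ (el n).
have el_in i n : (i < n)%N -> e i \in l n.
  elim: n => // n IH; rewrite ltnS leq_eqVlt /= mem_rcons inE => /orP[/eqP ->|/IH ->].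
    by rewrite eqxx.
  by rewrite orbT.
have l_in n v : v \in l n -> exists i, v = e i.
  elim: n => // n IH /=; rewrite mem_rcons inE => /orP[/eqP ->|/IH //].
  by exists n.
have s0 n : 0 <= s n by case: (hP n).
have Ne n : N (e n) = (0 < s n)%R%:R by case: (hP n).
have he : porth ip (fun n => 0 < s n) e.
  have hlt i j : (i < j)%N -> ip (e j) (e i) = 0.
    by move=> ij; have [_ h _ _ _] := hP j; apply: h; exact: el_in.
  move=> i j; have [->|] := eqVneq i j.
    by rewrite /= (ipxx H) Ne; case: (0 < s j); rewrite ?expr1n ?expr0n.
  rewrite neq_lt => /orP[/hlt|/hlt //] h.
  by rewrite (ip_conj H) h conjc0.
have TTe n : T' (T (e n)) = (s n ^+ 2)%:C *: e n by case: (hP n).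
have Tes n : N (T (e n)) = s n.
  have [s_0|sn0] := ltP 0 (s n); last first.
    have -> : e n = 0 by apply: (hilbert_def H); rewrite Ne ltNge sn0.
    by rewrite linear0 (hnorm0 H); apply/eqP; rewrite eq_le s0 sn0.
  rewrite /hnorm -(adjC H TT') TTe (ipZl H) he eqxx s_0 mulr1 /=.
  by rewrite sqrtr_sqr ger0_norm.
have nis : nonincreasing_seq s.
  apply/nonincreasing_seqP => n.
  have [_ h _ _ _] := hP n.+1; have [_ _ _ _ hb] := hP n.
  rewrite -Tes; apply: le_trans (hb (e n.+1) _) _.
    by move=> v vl; apply: h; rewrite /= mem_rcons inE vl orbT.
  by rewrite Ne; case: (_ < _); rewrite ?mulr1 ?mulr0.
have ns : null_seq s.
  apply/null_seqP; split => // eps e0; apply: contrapT => h.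
  have {}h n : eps <= s n.
    rewrite leNgt; apply/negP => sn; apply: h; exists n => m nm.
    exact: le_lt_trans (nis _ _ nm) sn.
  have sp n : 0 < s n by exact: lt_le_trans e0 (h n).
  have [|g hg [y _ /hcvgP hy]] := cT.2 e; first by move=> n; rewrite Ne sp.
  have e2 : 0 < eps / 2 by rewrite divr_gt0.
  have [n0 hn] := hy _ e2.
  have h1 := hn _ (leqnn n0); have h2 := hn _ (leqnSn n0).
  have : N (T (e (g n0)) - T (e (g n0.+1))) < eps.
    have := hnorm_triangle H y (T (e (g n0))) (T (e (g n0.+1))).
    by rewrite (hnormBC H y); lra.
  rewrite -(@ltr_pXn2r _ 2) ?nnegrE ?hnorm_ge0 ?(ltW e0) // (sqr_hnormB H) !Tes.
  rewrite -(adjC H TT') TTe (ipZl H) he.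
  have /negbTE -> : g n0 != g n0.+1 by rewrite neq_ltn hg.
  rewrite mulr0 mul0rn subr0.
  have := h (g n0); have := h (g n0.+1); nra.
exists s, e; split => // x hx.
apply: (hilbert_def H); apply/eqP; rewrite eq_le hnorm_ge0 andbT.
apply: le_limit => eps e0; rewrite add0r.
have [_ /(_ (eps / (N x + 1)))[|n0 hn]] := (null_seqP s).1 ns.
  by rewrite divr_gt0 // ltr_wpDl ?hnorm_ge0.
have [_ _ _ _ hb] := hP n0.
apply: le_trans (hb x _) _; first by move=> v /l_in[i ->].
have := hn _ (leqnn n0); rewrite ltr_pdivlMr ?ltr_wpDl ?hnorm_ge0 // => h.
by apply: le_trans (ltW h); rewrite ler_wpM2l ?s0 // lerDl.
Qed.

End Construction.
End Svd.

(** * Operators which are diagonal along a U + S_p basis *)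

Section Ideals.
Variable R : realType.

(** What the argument needs of l^p and of c_0, so that the Schatten case and the compact case share
    one proof. *)
Record seq_ideal (I : (nat -> R) -> Prop) : Prop := SeqIdeal {
  ideal_scale : forall M d, 0 <= M -> I d -> I (fun n => M * d n) ;
  ideal_interleave : forall d d', I d -> I d' -> I (interleave d d') ;
  ideal_dominated : forall s d, (forall n, 0 <= s n) -> I d -> dominated s d -> I s ;
  ideal_null : forall d, I d -> null_seq d }.

Lemma ell_ideal (p : R) : 1 <= p -> seq_ideal (ell_seq p).
Proof.
move=> p1; split.
- by move=> M d M0; exact: ell_scale.
- exact: ell_interleave.
- by move=> s d; exact: dominated_ell.
- by move=> d; exact: ell_null.
Qed.

Lemma null_ideal : seq_ideal (@null_seq R).
Proof.
split=> //.
- by move=> M d M0; exact: null_scale.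
- exact: null_interleave.
- by move=> s d; exact: dominated_null.
Qed.

Variables (W : lmodType R[i]) (ip : W -> W -> R[i]).
Local Notation N := (hnorm ip).
Hypothesis H : hilbert ip.

Lemma schatten_appr p (T : {linear W -> W}) : 1 <= p -> schatten ip setT p T ->
  exists2 s, ell_seq p s & appr ip s T.
Proof.
move=> p1 [[_ [M hM]] [s [s0 nis [T0 [e [[[T0lin _] TT'] he orth tot]]]] hs]].
have hells : ell_seq p s by split.
exists s => //.
have [T' hT'] := linear_packE T0lin.
have adj x y : ip (T x) y = ip x (T' y) by rewrite hT' TT'.
(* Where [s n] is 0, [singular_values] imposes no orthogonality on [e n]; replacing it by 0 there
   gives a [porth] family. *)
pose e' n := if 0 < s n then e n else 0.
have he' : porth ip (fun n => 0 < s n) e'.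
  move=> i j; rewrite /e'; have [si|si] := ltP 0 (s i); last by rewrite (ip0l H) andbF.
  rewrite andbT; have [sj|sj] := ltP 0 (s j); first exact: orth.
  rewrite (ip0r H); case: eqP => // ij.
  by move: sj; rewrite -ij leNgt si.
apply: (@svd_appr _ _ _ H T T' adj M s e'); first by move=> x; exact: hM.
split => //; first exact: ell_null hells.
  move=> n; rewrite /e'; case: ifP => _; first by rewrite hT' (he n).2.
  by rewrite !linear0.
by move=> x hx; apply: tot => // n sn; have := hx n; rewrite /e' sn.
Qed.

(** [d] may differ from the sequence of singular values. It tends to 0, so [T] is compact and has a
    decomposition; the true singular values are dominated by [d], hence p-summable. *)
Lemma appr_schatten p (T T' : {linear W -> W}) d : 1 <= p -> bdd ip T ->
  (forall x y, ip (T x) y = ip x (T' y)) -> ell_seq p d -> appr ip d T ->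
  schatten ip setT p T.
Proof.
move=> p1 bT TT' hd hT.
have cT := appr_compact H (ell_null p1 hd) hT.
have [s [e hs]] := svd_ex H TT' cT.
have [[s0 _] nis he hTe htot] := hs.
have [_ hells] := dominated_ell p1 s0 hd (svd_dominated H TT' hs hT).
split; first by apply/bounded_opP.
exists s => //; split => //; exists T', e; split => //.
- split => //; apply/bounded_opP; have [M M0 hM] := bT.
  by exists M => //; exact: (adj_bound H TT' hM).
- by move=> n; split => //; rewrite hTe.
- by move=> i j si sj; rewrite he si andbT.
- move=> x _ hx; apply: htot => n; have [/hx//|sn] := ltP 0 (s n).
  by rewrite (ip_porth0 H he) // -leNgt.
Qed.

Variable e : nat -> W.
Hypothesis he : orthonormal_basis ip setT e.

Lemma compact_appr (T : {linear W -> W}) : compact_op ip setT T ->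
  exists2 s, null_seq s & appr ip s T.
Proof.
move=> cT; have [M _ hM] := compact_bdd H cT.
have [T' TT'] := adjoint_ex H he hM.
have [s [f hs]] := svd_ex H TT' cT.
by exists s; [case: hs|exact: svd_appr hM hs].
Qed.

Variable I : (nat -> R) -> Prop.
Hypothesis hI : seq_ideal I.

Definition in_ideal (T : W -> W) := exists2 d, I d & appr ip d T.

Lemma in_ideal_add T T' : in_ideal T -> in_ideal T' -> in_ideal (fun x => T x + T' x).
Proof.
move=> [d Id hd] [d' Id' hd']; exists (fun n => 2 * interleave d d' n).
  by apply: (ideal_scale hI) => //; exact: (ideal_interleave hI).
exact: (appr_add H).
Qed.

Lemma in_ideal_sub T T' : in_ideal T -> in_ideal T' -> in_ideal (fun x => T x - T' x).
Proof.
move=> hT [d Id hd]; apply: (in_ideal_add hT).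
by exists d => //; exact: (appr_opp H).
Qed.

Lemma in_ideal_compl T (B : {linear W -> W}) : bdd ip B -> in_ideal T -> in_ideal (B \o T).
Proof.
move=> [M M0 hM] [d Id hd]; exists (fun n => M * d n).
  by apply: (ideal_scale hI) => //; exact: ltW.
exact: (appr_compl M0 hM).
Qed.

Lemma in_ideal_compr T (C : {linear W -> W}) : bdd ip C -> in_ideal T -> in_ideal (T \o C).
Proof.
move=> [M M0 hM] [d Id hd]; exists (fun n => M * d n).
  by apply: (ideal_scale hI) => //; exact: ltW.
have [C' hC'] := adjoint_ex H he hM.
exact: (appr_compr M0 hM hC').
Qed.

Lemma in_ideal_adj T T' : (forall x y, ip (T x) y = ip x (T' y)) ->
  in_ideal T -> in_ideal T'.
Proof. by move=> h [d Id hd]; exists d => //; exact: (appr_adj H h). Qed.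

Lemma bdd_add T T' : bdd ip T -> bdd ip T' -> bdd ip (fun x => T x + T' x).
Proof.
move=> [M M0 hM] [M' M'0 hM']; exists (M + M'); first exact: addr_gt0.
move=> x; apply: (le_trans (hnormD H _ _)).
by have := hM x; have := hM' x; rewrite mulrDl; lra.
Qed.

Lemma bdd_opp T : bdd ip T -> bdd ip (fun x => - T x).
Proof. by move=> [M M0 hM]; exists M => // x; rewrite (hnormN H). Qed.

Lemma bdd_comp T T' : bdd ip T -> bdd ip T' -> bdd ip (T \o T').
Proof.
move=> [M M0 hM] [M' M'0 hM']; exists (M * M'); first exact: mulr_gt0.
move=> x /=; apply: (le_trans (hM _)).
by rewrite -mulrA ler_wpM2l ?(ltW M0).
Qed.

Lemma bdd_adj T T' : (forall x y, ip (T x) y = ip x (T' y)) -> bdd ip T -> bdd ip T'.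
Proof. by move=> h [M M0 hM]; exists M => //; exact: (adj_bound H h hM). Qed.

Variables (L : {linear W -> W}) (k : nat -> W).
Hypotheses (bL : bdd ip L) (IL : in_ideal L) (hk : forall n, k n = e n + L (e n)).

(* If [A] is diagonalized by [e + L e], it differs from the corresponding
   diagonal operator [D] in the basis [e] by [L D - A L]. *)
Lemma eigen_diag (A D : {linear W -> W}) d : bdd ip A -> bdd ip D ->
  (forall n, A (k n) = d n *: k n) -> (forall n, D (e n) = d n *: e n) ->
  in_ideal (fun x => A x - D x).
Proof.
move=> bA bD hA hD.
(* The map [S] below is A (1 + L) - (1 + L) D. It kills every [e n], because k n = (1 + L) (e n) is
   an eigenvector of [A] for [d n]; being bounded, it is 0. *)
pose B := (A \o L) \- (L \o D).
pose S := (A \- D) \+ B.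
have bS : bdd ip S.
  apply: (bdd_add (bdd_add bA (bdd_opp bD))).
  by apply: bdd_add; [exact: bdd_comp|apply: bdd_opp; exact: bdd_comp].
have S0 x : S x = 0.
  have [M _ hM] := bS; apply: (@lin_eq0 _ _ _ H e he S M hM) => n.
  rewrite /S /B /= !hD.
  have -> : L (d n *: e n) = d n *: L (e n) by rewrite linearZ.
  have -> : A (e n) = d n *: k n - A (L (e n)) by rewrite -hA -linearB hk addrK.
  rewrite hk scalerDr; set a := d n *: e n; set b := d n *: L _; set c := A _.
  by rewrite [a + b - c - a]addrAC [a + b - a]addrAC subrr add0r addrA subrK subrr.
have -> : (fun x => A x - D x) = (fun x => (L \o D) x - (A \o L) x).
  apply/funext => x; have /eqP := S0 x; rewrite /S /B /= addr_eq0 => /eqP ->.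
  by rewrite opprB.
by apply: in_ideal_sub; [exact: in_ideal_compr|exact: in_ideal_compl].
Qed.

(** The second summand is diagonalized only through its adjoint, so [D2] is taken as the adjoint of
    the diagonal operator [D2']. The sum [D] is diagonal in [e] with entries d n + g n: domination
    reads these off any approximation of [D], and truncation to the large entries approximates it
    back. *)
Lemma in_ideal_diag (A1 A2 A2' A : {linear W -> W}) (d g : nat -> R[i]) M :
  bdd ip A1 -> bdd ip A2' -> (forall x y, ip (A2 x) y = ip x (A2' y)) ->
  (forall n, normc (d n) <= M) -> (forall n, normc (g n) <= M) ->
  (forall n, A1 (k n) = d n *: k n) -> (forall n, A2' (k n) = conjc (g n) *: k n) ->
  (forall x, A x = A1 x + A2 x) ->
  in_ideal A <-> I (fun n => normc (d n + g n)).
Proof.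
move=> bA1 bA2' adj2 hd hg h1 h2 hA.
have M0 : 0 <= M := le_trans (normc_ge0 _) (hd 0%N).
have mkbdd (T : W -> W) : (forall x, N (T x) <= M * N x) -> bdd ip T.
  move=> h; exists (M + 1); first by rewrite ltr_wpDl.
  by move=> x; apply: (le_trans (h x)); rewrite ler_wpM2r ?hnorm_ge0 // lerDl.
have [D1 [hD1 _ bD1]] := diag_ex H he hd.
have hg' n : normc (conjc (g n)) <= M by rewrite normc_conj.
have [D2' [hD2' hD2i bD2']] := diag_ex H he (d := fun n => conjc (g n)) hg'.
have [D2 adjD2] := adjoint_ex H he bD2'.
have hD2 n : D2 (e n) = g n *: e n.
  apply: (ip_eqr H) => y.
  by rewrite (ipZr H) -adjD2 hD2i.
have I1 := eigen_diag bA1 (mkbdd _ bD1) h1 hD1.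
have I2' := eigen_diag bA2' (mkbdd _ bD2') h2 hD2'.
have I2 : in_ideal (fun x => A2 x - D2 x).
  apply: in_ideal_adj I2' => x y.
  by rewrite (ipBl H) (ipBr H) (adjC H adj2) adjD2.
pose D := D1 \+ D2.
have hD n : D (e n) = (d n + g n) *: e n by rewrite /D /= hD1 hD2 scalerDl.
have IAD : in_ideal (fun x => A x - D x).
  have -> : (fun x => A x - D x) = (fun x => (A1 x - D1 x) + (A2 x - D2 x)).
    by apply/funext => x; rewrite hA opprD addrACA.
  exact: in_ideal_add.
have [MD _ hMD] : bdd ip D.
  by apply: bdd_add; [exact: mkbdd|exact: (bdd_adj adjD2 (mkbdd _ bD2'))].
have pe := onb_porth he.
have Do i j : i != j -> ip (D (e i)) (D (e j)) = 0.
  by move=> /negbTE ij; rewrite !hD (ipZl H) (ipZr H) pe ij !mulr0.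
have ND i : N (D (e i)) = normc (d i + g i).
  by rewrite hD (hnormZ H) (porth_hnorm i pe) mulr1.
split=> [IA|If].
  have [s Is hs] : in_ideal D.
    have -> : (D : W -> W) = (fun x => A x - (A x - D x)).
      by apply/funext => x; rewrite opprB addrC subrK.
    exact: in_ideal_sub.
  apply: (ideal_dominated hI _ Is) => [n|]; first exact: normc_ge0.
  exact: (appr_dominated H pe Do ND _ hs).
have -> : (A : W -> W) = (fun x => (A x - D x) + D x).
  by apply/funext => x; rewrite subrK.
apply: in_ideal_add => //; exists (fun n => normc (d n + g n)) => //.
apply: (diag_appr H pe hMD Do ND (ideal_null hI If)) => x hx.
by rewrite (onb_total he hx) linear0.
Qed.

End Ideals.

(** * The equivalence for abstract operators on a Hilbert space *)

Section AbstractTheorem.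
Variables (R : realType) (W : lmodType R[i]) (ip : W -> W -> R[i]).
Hypothesis H : hilbert ip.
Variables (A1 A2 A1' A2' A : {linear W -> W}) (d g : nat -> R[i]) (M : R) (k : nat -> W).
Hypotheses (bA1 : bdd ip A1) (bA2' : bdd ip A2').
Hypotheses (adj1 : forall x y, ip (A1 x) y = ip x (A1' y))
  (adj2 : forall x y, ip (A2 x) y = ip x (A2' y)).
Hypotheses (hd : forall n, normc (d n) <= M) (hg : forall n, normc (g n) <= M).
Hypotheses (h1 : forall n, A1 (k n) = d n *: k n)
  (h2 : forall n, A2' (k n) = conjc (g n) *: k n).
Hypothesis hA : forall x, A x = A1 x + A2 x.

(** Absorbs the unitary: with V = U^-1, k n = (1 + L V) (U (e n)), and U e is again an orthonormal
    basis, so the case U = 1 is enough. *)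
Lemma unitary_shift (U L : W -> W) e : unitary_op ip setT U -> linear_op setT L ->
  orthonormal_basis ip setT e -> (forall n, k n = U (e n) + L (e n)) ->
  exists V : {linear W -> W}, [/\ bdd ip V, orthonormal_basis ip setT (U \o e)
    & forall n, k n = (U \o e) n + (L \o V) ((U \o e) n)].
Proof.
move=> [Ulin Uip Usurj] Llin [_ eo etot] hk.
have [U' hU'] := linear_packE Ulin.
have NU x : hnorm ip (U' x) = hnorm ip x by rewrite /hnorm hU' Uip.
have Uinj x y : U' x = U' y -> x = y.
  move=> /eqP; rewrite -subr_eq0 -linearB => /eqP h.
  by apply/eqP; rewrite -subr_eq0; apply/eqP/(hilbert_def H); rewrite -NU h (hnorm0 H).
have hV y : exists x, U' x = y by rewrite hU'; have [x _ <-] := Usurj y I; exists x.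
have [V UV] := choice hV.
have Vlin : linear V by move=> a x y; apply: Uinj; rewrite linearP !UV.
pose Vm := GRing.isLinear.Build _ _ _ _ V Vlin.
pose V' : {linear W -> W} := HB.pack V Vm.
have VU x : V' (U x) = x by apply: Uinj; rewrite /= UV hU'.
exists V'; split.
- by exists 1 => // x; rewrite mul1r -NU /= UV.
- split=> // [i j|x _ hx]; first by rewrite /= Uip.
  have <- : U' (V x) = x by exact: UV.
  rewrite (etot (V x)) ?linear0 // => n.
  by rewrite -(Uip (V x)) // -hU' UV hU'; exact: hx.
- by move=> n; rewrite [LHS]hk /= -[V (U (e n))]/(V' (U (e n))) VU.
Qed.

Lemma abstract_main :
  (forall p : R, 1 <= p -> US_basis ip setT (schatten ip setT p) k ->
     (schatten ip setT p A <-> ell p (fun n => d n + g n))) /\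
  (US_basis ip setT (compact_op ip setT) k ->
     (compact_op ip setT A <-> (fun n => normc (d n + g n)) @ \oo --> (0 : R))).
Proof.
have bA2 : bdd ip A2 by apply: bdd_adj bA2' => //; exact: adjC adj2.
have bA : bdd ip A.
  have [B B0 hB] := bdd_add H bA1 bA2.
  by exists B => // x; rewrite hA; exact: hB.
pose A' := A1' \+ A2'.
have adjA x y : ip (A x) y = ip x (A' y).
  by rewrite hA (ipDl H) (ipDr H) adj1 adj2.
split=> [p p1|] [U [L [e [hU hL he hk]]]].
  have [L' hL'] := linear_packE hL.1.1.
  have [V [bV he' hk']] := unitary_shift hU hL.1.1 he hk.
  have hI := ell_ideal p1.
  rewrite -hL' in hL hk'.
  have [s Is hs] := schatten_appr H p1 hL.
  have IL : in_ideal ip (ell_seq p) (L' \o V).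
    by apply: (in_ideal_compr H he' hI bV); exists s.
  have bL' : bdd ip L' by apply/bounded_opP; exact: hL.1.
  have [i1 i2] := in_ideal_diag H he' hI (bdd_comp bL' bV) IL hk' bA1 bA2' adj2 hd hg h1 h2 hA.
  split=> [hS|hl].
    have [t It ht] := schatten_appr H p1 hS.
    have IA : in_ideal ip (ell_seq p) A by exists t.
    by have [] := i1 IA.
  have [|t It ht] := i2; first by split=> // n; exact: normc_ge0.
  exact: (appr_schatten H p1 bA adjA It ht).
have [L' hL'] := linear_packE hL.1.
have [V [bV he' hk']] := unitary_shift hU hL.1 he hk.
have hI := @null_ideal R.
rewrite -hL' in hL hk'.
have [s Is hs] := compact_appr H he hL.
have IL : in_ideal ip (@null_seq R) (L' \o V).
  by apply: (in_ideal_compr H he' hI bV); exists s.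
have bL' : bdd ip L' by exact: compact_bdd.
have [i1 i2] := in_ideal_diag H he' hI (bdd_comp bL' bV) IL hk' bA1 bA2' adj2 hd hg h1 h2 hA.
split=> [hS|hl].
  have [t It ht] := compact_appr H he hS.
  have IA : in_ideal ip (@null_seq R) A by exists t.
  by have [] := i1 IA.
have [|t It ht] := i2; first by split=> // n; exact: normc_ge0.
exact: (appr_compact H It ht).
Qed.

End AbstractTheorem.

(** * Operators on a subspace *)

Section Subspace.
Variables (R : realType) (V : lmodType R[i]) (K : set V).

Definition subspace := K 0 /\ forall (a : R[i]) x y, K x -> K y -> K (a *: x + y).

Definition in_subspace (hK : subspace) : {pred V} := fun x => `[< K x >].

Lemma in_subspace_closed hK : submod_closed (in_subspace hK).
Proof.
have [K0 KL] := hK; split; first exact/asboolP.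
by move=> a x y /asboolP hx /asboolP hy; apply/asboolP; exact: KL.
Qed.

(** A subspace becomes a module in its own right, so that the abstract theory applies with [setT] in
    place of [K]. *)
Record subspace_type (hK : subspace) :=
  SubspaceType { subspace_val : V ; _ : in_subspace hK subspace_val }.

End Subspace.

HB.instance Definition _ (R : realType) (V : lmodType R[i]) (K : set V) (hK : subspace K) :=
  GRing.isSubmodClosed.Build R[i] V (in_subspace hK) (in_subspace_closed hK).

HB.instance Definition _ (R : realType) (V : lmodType R[i]) (K : set V) (hK : subspace K) :=
  [isSub for (@subspace_val R V K hK)].

HB.instance Definition _ (R : realType) (V : lmodType R[i]) (K : set V) (hK : subspace K) :=
  [Choice of (subspace_type hK) by <:].

HB.instance Definition _ (R : realType) (V : lmodType R[i]) (K : set V) (hK : subspace K) :=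
  [SubChoice_isSubLmodule of (subspace_type hK) by <:].

Section Transfer.
Variables (R : realType) (V : lmodType R[i]) (K : set V) (ip : V -> V -> R[i]).
Hypothesis hK : subspace K.
Local Notation W := (subspace_type hK).
Local Notation sv := (@subspace_val R V K hK).

Lemma sv_inj : injective sv. Proof. exact: val_inj. Qed.

Definition sub_ip (x y : W) := ip (sv x) (sv y).

Lemma val_in (x : W) : K (sv x).
Proof. by apply/asboolP; exact: (valP x). Qed.

Definition to_sub (v : V) : W := insubd 0 v.

Lemma to_subK v : K v -> sv (to_sub v) = v.
Proof. by move=> Kv; apply: insubdK; apply/asboolP. Qed.

Lemma svD (x y : W) : sv (x + y) = sv x + sv y. Proof. exact: (raddfD (val : W -> V)). Qed.
Lemma svZ a (x : W) : sv (a *: x) = a *: sv x. Proof. by rewrite -[LHS]/(val (a *: x)) linearZ. Qed.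
Lemma sv0 : sv 0 = 0. Proof. exact: (raddf0 (val : W -> V)). Qed.
Lemma svB x y : sv (x - y) = sv x - sv y. Proof. exact: (raddfB (val : W -> V)). Qed.

Lemma sv_sum I (r : seq I) (P : pred I) (F : I -> W) :
  sv (\sum_(i <- r | P i) F i) = \sum_(i <- r | P i) sv (F i).
Proof. exact: (big_morph sv svD sv0). Qed.

Definition restrict (T : V -> V) : W -> W := fun w => to_sub (T (sv w)).

Definition extend (S : W -> W) : V -> V := fun v => sv (S (to_sub v)).

(** A relation, because only the values of [T : V -> V] on [K] matter and many maps represent the
    same operator. *)
Definition related (T : V -> V) (S : W -> W) := forall w, sv (S w) = T (sv w).

Lemma to_val (w : W) : to_sub (sv w) = w.
Proof. by apply: sv_inj; rewrite to_subK //; exact: val_in. Qed.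

Lemma related_restrict T : (forall x, K x -> K (T x)) -> related T (restrict T).
Proof. by move=> hT w; rewrite /restrict to_subK //; apply/hT/val_in. Qed.

Lemma related_extend S : related (extend S) S.
Proof. by move=> w; rewrite /extend to_val. Qed.

Lemma related_linear T S : related T S -> linear_op K T <-> linear_op setT S.
Proof.
move=> h; split=> [[hT1 hT2]|[_ hS]].
  split=> // a x y _ _; apply: sv_inj.
  by rewrite (h (a *: x + y)) !svD !svZ hT2 ?(h x) ?(h y) //; exact: val_in.
split=> [x Kx|a x y Kx Ky].
  by rewrite -(to_subK Kx) -h; exact: val_in.
have := congr1 sv (hS a (to_sub x) (to_sub y) I I).
by rewrite (h (_ + _)) !svD !svZ (h (to_sub x)) (h (to_sub y)) !to_subK.
Qed.

Lemma related_bounded T S : related T S ->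
  bounded_op ip K T <-> bounded_op sub_ip setT S.
Proof.
move=> h; split=> -[/(related_linear h) hl [M hM]]; split=> //; exists M.
  by move=> x _; rewrite /hnorm /sub_ip h; apply: hM; exact: val_in.
move=> x Kx; have := hM (to_sub x) I.
by rewrite /hnorm /sub_ip h to_subK.
Qed.

Lemma related_adjoint T S T' S' : related T S -> related T' S' ->
  adjoint_op ip K T T' <-> adjoint_op sub_ip setT S S'.
Proof.
move=> h h'; split=> -[/(related_bounded h') hb hadj]; split=> // x y.
  by move=> _ _; rewrite /sub_ip h h'; apply: hadj; exact: val_in.
move=> Kx Ky; have := hadj (to_sub x) (to_sub y) I I.
by rewrite /sub_ip h h' !to_subK.
Qed.

Lemma related_compact T S : related T S ->
  compact_op ip K T <-> compact_op sub_ip setT S.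
Proof.
move=> h; split=> -[/(related_linear h) hl hc]; split=> // x hx.
  have [|s hs [y Ky hy]] := hc (fun n => sv (x n)).
    by move=> n; split; [exact: val_in|case: (hx n)].
  exists s => //; exists (to_sub y) => //.
  under eq_fun do rewrite /hnorm /sub_ip svB (h (x _)) (to_subK Ky).
  exact: hy.
have [|s hs [y Ky hy]] := hc (fun n => to_sub (x n)).
  move=> n; split => //; have [Kx] := hx n.
  by rewrite /hnorm /sub_ip to_subK.
exists s => //; exists (sv y); first exact: val_in.
have Kx n : K (x n) by case: (hx n).
move: hy; under eq_fun do rewrite /hnorm /sub_ip svB (h (to_sub _)) to_subK //.
exact.
Qed.

Lemma related_singular T S s : related T S ->
  singular_values ip K T s <-> singular_values sub_ip setT S s.
Proof.
move=> h; split=> -[s0 nis [T' [e [hadj he orth tot]]]]; split=> //.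
  have h' := related_restrict hadj.1.1.1.
  exists (restrict T'), (fun n => to_sub (e n)); split.
  - by apply/(related_adjoint h h').
  - move=> n; split => //; have [Ke eig] := he n; apply: sv_inj.
    by rewrite h' h svZ to_subK.
  - by move=> i j si sj; rewrite /sub_ip !to_subK ?orth //; case: (he i); case: (he j).
  - move=> x _ hx; apply: sv_inj; rewrite h tot ?sv0 //; first exact: val_in.
    by move=> n sn; rewrite -(hx n sn) /sub_ip to_subK //; case: (he n).
have h' := related_extend T'.
exists (extend T'), (fun n => sv (e n)); split.
- by apply/(related_adjoint h h').
- by move=> n; split; [exact: val_in|rewrite -h -h' (he n).2 svZ].
- exact: orth.
- move=> x Kx hx; rewrite -(to_subK Kx) -h tot ?sv0 // => n sn.
  by rewrite /sub_ip to_subK // hx.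
Qed.

Lemma related_schatten p T S : related T S ->
  schatten ip K p T <-> schatten sub_ip setT p S.
Proof.
move=> h; split=> -[/(related_bounded h) hb [s /(related_singular s h) hs hp]];
  by split=> //; exists s.
Qed.

(** Besides the transfer, the decomposition k n = U (e n) + L (e n) shows that the [k n] belong to
    [K], which is how the kernels get into the model space. *)
Lemma related_US_basis (P : (V -> V) -> Prop) (Q : (W -> W) -> Prop) k :
  (forall T, P T -> linear_op K T) -> (forall T S, related T S -> P T -> Q S) ->
  US_basis ip K P k ->
  (forall n, K (k n)) /\ US_basis sub_ip setT Q (fun n => to_sub (k n)).
Proof.
move=> Plin PQ [U [L [e [[Ulin Uip Usurj] hL [Ke eo etot] hk]]]].
have Llin := Plin _ hL.
have hU := related_restrict Ulin.1; have hLr := related_restrict Llin.1.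
have Kk n : K (k n).
  by rewrite hk -[U _]scale1r; apply: hK.2; [exact: Ulin.1|exact: Llin.1].
split=> //; exists (restrict U), (restrict L), (fun n => to_sub (e n)); split.
- split; first by apply/(related_linear hU).
    by move=> x y _ _; rewrite /sub_ip !hU Uip //; exact: val_in.
  move=> y _; have [x Kx hx] := Usurj (sv y) (val_in y).
  by exists (to_sub x) => //; apply: sv_inj; rewrite hU to_subK.
- exact: PQ hL.
- split=> // [i j|x _ hx]; first by rewrite /sub_ip !to_subK.
  apply: sv_inj; rewrite sv0; apply: etot; first exact: val_in.
  by move=> n; rewrite -(hx n) /sub_ip to_subK.
- by move=> n; apply: sv_inj; rewrite svD hU hLr !to_subK.
Qed.

End Transfer.

(** * Green's theorem for pointwise differentiable forms *)

Section RealIntegral.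
Variable R : realType.
Implicit Types (f g F : R -> R) (a b c : R).

Definition ri a b f := \int[@lebesgue_measure R]_(x in `[a, b]) f x.

Definition cont_on a b f := forall x, a <= x <= b -> {for x, continuous f}.

Lemma cont_on_within a b f : cont_on a b f -> {within `[a, b], continuous f}.
Proof.
move=> h; apply: continuous_in_subspaceT => x; rewrite inE /= in_itv /=.
exact: h.
Qed.

Lemma cont_on_integrable a b f : cont_on a b f ->
  (@lebesgue_measure R).-integrable `[a, b] (EFin \o f).
Proof.
move=> h; apply: continuous_compact_integrable; first exact: segment_compact.
exact: cont_on_within.
Qed.

Lemma cont_on_sub a b c d f : a <= c -> d <= b -> cont_on a b f -> cont_on c d f.
Proof.
move=> ac db h x /andP[cx xd]; apply: h.
by rewrite (le_trans ac cx) (le_trans xd db).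
Qed.

Lemma ri_split a b c f : a <= c -> c <= b -> cont_on a b f ->
  ri a b f = ri a c f + ri c b f.
Proof.
move=> ac cb h; rewrite /ri.
rewrite -(@Rintegral_itv_obnd_cbnd _ c _ f); last first.
  apply: (integrableS _ _ _ (cont_on_integrable (cont_on_sub ac (lexx b) h))) => //.
  exact: subset_itv_oc_cc.
rewrite -(Rintegral_itvB (cont_on_integrable h)) ?bnd_simp //.
by rewrite addrC subrK.
Qed.

Lemma ri_lin a b f g k : cont_on a b f -> cont_on a b g ->
  ri a b (fun x => f x + k * g x) = ri a b f + k * ri a b g.
Proof.
move=> hf hg; rewrite /ri RintegralD ?RintegralZl //; try exact: cont_on_integrable.
by apply: cont_on_integrable => x hx; apply: continuousM (hg x hx); exact: cst_continuous.
Qed.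

Lemma ri_cst a b (k : R) : a <= b -> ri a b (fun=> k) = k * (b - a).
Proof.
move=> ab; rewrite /ri Rintegral_cst //= lebesgue_measure_itv /= lte_fin.
move: ab; rewrite le_eqVlt => /orP[/eqP ->|->]; last by [].
by rewrite ltxx /= subrr.
Qed.

Lemma ri_ge0_bound a b f g : a <= b -> cont_on a b f -> cont_on a b g ->
  (forall x, a <= x <= b -> f x <= g x) -> ri a b f <= ri a b g.
Proof.
move=> ab hf hg h; apply: le_Rintegral => //; try exact: cont_on_integrable.
Qed.

Lemma ri_bound a b f M : a <= b -> cont_on a b f ->
  (forall x, a <= x <= b -> `|f x| <= M) -> `|ri a b f| <= M * (b - a).
Proof.
move=> ab hf hM; rewrite ler_norml -mulNr -!ri_cst //.
have hc k : cont_on a b (fun=> k) by move=> x _; exact: cst_continuous.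
by apply/andP; split; apply: ri_ge0_bound => // x /hM; rewrite ler_norml => /andP[].
Qed.

Lemma ri_FTC a b f F : a <= b -> cont_on a b f ->
  (forall x : R, is_derive x (1 : R) F (f x)) -> ri a b f = F b - F a.
Proof.
rewrite le_eqVlt => /orP[/eqP <-|ab] hf hF.
  by rewrite /ri set_itv1 Rintegral_set1 subrr.
have dF x : derivable F x 1 by [].
rewrite /ri /Rintegral (@continuous_FTC2 _ f F a b ab) //.
- exact: cont_on_within.
- split=> //.
  + by apply: cvg_at_right_filter; apply: differentiable_continuous; exact/derivable1_diffP.
  + by apply: cvg_at_left_filter; apply: differentiable_continuous; exact/derivable1_diffP.
- by move=> x _; rewrite derive1E; exact: derive_val.
Qed.

(** The subtracted term is the exact integral of the affine function, from the primitive p x + (q /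
    2) (x - x0)^2. *)
Lemma ri_affine a b f p q x0 E : a <= b -> cont_on a b f ->
  (forall x, a <= x <= b -> `|f x - (p + q * (x - x0))| <= E) ->
  `|ri a b f - (p * (b - a) + q * (((b - x0) ^+ 2 - (a - x0) ^+ 2) / 2))| <= E * (b - a).
Proof.
move=> ab hf hE.
pose g x := p + q * (x - x0).
have hg : cont_on a b g.
  move=> x _; rewrite /g; apply: continuousD; first exact: cst_continuous.
  apply: continuousM; first exact: cst_continuous.
  by apply: continuousB => //; exact: cst_continuous.
have -> : p * (b - a) + q * (((b - x0) ^+ 2 - (a - x0) ^+ 2) / 2) = ri a b g.
  pose F x := p * x + (q / 2) * (x - x0) ^+ 2.
  have -> : ri a b g = F b - F a; last by rewrite /F; field.
  apply: ri_FTC => // x; rewrite /F; apply: is_derive_eq.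
  by rewrite /g /= /GRing.scale /=; field.
rewrite -[- ri a b g]mulN1r -ri_lin //.
apply: ri_bound => // [x hx|x /hE]; last by rewrite mulN1r.
apply: continuousD; first exact: hf.
by apply: continuousM; [exact: cst_continuous|exact: hg].
Qed.

End RealIntegral.

Section Green.
Variable R : realType.
Implicit Types (f P Q : R -> R -> R).

Definition diff2 f (x0 y0 A B : R) := forall eps : R, 0 < eps ->
  exists2 delta : R, 0 < delta & forall x y, `|x - x0| < delta -> `|y - y0| < delta ->
    `|f x y - (f x0 y0 + A * (x - x0) + B * (y - y0))| <= eps * (`|x - x0| + `|y - y0|).

Lemma diff2_swap f x0 y0 A B : diff2 f x0 y0 A B -> diff2 (fun y x => f x y) y0 x0 B A.
Proof.
move=> h eps /h[d d0 {}h]; exists d => // y x hy hx.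
by rewrite addrAC [in leRHS]addrC; exact: h.
Qed.

Lemma diff2_continuous f x0 y0 A B : diff2 f x0 y0 A B ->
  {for x0, continuous (f ^~ y0)}.
Proof.
move=> h; apply/(@cvgrPdist_le R R) => eps e0.
have [d d0 {}h] := h 1 ltr01.
have k0 : 0 < 1 + `|A| by rewrite ltr_wpDr.
near=> x.
have hx : `|x - x0| < d.
  by rewrite distrC; near: x; apply/nbhs_ballP; exists d.
have hx2 : `|x - x0| < eps / (1 + `|A|).
  by rewrite distrC; near: x; apply/nbhs_ballP; exists (eps / (1 + `|A|)) => //=; rewrite divr_gt0.
have := h x y0 hx; rewrite subrr normr0 mulr0 !addr0 mul1r => /(_ d0) {}h.
rewrite distrC -[f x y0 - f x0 y0](addrNK (A * (x - x0))).
apply: (le_trans (ler_normD _ _)); rewrite normrM.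
rewrite -[f x y0 - _ - _]addrA -opprD.
move: hx2; rewrite ltr_pdivlMr //; lra.
Unshelve. all: by end_near.
Qed.

(** The integral of the form P dx + Q dy, counterclockwise around the rectangle. *)
Definition circulation P Q x1 x2 y1 y2 :=
  ri x1 x2 (P ^~ y1) + ri y1 y2 (Q x2) - ri x1 x2 (P ^~ y2) - ri y1 y2 (Q x1).

Section Rectangle.
Variables (P Q : R -> R -> R) (X1 X2 Y1 Y2 : R).
Hypotheses (X12 : X1 <= X2) (Y12 : Y1 <= Y2).
(** The common [m] expresses that the y-derivative of [P] equals the x-derivative of [Q]. The
    derivatives exist at each point without any continuity, so they cannot simply be integrated;
    Goursat's subdivision is used instead. *)
Hypothesis closed_form : forall x y, X1 <= x <= X2 -> Y1 <= y <= Y2 ->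
  exists p m q, diff2 P x y p m /\ diff2 Q x y m q.

Let contP y : Y1 <= y <= Y2 -> cont_on X1 X2 (P ^~ y).
Proof.
by move=> hy x hx; have [p [m [q [h _]]]] := closed_form hx hy; exact: diff2_continuous h.
Qed.

Let contQ x : X1 <= x <= X2 -> cont_on Y1 Y2 (Q x).
Proof.
move=> hx y hy; have [p [m [q [_ h]]]] := closed_form hx hy.
exact: (diff2_continuous (diff2_swap h)).
Qed.

Let J := circulation P Q.

Let circ_split_x x1 c x2 y1 y2 : X1 <= x1 -> x1 <= c -> c <= x2 -> x2 <= X2 ->
  Y1 <= y1 -> y1 <= y2 -> y2 <= Y2 ->
  J x1 x2 y1 y2 = J x1 c y1 y2 + J c x2 y1 y2.
Proof.
move=> *; rewrite /J /circulation.
rewrite (@ri_split _ x1 x2 c (P ^~ y1)) // ?(@ri_split _ x1 x2 c (P ^~ y2)) //; first ring.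
- by apply: cont_on_sub (contP _) => //; apply/andP; split; lra.
- by apply: cont_on_sub (contP _) => //; apply/andP; split; lra.
Qed.

Let circ_split_y x1 x2 y1 c y2 : X1 <= x1 -> x1 <= x2 -> x2 <= X2 ->
  Y1 <= y1 -> y1 <= c -> c <= y2 -> y2 <= Y2 ->
  J x1 x2 y1 y2 = J x1 x2 y1 c + J x1 x2 c y2.
Proof.
move=> *; rewrite /J /circulation.
rewrite (@ri_split _ y1 y2 c (Q x1)) // ?(@ri_split _ y1 y2 c (Q x2)) //; first ring.
- by apply: cont_on_sub (contQ _) => //; apply/andP; split; lra.
- by apply: cont_on_sub (contQ _) => //; apply/andP; split; lra.
Qed.

(* Around a point the form is closed up to a linear error, so the circulation
   of a small rectangle is of smaller order than its squared size. *)
Let circ_local x0 y0 (eps : R) : X1 <= x0 <= X2 -> Y1 <= y0 <= Y2 -> 0 < eps ->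
  exists2 delta : R, 0 < delta & forall x1 x2 y1 y2,
    X1 <= x1 -> x1 <= x0 -> x0 <= x2 -> x2 <= X2 ->
    Y1 <= y1 -> y1 <= y0 -> y0 <= y2 -> y2 <= Y2 ->
    x2 - x1 < delta -> y2 - y1 < delta ->
    `|J x1 x2 y1 y2| <= 2 * eps * ((x2 - x1) + (y2 - y1)) ^+ 2.
Proof.
move=> hx0 hy0 e0; have [p [m [q [hP hQ]]]] := closed_form hx0 hy0.
have [d1 d10 h1] := hP _ e0; have [d2 d20 h2] := hQ _ e0.
exists (Num.min d1 d2); first by rewrite lt_min d10.
move=> x1 x2 y1 y2 a1 a2 a3 a4 b1 b2 b3 b4; rewrite !lt_min => /andP[w1 w2] /andP[v1 v2].
set w := x2 - x1; set v := y2 - y1; set E := eps * (w + v).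
have dx x : x1 <= x <= x2 -> `|x - x0| <= w.
  by move=> /andP[? ?]; rewrite ler_norml /w; apply/andP; split; lra.
have dy y : y1 <= y <= y2 -> `|y - y0| <= v.
  by move=> /andP[? ?]; rewrite ler_norml /v; apply/andP; split; lra.
have hPy y : y1 <= y <= y2 -> forall x, x1 <= x <= x2 ->
    `|P x y - ((P x0 y0 + m * (y - y0)) + p * (x - x0))| <= E.
  move=> hy x hx; rewrite -addrA [m * _ + _]addrC addrA.
  apply: le_trans (h1 x y _ _) _.
  - exact: le_lt_trans (dx x hx) w1.
  - exact: le_lt_trans (dy y hy) v1.
  - by rewrite ler_wpM2l ?(ltW e0) // lerD // ?dx // dy.
have hQx x : x1 <= x <= x2 -> forall y, y1 <= y <= y2 ->
    `|Q x y - ((Q x0 y0 + m * (x - x0)) + q * (y - y0))| <= E.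
  move=> hx y hy; apply: le_trans (h2 x y _ _) _.
  - exact: le_lt_trans (dx x hx) w2.
  - exact: le_lt_trans (dy y hy) v2.
  - by rewrite ler_wpM2l ?(ltW e0) // lerD // ?dx // dy.
have x12 : x1 <= x2 by lra.
have y12 : y1 <= y2 by lra.
have cP y : y1 <= y <= y2 -> cont_on x1 x2 (P ^~ y).
  by move=> /andP[? ?]; apply: cont_on_sub (contP _) => //; apply/andP; split; lra.
have cQ x : x1 <= x <= x2 -> cont_on y1 y2 (Q x).
  by move=> /andP[? ?]; apply: cont_on_sub (contQ _) => //; apply/andP; split; lra.
have Y1y : y1 <= y1 <= y2 by rewrite lexx.
have Y2y : y1 <= y2 <= y2 by rewrite lexx y12.
have X1x : x1 <= x1 <= x2 by rewrite lexx.
have X2x : x1 <= x2 <= x2 by rewrite lexx x12.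
have r1 := ri_affine x12 (cP _ Y1y) (hPy _ Y1y).
have r2 := ri_affine x12 (cP _ Y2y) (hPy _ Y2y).
have r3 := ri_affine y12 (cQ _ X1x) (hQx _ X1x).
have r4 := ri_affine y12 (cQ _ X2x) (hQx _ X2x).
rewrite /J /circulation.
set A1 := ri _ _ _ in r1 *; set A2 := ri _ _ _ in r4 *.
set A3 := ri _ _ _ in r2 *; set A4 := ri _ _ _ in r3 *.
move: r1 r2 r3 r4; rewrite -/w -/v.
set B1 := (_ + _ * (_ / 2)); set B3 := (_ + _ * (_ / 2)).
set B4 := (_ + _ * (_ / 2)); set B2 := (_ + _ * (_ / 2)) => r1 r2 r3 r4.
(* The affine approximations of [P] and [Q] make up a closed form themselves: their circulation
   vanishes and only the errors remain. *)
have B0 : B1 + B2 - B3 - B4 = 0 by rewrite /B1 /B2 /B3 /B4 /w /v; ring.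
have -> : A1 + A2 - A3 - A4 = (A1 - B1) + (A2 - B2) - (A3 - B3) - (A4 - B4).
  by rewrite -[LHS]subr0 -B0; ring.
have -> : 2 * eps * (w + v) ^+ 2 = E * w + E * v + E * w + E * v by rewrite /E; ring.
apply: (le_trans (ler_normB _ _)); apply: lerD => //.
apply: (le_trans (ler_normB _ _)); apply: lerD => //.
by apply: (le_trans (ler_normD _ _)); apply: lerD.
Qed.

Let rect := (R * R * (R * R))%type.
Let JR (r : rect) := J r.1.1 r.1.2 r.2.1 r.2.2.
Let inR (r : rect) := [/\ X1 <= r.1.1, r.1.1 <= r.1.2, r.1.2 <= X2 &
  [/\ Y1 <= r.2.1, r.2.1 <= r.2.2 & r.2.2 <= Y2]].

(** The circulations of the four quarters add up to that of the rectangle, so one of them has at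
    least a quarter of its absolute value. *)
Let quarter (r : rect) : inR r -> exists r' : rect,
  [/\ inR r', r.1.1 <= r'.1.1 /\ r'.1.2 <= r.1.2, r.2.1 <= r'.2.1 /\ r'.2.2 <= r.2.2,
   r'.1.2 - r'.1.1 = (r.1.2 - r.1.1) / 2 /\ r'.2.2 - r'.2.1 = (r.2.2 - r.2.1) / 2
   & `|JR r| <= 4 * `|JR r'|].
Proof.
case: r => [[x1 x2] [y1 y2]]; rewrite /inR /= => -[a1 a2 a3 [b1 b2 b3]].
set c := (x1 + x2) / 2; set d := (y1 + y2) / 2.
have c1 : x1 <= c by rewrite /c; lra.
have c2 : c <= x2 by rewrite /c; lra.
have d1 : y1 <= d by rewrite /d; lra.
have d2 : d <= y2 by rewrite /d; lra.
have cX1 := le_trans a1 c1; have cX2 := le_trans c2 a3.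
have dY1 := le_trans b1 d1; have dY2 := le_trans d2 b3.
have e1 : c - x1 = (x2 - x1) / 2 by rewrite /c; field.
have e2 : x2 - c = (x2 - x1) / 2 by rewrite /c; field.
have e3 : d - y1 = (y2 - y1) / 2 by rewrite /d; field.
have e4 : y2 - d = (y2 - y1) / 2 by rewrite /d; field.
have E : JR (x1, x2, (y1, y2)) = JR (x1, c, (y1, d)) + JR (x1, c, (d, y2))
    + JR (c, x2, (y1, d)) + JR (c, x2, (d, y2)).
  rewrite /JR /= (@circ_split_x x1 c x2) // (@circ_split_y x1 c y1 d y2) //.
  rewrite (@circ_split_y c x2 y1 d y2) //.
  by rewrite !addrA.
have T : `|JR (x1, x2, (y1, y2))| <= `|JR (x1, c, (y1, d))| + `|JR (x1, c, (d, y2))|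
    + `|JR (c, x2, (y1, d))| + `|JR (c, x2, (d, y2))|.
  rewrite E; apply: (le_trans (ler_normD _ _)); rewrite lerD2r.
  apply: (le_trans (ler_normD _ _)); rewrite lerD2r; exact: ler_normD.
have [h|h1] := leP `|JR (x1, x2, (y1, y2))| (4 * `|JR (x1, c, (y1, d))|).
  by exists (x1, c, (y1, d)); do ?split.
have [h|h2] := leP `|JR (x1, x2, (y1, y2))| (4 * `|JR (x1, c, (d, y2))|).
  by exists (x1, c, (d, y2)); do ?split.
have [h|h3] := leP `|JR (x1, x2, (y1, y2))| (4 * `|JR (c, x2, (y1, d))|).
  by exists (c, x2, (y1, d)); do ?split.
exists (c, x2, (d, y2)); do ?split => //.
by move: T h1 h2 h3; clear a1 a2 a3 b1 b2 b3 c1 c2 d1 d2 cX1 cX2 dY1 dY2 e1 e2 e3 e4 E; lra.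
Qed.

(** Goursat's argument: nested quarters shrink to a point (x0, y0). Each step costs the circulation
    a factor of at most 4, while the bound of [circ_local], 2 eps times the squared size, also loses
    a factor 4; so the original circulation is at most 2 eps (W + V)^2 for every eps. *)
Lemma green_closed : circulation P Q X1 X2 Y1 Y2 = 0.
Proof.
have hstep r : exists r' : rect, inR r ->
  [/\ inR r', r.1.1 <= r'.1.1 /\ r'.1.2 <= r.1.2, r.2.1 <= r'.2.1 /\ r'.2.2 <= r.2.2,
   r'.1.2 - r'.1.1 = (r.1.2 - r.1.1) / 2 /\ r'.2.2 - r'.2.1 = (r.2.2 - r.2.1) / 2
   & `|JR r| <= 4 * `|JR r'|].
  by have [/quarter[r' h]|h] := pselect (inR r); [exists r'|exists r].
have [f hf] := choice hstep.
pose r n := iter n f (X1, X2, (Y1, Y2)).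
have rin n : inR (r n).
  elim: n => [|n IH]; first by split.
  by have [] := hf _ IH.
have hr n := hf _ (rin n).
pose W := X2 - X1; pose V := Y2 - Y1.
have size n : (r n).1.2 - (r n).1.1 = W / 2 ^+ n /\ (r n).2.2 - (r n).2.1 = V / 2 ^+ n.
  elim: n => [|n [IH1 IH2]]; first by rewrite expr0 !divr1.
  have [_ _ _ [h1 h2] _] := hr n; split; rewrite /= ?h1 ?h2 ?IH1 ?IH2 exprS invfM mulrA mulrAC //.
have grow n : `|JR (r 0%N)| <= 4 ^+ n * `|JR (r n)|.
  elim: n => [|n IH]; first by rewrite expr0 mul1r.
  apply: (le_trans IH); have [_ _ _ _ h] := hr n.
  by rewrite exprSr -mulrA ler_wpM2l // exprn_ge0.
have x1nd : nondecreasing_seq (fun n => (r n).1.1).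
  by apply/nondecreasing_seqP => n; case: (hr n) => _ [].
have y1nd : nondecreasing_seq (fun n => (r n).2.1).
  by apply/nondecreasing_seqP => n; case: (hr n) => _ _ [].
have x2ni : nonincreasing_seq (fun n => (r n).1.2).
  by apply/nonincreasing_seqP => n; case: (hr n) => _ [].
have y2ni : nonincreasing_seq (fun n => (r n).2.2).
  by apply/nonincreasing_seqP => n; case: (hr n) => _ _ [].
have x1x2 m n : (r m).1.1 <= (r n).1.2.
  have h1 := x1nd _ _ (leq_maxl m n); have h2 := x2ni _ _ (leq_maxr m n).
  have [_ h _ _] := rin (maxn m n); move: h1 h2 => /= h1 h2; lra.
have y1y2 m n : (r m).2.1 <= (r n).2.2.
  have h1 := y1nd _ _ (leq_maxl m n); have h2 := y2ni _ _ (leq_maxr m n).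
  have [_ _ _ [_ h _]] := rin (maxn m n); move: h1 h2 => /= h1 h2; lra.
pose x0 := sup (range (fun n => (r n).1.1)); pose y0 := sup (range (fun n => (r n).2.1)).
have x1x0 n : (r n).1.1 <= x0.
  by apply: ub_le_sup; [exists X2 => _ [m _ <-]; exact: (x1x2 m 0%N)|exists n].
have y1y0 n : (r n).2.1 <= y0.
  by apply: ub_le_sup; [exists Y2 => _ [m _ <-]; exact: (y1y2 m 0%N)|exists n].
have x0x2 n : x0 <= (r n).1.2.
  by apply: ge_sup => [|_ [m _ <-]]; [exists X1, 0%N|exact: x1x2].
have y0y2 n : y0 <= (r n).2.2.
  by apply: ge_sup => [|_ [m _ <-]]; [exists Y1, 0%N|exact: y1y2].
have hx0 : X1 <= x0 <= X2 by rewrite (x1x0 0%N) (x0x2 0%N).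
have hy0 : Y1 <= y0 <= Y2 by rewrite (y1y0 0%N) (y0y2 0%N).
have bound eps : 0 < eps -> `|JR (r 0%N)| <= 2 * eps * (W + V) ^+ 2.
  move=> e0; have [d d0 hd] := circ_local hx0 hy0 e0.
  have [n hn] : exists n, (W + V) / 2 ^+ n < d.
    have WV : 0 <= W + V by rewrite /W /V; lra.
    exists (Num.bound ((W + V) / d)).
    rewrite ltr_pdivrMr ?exprn_gt0 // mulrC -ltr_pdivrMr //.
    have h : 0 <= (W + V) / d by rewrite divr_ge0 // ltW.
    apply: (lt_le_trans (archi_boundP h)).
    by rewrite -natrX ler_nat ltnW // ltn_expl.
  have p2 : 0 < 2 ^+ n :> R by rewrite exprn_gt0.
  have [i1 i2 i3 [i4 i5 i6]] := rin n; have [s1 s2] := size n.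
  have sW : 0 <= W / 2 ^+ n by rewrite divr_ge0 ?(ltW p2) // /W; lra.
  have sV : 0 <= V / 2 ^+ n by rewrite divr_ge0 ?(ltW p2) // /V; lra.
  rewrite mulrDl in hn.
  have := hd _ _ _ _ i1 (x1x0 n) (x0x2 n) i3 i4 (y1y0 n) (y0y2 n) i6.
  rewrite s1 s2 => h; apply: (le_trans (grow n)).
  apply: (@le_trans _ _ (4 ^+ n * (2 * eps * (W / 2 ^+ n + V / 2 ^+ n) ^+ 2))).
    by rewrite ler_wpM2l ?exprn_ge0 //; apply: h; lra.
  rewrite le_eqVlt; apply/orP; left; apply/eqP.
  have -> : 4 ^+ n = (2 ^+ n) ^+ 2 :> R by rewrite exprAC; congr (_ ^+ _); ring.
  by field; rewrite gt_eqF.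
apply/eqP; rewrite -normr_le0; apply/ler_addgt0Pr => e e0; rewrite add0r.
have K0 : 0 < 2 * ((W + V) ^+ 2 + 1) by rewrite mulr_gt0 // ltr_wpDl ?sqr_ge0.
apply: (le_trans (bound (e / (2 * ((W + V) ^+ 2 + 1))) _)); first by rewrite divr_gt0.
rewrite mulrAC mulrA ler_pdivrMr //.
have := sqr_ge0 (W + V); move: ((W + V) ^+ 2) => w; nra.
Qed.

End Rectangle.
End Green.

(** * Integration on the circle *)

Section RealMean.
Variable R : realType.
Implicit Types (f g h : R -> R) (k : R).
Local Notation mu := (@lebesgue_measure R).
Local Notation Om := (@angles R).

Lemma measurable_angles : measurable (Om : set (measurableTypeR R)).
Proof. exact: measurable_itv. Qed.

Lemma twopi_gt0 : 0 < 2 * pi :> R.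
Proof. by rewrite mulr_gt0 ?pi_gt0. Qed.

Definition IR f := mu.-integrable Om (EFin \o f).

Definition rmean f := (2 * pi)^-1 * \int[mu]_(t in Om) f t.

Lemma IR_measurable f : IR f -> measurable_fun Om f.
Proof. by move=> /measurable_int/measurable_EFinP. Qed.

Lemma IR_dominated f h : measurable_fun Om f -> (forall t, Om t -> `|f t| <= h t) ->
  IR h -> IR f.
Proof.
move=> mf fh; apply: le_integrable => //; first exact: measurable_angles.
  exact/measurable_EFinP.
by move=> t Ot /=; rewrite lee_fin; apply: (le_trans (fh t Ot)); exact: ler_norm.
Qed.

Lemma IR_lin k f g : IR f -> IR g -> IR (fun t => k * f t + g t).
Proof.
move=> hf hg.
have := integrableD measurable_angles (integrableZl measurable_angles k hf) hg.
by apply: eq_integrable => [|t _]; [exact: measurable_angles|rewrite /= EFinD EFinM].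
Qed.

Lemma IR_continuous f : (forall t, {for t, continuous f}) -> IR f.
Proof. by move=> h; apply: (@cont_on_integrable R 0 (2 * pi)) => t _; exact: h. Qed.

Lemma IR_cst k : IR (fun=> k).
Proof. by apply: IR_continuous => t; exact: cst_continuous. Qed.

Lemma rmean_lin k f g : IR f -> IR g ->
  rmean (fun t => k * f t + g t) = k * rmean f + rmean g.
Proof.
move=> hf hg; rewrite /rmean RintegralD //; last first.
- rewrite (_ : (fun t => k * f t) = (fun t => k * f t + 0)); last first.
    by apply/funext => t; rewrite addr0.
  by apply: IR_lin => //; exact: IR_cst.
- exact: measurable_angles.
rewrite RintegralZl //; [by ring|exact: measurable_angles].
Qed.

Lemma rmean_cst k : rmean (fun=> k) = k.
Proof.
have := @ri_cst R 0 (2 * pi) k (ltW twopi_gt0); rewrite /ri /rmean /angles => ->.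
by rewrite subr0 mulrCA mulVf ?mulr1 // gt_eqF // twopi_gt0.
Qed.

Lemma eq_rmean f g : (forall t, Om t -> f t = g t) -> rmean f = rmean g.
Proof. by move=> h; congr (_ * _); apply: eq_Rintegral => t /set_mem /h. Qed.

Lemma le_rmean f g : IR f -> IR g -> (forall t, Om t -> f t <= g t) -> rmean f <= rmean g.
Proof.
move=> hf hg h; rewrite ler_wpM2l ?invr_ge0 ?(ltW twopi_gt0) //.
by apply: le_Rintegral => //; exact: measurable_angles.
Qed.

Lemma rmean_ge0 f : (forall t, Om t -> 0 <= f t) -> 0 <= rmean f.
Proof. by move=> h; rewrite mulr_ge0 ?invr_ge0 ?(ltW twopi_gt0) ?Rintegral_ge0. Qed.

End RealMean.

Section ComplexMean.
Variable R : realType.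
Local Notation C := R[i].
Local Notation Om := (@angles R).
Implicit Types (f g h : R -> C) (a : C).

Definition cint g := IR (fun t => complex.Re (g t)) /\ IR (fun t => complex.Im (g t)).

Definition cmeasurable g := measurable_fun Om (fun t => complex.Re (g t)) /\
  measurable_fun Om (fun t => complex.Im (g t)).

Lemma cmeanE g : circle_mean g =
  Complex (rmean (fun t => complex.Re (g t))) (rmean (fun t => complex.Im (g t))).
Proof. by []. Qed.

Lemma cint_lin a f g : cint f -> cint g -> cint (fun t => a * f t + g t).
Proof.
case: a => a b [f1 f2] [g1 g2]; split.
  have -> : (fun t => complex.Re (Complex a b * f t + g t)) =
     (fun t => a * complex.Re (f t) + (- b * complex.Im (f t) + complex.Re (g t))).
    by apply/funext => t; case: (f t) (g t) => x y [x' y'] /=; ring.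
  by apply: IR_lin => //; exact: IR_lin.
have -> : (fun t => complex.Im (Complex a b * f t + g t)) =
   (fun t => a * complex.Im (f t) + (b * complex.Re (f t) + complex.Im (g t))).
  by apply/funext => t; case: (f t) (g t) => x y [x' y'] /=; ring.
by apply: IR_lin => //; exact: IR_lin.
Qed.

Lemma cmean_lin a f g : cint f -> cint g ->
  circle_mean (fun t => a * f t + g t) = a * circle_mean f + circle_mean g.
Proof.
case: a => a b [f1 f2] [g1 g2]; rewrite !cmeanE.
have -> : (fun t => complex.Re (Complex a b * f t + g t)) =
   (fun t => a * complex.Re (f t) + (- b * complex.Im (f t) + complex.Re (g t))).
  by apply/funext => t; case: (f t) (g t) => x y [x' y'] /=; ring.
have -> : (fun t => complex.Im (Complex a b * f t + g t)) =
   (fun t => a * complex.Im (f t) + (b * complex.Re (f t) + complex.Im (g t))).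
  by apply/funext => t; case: (f t) (g t) => x y [x' y'] /=; ring.
rewrite rmean_lin //; last exact: IR_lin.
rewrite [in X in Complex _ X]rmean_lin //; last exact: IR_lin.
rewrite !rmean_lin //; simpc; congr Complex; ring.
Qed.

Lemma cint0 : cint (fun=> 0).
Proof. by split; exact: IR_cst. Qed.

Lemma cmean_cst a : circle_mean (fun=> a) = a.
Proof. by rewrite cmeanE !rmean_cst; case: a. Qed.

Lemma cintZ a f : cint f -> cint (fun t => a * f t).
Proof.
move=> hf; have -> : (fun t => a * f t) = (fun t => a * f t + 0).
  by apply/funext => t; rewrite addr0.
by apply: cint_lin => //; exact: cint0.
Qed.

Lemma cmeanZ a f : cint f -> circle_mean (fun t => a * f t) = a * circle_mean f.
Proof.
move=> hf; have -> : (fun t => a * f t) = (fun t => a * f t + 0).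
  by apply/funext => t; rewrite addr0.
by rewrite cmean_lin //; [rewrite cmean_cst addr0|exact: cint0].
Qed.

Lemma cintD f g : cint f -> cint g -> cint (fun t => f t + g t).
Proof.
move=> hf hg; have -> : (fun t => f t + g t) = (fun t => 1 * f t + g t).
  by apply/funext => t; rewrite mul1r.
exact: cint_lin.
Qed.

Lemma cmeanD f g : cint f -> cint g ->
  circle_mean (fun t => f t + g t) = circle_mean f + circle_mean g.
Proof.
move=> hf hg; have -> : (fun t => f t + g t) = (fun t => 1 * f t + g t).
  by apply/funext => t; rewrite mul1r.
by rewrite cmean_lin // mul1r.
Qed.

Lemma cintB f g : cint f -> cint g -> cint (fun t => f t - g t).
Proof.
move=> hf hg; have -> : (fun t => f t - g t) = (fun t => -1 * g t + f t).
  by apply/funext => t; rewrite mulN1r addrC.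
exact: cint_lin.
Qed.

Lemma cmeanB f g : cint f -> cint g ->
  circle_mean (fun t => f t - g t) = circle_mean f - circle_mean g.
Proof.
move=> hf hg; have -> : (fun t => f t - g t) = (fun t => -1 * g t + f t).
  by apply/funext => t; rewrite mulN1r addrC.
by rewrite cmean_lin // mulN1r addrC.
Qed.

Lemma cint_sum I (r : seq I) (F : I -> R -> C) : (forall i, cint (F i)) ->
  cint (fun t => \sum_(i <- r) F i t).
Proof.
move=> hF; elim: r => [|i r IH].
  by under [fun t => _]funext do rewrite big_nil; exact: cint0.
by under [fun t => _]funext do rewrite big_cons; exact: cintD.
Qed.

Lemma cmean_sum I (r : seq I) (F : I -> R -> C) : (forall i, cint (F i)) ->
  circle_mean (fun t => \sum_(i <- r) F i t) = \sum_(i <- r) circle_mean (F i).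
Proof.
move=> hF; elim: r => [|i r IH].
  by rewrite big_nil; under [fun t => _]funext do rewrite big_nil; exact: cmean_cst.
rewrite big_cons -IH -cmeanD //; last exact: cint_sum.
by congr circle_mean; apply/funext => t; rewrite big_cons.
Qed.

Lemma cmean_conj f : cint f -> circle_mean (fun t => conjc (f t)) = conjc (circle_mean f).
Proof.
move=> [_ h2]; rewrite !cmeanE /=; congr Complex.
  by apply: eq_rmean => t _; case: (f t).
have -> : (fun t => complex.Im (conjc (f t))) = (fun t => -1 * complex.Im (f t) + 0).
  by apply/funext => t; rewrite mulN1r addr0; case: (f t).
by rewrite rmean_lin // ?rmean_cst ?addr0 ?mulN1r //; exact: IR_cst.
Qed.

(** A unimodular [u] rotates the mean onto the positive axis, where it is the mean of a real part
    bounded by |g|. *)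
Lemma cmean_bound g (h : R -> R) : cint g -> IR h ->
  (forall t, Om t -> normc (g t) <= h t) -> normc (circle_mean g) <= rmean h.
Proof.
move=> hg hh gh; set m := circle_mean g.
have [m0|m0] := eqVneq m 0.
  rewrite m0 normc0; apply: rmean_ge0 => t /gh; apply: le_trans; exact: normc_ge0.
have nm : normc m != 0 by apply: contra m0 => /eqP/eq0_normc ->.
pose u := conjc m * (normc m)^-1%:C.
have nu : normc u = 1.
  by rewrite normcM normc_conj normc_real ger0_norm ?invr_ge0 ?normc_ge0 // divff.
have -> : normc m = complex.Re (circle_mean (fun t => u * g t)).
  rewrite cmeanZ // -/m /u mulrAC [_ * m]mulrC mulcJ -rmorphM /=.
  by rewrite expr2 mulfK.
apply: le_rmean => //; first by case: (cintZ u hg).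
move=> t /gh; apply: le_trans; apply: (le_trans (ler_norm _)).
by apply: (le_trans (normc_Re _)); rewrite normcM nu mul1r.
Qed.

Lemma cint_dominated g (h : R -> R) : cmeasurable g ->
  (forall t, Om t -> normc (g t) <= h t) -> IR h -> cint g.
Proof.
move=> [m1 m2] gh hh; split; apply: (IR_dominated _ _ hh) => // t /gh.
  exact: le_trans (normc_Re _).
exact: le_trans (normc_Im _).
Qed.

Definition ccontinuous g := forall t, {for t, continuous (fun t => complex.Re (g t))} /\
  {for t, continuous (fun t => complex.Im (g t))}.

Lemma ccontinuous_cint g : ccontinuous g -> cint g.
Proof. by move=> h; split; apply: IR_continuous => t; case: (h t). Qed.

Lemma cint_cmeasurable g : cint g -> cmeasurable g.
Proof. by move=> [h1 h2]; split; exact: IR_measurable. Qed.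

Lemma ccontinuousP g : ccontinuous g <-> forall t (eps : R), 0 < eps ->
  exists2 d : R, 0 < d & forall s, `|s - t| < d -> normc (g s - g t) < eps.
Proof.
split=> [h t eps e0|h t].
  have [/(@cvgrPdist_lt R R) h1 /(@cvgrPdist_lt R R) h2] := h t.
  have e2 : 0 < eps / 2 by rewrite divr_gt0.
  have /nbhs_ballP[d1 /= d10 {}h1] := h1 _ e2.
  have /nbhs_ballP[d2 /= d20 {}h2] := h2 _ e2.
  exists (Num.min d1 d2); first by rewrite lt_min d10.
  move=> s; rewrite lt_min distrC => /andP[/h1 /= {}h1 /h2 /= {}h2].
  move: h1 h2; case: (g s) (g t) => x y [x' y'] /= h1 h2.
  rewrite -(@ltr_pXn2r _ 2) ?nnegrE ?sqrtr_ge0 ?(ltW e0) // sqr_sqrtr ?addr_ge0 ?sqr_ge0 //.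
  rewrite -(real_normK (num_real (x - x'))) -(real_normK (num_real (y - y'))).
  rewrite distrC in h1; rewrite distrC in h2.
  have := normr_ge0 (x - x'); have := normr_ge0 (y - y').
  move: `|x - x'| `|y - y'| h1 h2 => u v; nra.
split; apply/(@cvgrPdist_lt R R) => eps /(h t)[d d0 {}h];
  apply/nbhs_ballP; exists d => //= s; rewrite /ball /= distrC => /h;
  apply: le_lt_trans; rewrite distrC.
  by have := normc_Re (g s - g t); rewrite ReD ReN.
by have := normc_Im (g s - g t); case: (g s) (g t) => x y [].
Qed.

End ComplexMean.

(** * L^2 of the circle with its semi-inner product *)

Section L2Space.
Variable R : realType.
Local Notation C := R[i].
Local Notation Om := (@angles R).
Local Notation mu := (@lebesgue_measure R).
Implicit Types (f g h : R -> C) (a : C).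

Lemma cmeasurable_normc f : cmeasurable f ->
  measurable_fun Om (fun t => normc (f t) ^+ 2).
Proof.
move=> [m1 m2]; under eq_fun do rewrite sqr_normc.
by apply: measurable_funD; exact: measurable_funX.
Qed.

Lemma IR_ltoo (f : R -> R) : measurable_fun Om f -> (forall t, 0 <= f t) ->
  (\int[mu]_(t in Om) (f t)%:E < +oo)%E -> IR f.
Proof.
move=> mf f0 h; apply/integrableP; split; first exact/measurable_EFinP.
apply: le_lt_trans h; rewrite le_eqVlt; apply/orP; left; apply/eqP.
by apply: eq_integral => t _; rewrite /= ger0_norm.
Qed.

Lemma rmean_EFin (f : R -> R) : IR f ->
  ((2 * pi)^-1%:E * \int[mu]_(t in Om) (f t)%:E)%E = (rmean f)%:E.
Proof.
move=> hf; rewrite /rmean EFinM; congr (_ * _)%E; rewrite /Rintegral fineK //.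
by apply: integrable_fin_num => //; exact: measurable_angles.
Qed.

Lemma L2P f : L2 f <-> cmeasurable f /\ IR (fun t => normc (f t) ^+ 2).
Proof.
split=> [[m1 m2 h]|[[m1 m2] h]].
  split=> //; apply: IR_ltoo => [|t|]; [exact: cmeasurable_normc|exact: sqr_ge0|].
  move: h; rewrite /L2_energy; set I := integral _ _ _.
  have c0 : (0 < (2 * pi : R)^-1%:E)%E by rewrite lte_fin invr_gt0 twopi_gt0.
  rewrite !ltey; apply: contra => /eqP ->.
  by rewrite gt0_muley.
by split=> //; rewrite /L2_energy rmean_EFin // ltry.
Qed.

Lemma L2_energyE f : L2 f -> L2_energy f = (rmean (fun t => normc (f t) ^+ 2))%:E.
Proof. by move=> /L2P[_ h]; rewrite /L2_energy rmean_EFin. Qed.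

Lemma cmeasurable_lin a f g : cmeasurable f -> cmeasurable g ->
  cmeasurable (fun t => a * f t + g t).
Proof.
case: a => a b [f1 f2] [g1 g2].
have mc (k : R) u : measurable_fun Om u -> measurable_fun Om (fun t => k * u t).
  by move=> mu_; apply: measurable_funM => //; exact: measurable_cst.
split.
  have -> : (fun t => complex.Re (Complex a b * f t + g t)) =
     (fun t => a * complex.Re (f t) + (- b * complex.Im (f t) + complex.Re (g t))).
    by apply/funext => t; case: (f t) (g t) => x y [x' y'] /=; ring.
  by apply: measurable_funD; [exact: mc|apply: measurable_funD => //; exact: mc].
have -> : (fun t => complex.Im (Complex a b * f t + g t)) =
   (fun t => a * complex.Im (f t) + (b * complex.Re (f t) + complex.Im (g t))).
  by apply/funext => t; case: (f t) (g t) => x y [x' y'] /=; ring.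
by apply: measurable_funD; [exact: mc|apply: measurable_funD => //; exact: mc].
Qed.

Lemma cmeasurableM f g : cmeasurable f -> cmeasurable g ->
  cmeasurable (fun t => f t * g t).
Proof.
move=> [f1 f2] [g1 g2]; split.
  have -> : (fun t => complex.Re (f t * g t)) = (fun t =>
     complex.Re (f t) * complex.Re (g t) - complex.Im (f t) * complex.Im (g t)).
    by apply/funext => t; case: (f t) (g t) => x y [x' y'].
  by apply: measurable_funB; exact: measurable_funM.
have -> : (fun t => complex.Im (f t * g t)) = (fun t =>
   complex.Re (f t) * complex.Im (g t) + complex.Im (f t) * complex.Re (g t)).
  by apply/funext => t; case: (f t) (g t) => x y [x' y'].
by apply: measurable_funD; exact: measurable_funM.
Qed.

Lemma cmeasurable_conj f : cmeasurable f -> cmeasurable (fun t => conjc (f t)).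
Proof.
move=> [f1 f2]; split.
  by have -> : (fun t => complex.Re (conjc (f t))) = (fun t => complex.Re (f t));
    [apply/funext => t; case: (f t)|].
have -> : (fun t => complex.Im (conjc (f t))) = (fun t => - complex.Im (f t)).
  by apply/funext => t; case: (f t).
exact: measurableT_comp.
Qed.

Lemma L2_cint f g : L2 f -> L2 g -> cint (fun t => f t * conjc (g t)).
Proof.
move=> /L2P[mf hf] /L2P[mg hg].
apply: (@cint_dominated _ _ (fun t => 1 * normc (f t) ^+ 2 + normc (g t) ^+ 2)).
- by apply: cmeasurableM => //; exact: cmeasurable_conj.
- move=> t _; rewrite normcM normc_conj.
  have := normc_ge0 (f t); have := normc_ge0 (g t).
  by move: (normc _) (normc _) => x y; nra.
- exact: IR_lin.
Qed.

Lemma L2_mul_bounded f g M : cmeasurable f -> (forall t, Om t -> normc (f t) <= M) ->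
  L2 g -> L2 (fun t => f t * g t).
Proof.
move=> mf fM /L2P[mg hg]; apply/L2P; split; first exact: cmeasurableM.
apply: (@IR_dominated _ _ (fun t => M ^+ 2 * normc (g t) ^+ 2 + 0)).
- by apply: cmeasurable_normc; exact: cmeasurableM.
- move=> t /fM h; rewrite addr0 normcM ger0_norm ?sqr_ge0 // exprMn.
  rewrite ler_wpM2r ?sqr_ge0 // ler_pXn2r ?nnegrE ?normc_ge0 //.
  exact: le_trans (normc_ge0 _) h.
- by apply: IR_lin => //; exact: IR_cst.
Qed.

Lemma L2_conj f : L2 f -> L2 (fun t => conjc (f t)).
Proof.
move=> /L2P[mf hf]; apply/L2P; split; first exact: cmeasurable_conj.
by under eq_fun do rewrite normc_conj.
Qed.

Lemma L2_0 : L2 (0 : R -> C).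
Proof.
apply/L2P; split; first by apply: cint_cmeasurable; exact: cint0.
under eq_fun do rewrite normc0; exact: IR_cst.
Qed.

Lemma L2_lin a f g : L2 f -> L2 g -> L2 (a *: f + g).
Proof.
move=> /L2P[mf hf] /L2P[mg hg]; apply/L2P; split.
  exact: (cmeasurable_lin a mf mg).
apply: (@IR_dominated _ _ (fun t => (2 * normc a ^+ 2) * normc (f t) ^+ 2 +
   (2 * normc (g t) ^+ 2 + 0))).
- by apply: cmeasurable_normc; exact: (cmeasurable_lin a mf mg).
- move=> t _; rewrite ger0_norm ?sqr_ge0 // addr0.
  apply: (@le_trans _ _ ((normc a * normc (f t) + normc (g t)) ^+ 2)).
    rewrite ler_pXn2r ?nnegrE ?addr_ge0 ?mulr_ge0 ?normc_ge0 //.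
    by apply: (le_trans (normcD _ _)); rewrite normcM.
  have := sqr_ge0 (normc a * normc (f t) - normc (g t)).
  move: (normc a) (normc (f t)) (normc (g t)) => x y z; nra.
- by apply: IR_lin => //; apply: IR_lin => //; exact: IR_cst.
Qed.

Lemma L2_subspace : subspace (@L2 R).
Proof. by split; [exact: L2_0|move=> a f g; exact: L2_lin]. Qed.

Lemma L2_ipE f g : L2_ip f g = circle_mean (fun t => f t * conjc (g t)).
Proof. by []. Qed.

Lemma L2_ipxx f : L2_ip f f = (rmean (fun t => normc (f t) ^+ 2))%:C.
Proof.
rewrite L2_ipE; have -> : (fun t => f t * conjc (f t)) = (fun t => (normc (f t) ^+ 2)%:C).
  by apply/funext => t; rewrite mulcJ.
by rewrite cmeanE /= rmean_cst.
Qed.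

Lemma L2_ip_lin a f g h : L2 f -> L2 g -> L2 h ->
  L2_ip (a *: f + g) h = a * L2_ip f h + L2_ip g h.
Proof.
move=> hf hg hh; rewrite !L2_ipE -cmean_lin; [|exact: L2_cint|exact: L2_cint].
by congr circle_mean; apply/funext => t; rewrite mulrA -mulrDl.
Qed.

Lemma L2_ip_conj f g : L2 f -> L2 g -> L2_ip f g = conjc (L2_ip g f).
Proof.
move=> hf hg; rewrite !L2_ipE -cmean_conj; last exact: L2_cint.
by congr circle_mean; apply/funext => t; rewrite conjcM conjcK mulrC.
Qed.

(* Only semi-definite: functions are not identified almost everywhere. *)
Lemma sub_L2_semi_ip : semi_ip (sub_ip (@L2_ip R) (hK := L2_subspace)).
Proof.
split=> [a x y z|x y|x].
- rewrite /sub_ip svD svZ; apply: L2_ip_lin; exact: val_in.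
- by apply: L2_ip_conj; exact: val_in.
- by rewrite /sub_ip L2_ipxx; apply: rmean_ge0 => t _; exact: sqr_ge0.
Qed.

Local Notation N := (hnorm (@L2_ip R)).

Lemma L2_norm_sqr f : N f ^+ 2 = rmean (fun t => normc (f t) ^+ 2).
Proof.
rewrite /hnorm L2_ipxx sqr_sqrtr //; apply: rmean_ge0 => t _; exact: sqr_ge0.
Qed.

Lemma L2_energy_norm f : L2 f -> L2_energy f = (N f ^+ 2)%:E.
Proof. by move=> hf; rewrite L2_energyE // L2_norm_sqr. Qed.

Lemma L2_cauchy_schwarz f g : L2 f -> L2 g -> normc (L2_ip f g) <= N f * N g.
Proof.
move=> hf hg; have := cauchy_schwarz sub_L2_semi_ip (to_sub L2_subspace f) (to_sub L2_subspace g).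
by rewrite /hnorm /sub_ip !to_subK.
Qed.

Lemma L2_hnormD f g : L2 f -> L2 g -> N (f + g) <= N f + N g.
Proof.
move=> hf hg; have := hnormD sub_L2_semi_ip (to_sub L2_subspace f) (to_sub L2_subspace g).
by rewrite /hnorm /sub_ip !svD !to_subK.
Qed.

Lemma L2_hnormN f : N (- f) = N f.
Proof.
rewrite /hnorm !L2_ipxx /=; congr (Num.sqrt (rmean _)).
by apply/funext => t; rewrite normcN.
Qed.

Lemma L2_B f g : L2 f -> L2 g -> L2 (f - g).
Proof. by move=> hf hg; rewrite -[- g]scaleN1r addrC; exact: L2_lin. Qed.

Lemma L2_D f g : L2 f -> L2 g -> L2 (f + g).
Proof. by move=> hf hg; rewrite -[f]scale1r; exact: L2_lin. Qed.

Lemma L2_ipBl f g h : L2 f -> L2 g -> L2 h -> L2_ip (f - g) h = L2_ip f h - L2_ip g h.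
Proof.
by move=> hf hg hh; rewrite -[- g]scaleN1r addrC L2_ip_lin // mulN1r addrC.
Qed.

Lemma L2_ip_mulr f m g : L2_ip (fun t => m t * f t) g = L2_ip f (fun t => conjc (m t) * g t).
Proof.
rewrite !L2_ipE; congr circle_mean; apply/funext => t.
by rewrite conjcM conjcK mulrCA mulrA.
Qed.

Lemma L2_norm_mul f g M : cmeasurable f -> (forall t, Om t -> normc (f t) <= M) -> 0 <= M ->
  L2 g -> N (fun t => f t * g t) <= M * N g.
Proof.
move=> mf fM M0 hg; have /L2P[_ hfg] := L2_mul_bounded mf fM hg.
have /L2P[_ hg2] := hg.
rewrite -(@ler_pXn2r _ 2) ?nnegrE ?mulr_ge0 ?hnorm_ge0 // exprMn !L2_norm_sqr.
rewrite -[leRHS]addr0 -(rmean_cst 0) -rmean_lin //; last exact: IR_cst.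
apply: le_rmean => //; first by apply: IR_lin => //; exact: IR_cst.
move=> t Ot; rewrite addr0 normcM exprMn ler_wpM2r ?sqr_ge0 //.
by rewrite ler_pXn2r ?nnegrE ?normc_ge0 ?fM.
Qed.

Lemma ccontinuous_L2 f : ccontinuous f -> L2 f.
Proof.
move=> hf; apply/L2P; split; first by apply: cint_cmeasurable; exact: ccontinuous_cint.
have -> : (fun t => normc (f t) ^+ 2) =
    (fun t => complex.Re (f t) * complex.Re (f t) + complex.Im (f t) * complex.Im (f t)).
  by apply/funext => t; rewrite sqr_normc !expr2.
apply: IR_continuous => t; have [h1 h2] := hf t.
by apply: continuousD; apply: continuousM.
Qed.

End L2Space.

(** * Cauchy's formula *)

Section ComplexDifferential.
Variable R : realType.
Local Notation C := R[i].
Implicit Types (f g : R -> R -> C) (F : C -> C).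

(** Complex differentiability in epsilon form; [derivable_cdiff1] and [cdiff1_derivable] relate it
    to [derivable] on [C^o]. *)
Definition cdiff1 F (w D : C) := forall eps : R, 0 < eps ->
  exists2 d : R, 0 < d & forall v, normc (v - w) < d ->
    normc (F v - (F w + D * (v - w))) <= eps * normc (v - w).

(** Real differentiability of a complex-valued function of two real variables; its real and
    imaginary parts satisfy the [diff2] of Green's theorem. *)
Definition cdiff2 f (x0 y0 : R) (A B : C) := forall eps : R, 0 < eps ->
  exists2 d : R, 0 < d & forall x y, `|x - x0| < d -> `|y - y0| < d ->
    normc (f x y - (f x0 y0 + A * (x - x0)%:C + B * (y - y0)%:C))
      <= eps * (`|x - x0| + `|y - y0|).

Lemma cdiff2_Re f x0 y0 A B : cdiff2 f x0 y0 A B ->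
  diff2 (fun x y => complex.Re (f x y)) x0 y0 (complex.Re A) (complex.Re B).
Proof.
move=> h eps /h[d d0 {}h]; exists d => // x y hx hy.
apply: le_trans (h x y hx hy); apply: le_trans (normc_Re _).
rewrite le_eqVlt; apply/orP; left; apply/eqP; congr Num.norm.
by case: (f x y) (f x0 y0) A B {h} => ? ? [? ?] [? ?] [? ?] /=; ring.
Qed.

Lemma cdiff2_Im f x0 y0 A B : cdiff2 f x0 y0 A B ->
  diff2 (fun x y => complex.Im (f x y)) x0 y0 (complex.Im A) (complex.Im B).
Proof.
move=> h eps /h[d d0 {}h]; exists d => // x y hx hy.
apply: le_trans (h x y hx hy); apply: le_trans (normc_Im _).
rewrite le_eqVlt; apply/orP; left; apply/eqP; congr Num.norm.
by case: (f x y) (f x0 y0) A B {h} => ? ? [? ?] [? ?] [? ?] /=; ring.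
Qed.

Lemma normc_lin2 (A B : C) (x y : R) :
  normc (A * x%:C + B * y%:C) <= (normc A + normc B) * (`|x| + `|y|).
Proof.
apply: (le_trans (normcD _ _)); rewrite !normcM !normc_real.
have := normc_ge0 A; have := normc_ge0 B; have := normr_ge0 x; have := normr_ge0 y.
by move: (normc A) (normc B) `|x| `|y| => a b u v; nra.
Qed.

Lemma eq_cdiff2 f g x0 y0 A B A' B' : f =2 g -> A = A' -> B = B' ->
  cdiff2 f x0 y0 A B -> cdiff2 g x0 y0 A' B'.
Proof.
move=> fg <- <- h eps /h[d d0 {}h]; exists d => // x y hx hy.
by rewrite -!fg; exact: h.
Qed.

Lemma cdiff2_lipschitz f x0 y0 A B : cdiff2 f x0 y0 A B ->
  exists2 d : R, 0 < d & forall x y, `|x - x0| < d -> `|y - y0| < d ->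
    normc (f x y - f x0 y0) <= (normc A + normc B + 1) * (`|x - x0| + `|y - y0|).
Proof.
move=> /(_ _ ltr01)[d d0 h]; exists d => // x y hx hy.
have := h x y hx hy; set L := f x0 y0 + _ + _.
have -> : f x y - f x0 y0 = (f x y - L) + (A * (x - x0)%:C + B * (y - y0)%:C).
  by rewrite /L; ring.
move=> h1; apply: (le_trans (normcD _ _)).
by have := normc_lin2 A B (x - x0) (y - y0); lra.
Qed.

Lemma cdiff2_add f g x0 y0 A B A' B' : cdiff2 f x0 y0 A B -> cdiff2 g x0 y0 A' B' ->
  cdiff2 (fun x y => f x y + g x y) x0 y0 (A + A') (B + B').
Proof.
move=> hf hg eps e0; have e2 : 0 < eps / 2 by rewrite divr_gt0.
have [d d0 h] := hf _ e2; have [d' d'0 h'] := hg _ e2.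
exists (Num.min d d'); first by rewrite lt_min d0.
move=> x y; rewrite !lt_min => /andP[hx hx'] /andP[hy hy'].
have := h x y hx hy; have := h' x y hx' hy'.
set L := f x0 y0 + _ + _; set L' := g x0 y0 + _ + _.
have -> : f x y + g x y - (f x0 y0 + g x0 y0 + (A + A') * (x - x0)%:C
   + (B + B') * (y - y0)%:C) = (f x y - L) + (g x y - L') by rewrite /L /L'; ring.
by move=> h1 h2; apply: (le_trans (normcD _ _)); lra.
Qed.

Lemma cdiff2_cst c x0 y0 : cdiff2 (fun _ _ => c) x0 y0 0 0.
Proof.
move=> eps e0; exists 1 => // x y _ _.
by rewrite !mul0r !addr0 subrr normc0 mulr_ge0 ?addr_ge0 ?(ltW e0).
Qed.

Lemma cdiff2_mul f g x0 y0 A B A' B' : cdiff2 f x0 y0 A B -> cdiff2 g x0 y0 A' B' ->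
  cdiff2 (fun x y => f x y * g x y) x0 y0
    (A * g x0 y0 + f x0 y0 * A') (B * g x0 y0 + f x0 y0 * B').
Proof.
move=> hf hg eps e0.
set F0 := normc (f x0 y0); set G0 := normc (g x0 y0).
set K := normc A + normc B + 1; set K' := normc A' + normc B' + 1.
have F00 : 0 <= F0 by exact: normc_ge0.
have G00 : 0 <= G0 by exact: normc_ge0.
have K0 : 0 < K by rewrite ltr_wpDl // addr_ge0 ?normc_ge0.
have K'0 : 0 < K' by rewrite ltr_wpDl // addr_ge0 ?normc_ge0.
(* Half of eps pays for the two remainders, weighted by |f| and |g| at the point; the other half,
   through [d5], pays for the product of the increments, which is at most K K' d^2 with d < 2 d5. *)
pose e1 := eps / (2 * (F0 + G0 + 1)).
have s0 : 0 < 2 * (F0 + G0 + 1) by rewrite mulr_gt0 // ltr_wpDl // addr_ge0.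
have e10 : 0 < e1 by rewrite divr_gt0.
have e1E : e1 * (2 * (F0 + G0 + 1)) = eps by rewrite divfK // gt_eqF.
have [d1 d10 h1] := hf _ e10; have [d2 d20 h2] := hg _ e10.
have [d3 d30 h3] := cdiff2_lipschitz hf; have [d4 d40 h4] := cdiff2_lipschitz hg.
pose d5 := eps / (4 * (K * K')).
have d50 : 0 < d5 by rewrite divr_gt0 // !mulr_gt0.
have d5E : d5 * (4 * (K * K')) = eps by rewrite divfK // gt_eqF // !mulr_gt0.
exists (Num.min (Num.min d1 d2) (Num.min (Num.min d3 d4) d5)).
  by rewrite !lt_min d10 d20 d30 d40 d50.
move=> x y; rewrite !lt_min => /andP[/andP[x1 x2] /andP[/andP[x3 x4] x5]].
move=> /andP[/andP[y1 y2] /andP[/andP[y3 y4] y5]].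
have := h1 x y x1 y1; have := h2 x y x2 y2; have := h3 x y x3 y3; have := h4 x y x4 y4.
rewrite -/K -/K'; set L := f x0 y0 + _ + _; set L' := g x0 y0 + _ + _.
set d := `|x - x0| + `|y - y0|; move=> q4 q3 q2 q1.
have -> : f x y * g x y - (f x0 y0 * g x0 y0 + (A * g x0 y0 + f x0 y0 * A') * (x - x0)%:C +
    (B * g x0 y0 + f x0 y0 * B') * (y - y0)%:C) =
  (f x y - L) * g x0 y0 + f x0 y0 * (g x y - L') + (f x y - f x0 y0) * (g x y - g x0 y0).
  by rewrite /L /L'; ring.
apply: (le_trans (normcD _ _)); rewrite normcM.
have t1 : normc ((f x y - L) * g x0 y0 + f x0 y0 * (g x y - L')) <= e1 * d * (F0 + G0).
  apply: (le_trans (normcD _ _)); rewrite !normcM -/F0 -/G0.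
  by move: (normc (f x y - L)) (normc (g x y - L')) q1 q2 => u v q1 q2; nra.
have d00 : 0 <= d by rewrite addr_ge0.
have t2 : normc (f x y - f x0 y0) * normc (g x y - g x0 y0) <= (K * d) * (K' * d).
  by apply: ler_pM; rewrite ?normc_ge0.
have t3 : (K * d) * (K' * d) <= eps / 2 * d.
  have -> : (K * d) * (K' * d) = (K * K' * d) * d by ring.
  rewrite ler_wpM2r //; have : d <= 2 * d5 by rewrite /d; lra.
  have KK : 0 < K * K' by exact: mulr_gt0.
  move: KK d5E; move: (K * K') => k k0 <-; nra.
have t4 : e1 * d * (F0 + G0) <= eps / 2 * d.
  have h0 : 0 <= e1 * d by rewrite mulr_ge0 // ltW.
  by rewrite -e1E; nra.
lra.
Qed.

Lemma cdiff2_comp F f x0 y0 A B D : cdiff2 f x0 y0 A B -> cdiff1 F (f x0 y0) D ->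
  cdiff2 (fun x y => F (f x y)) x0 y0 (D * A) (D * B).
Proof.
move=> hf hF eps e0.
set K := normc A + normc B + 1; set M := normc D.
have K0 : 0 < K by rewrite ltr_wpDl // addr_ge0 ?normc_ge0.
have M0 : 0 <= M by exact: normc_ge0.
pose e1 := eps / (K + M).
have s0 : 0 < K + M by rewrite ltr_wpDr.
have e10 : 0 < e1 by rewrite divr_gt0.
have e1E : e1 * (K + M) = eps by rewrite divfK // gt_eqF.
have [d1 d10 h1] := hF _ e10; have [d2 d20 h2] := hf _ e10.
have [d3 d30 h3] := cdiff2_lipschitz hf.
pose d4 := d1 / (2 * K); have d40 : 0 < d4 by rewrite divr_gt0 // mulr_gt0.
have d4E : d4 * (2 * K) = d1 by rewrite divfK // gt_eqF // mulr_gt0.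
exists (Num.min d2 (Num.min d3 d4)); first by rewrite !lt_min d20 d30.
move=> x y; rewrite !lt_min => /andP[x2 /andP[x3 x4]] /andP[y2 /andP[y3 y4]].
have q2 := h2 x y x2 y2; have q3 := h3 x y x3 y3; rewrite -/K in q3.
set d := `|x - x0| + `|y - y0| in q2 q3 *.
have q1 : normc (f x y - f x0 y0) < d1.
  by apply: (le_lt_trans q3); rewrite -d4E /d; nra.
have {}q1 := h1 _ q1.
set L := f x0 y0 + _ + _ in q2.
have -> : F (f x y) - (F (f x0 y0) + D * A * (x - x0)%:C + D * B * (y - y0)%:C) =
  (F (f x y) - (F (f x0 y0) + D * (f x y - f x0 y0))) + D * (f x y - L).
  by rewrite /L; ring.
apply: (le_trans (normcD _ _)); rewrite normcM -/M -e1E.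
move: (normc (f x y - L)) (normc (f x y - f x0 y0)) (normc (_ - _)) q1 q2 q3 => u v w q1 q2 q3.
by nra.
Qed.

Lemma real_derive_o (f : R -> R) x (df : R) : is_derive x (1 : R) f df -> forall eps : R, 0 < eps ->
  exists2 d : R, 0 < d & forall y, `|y - x| < d ->
    `|f y - (f x + df * (y - x))| <= eps * `|y - x|.
Proof.
move=> [dfx <-] eps e0.
have /(@cvgrPdist_lt R R) /(_ _ e0) := dfx.
move=> /nbhs_ballP[d /= d0 h]; exists d => // y yx.
have [->|yx0] := eqVneq y x; first by rewrite subrr mulr0 addr0 subrr normr0 mulr0.
have yn : y - x != 0 by rewrite subr_eq0.
have := h (y - x); rewrite /ball /= sub0r normrN => /(_ yx yn).
rewrite /GRing.scale /= mulr1 subrK -/(derive f x 1) => {}h.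
rewrite -ler_pdivrMr ?normr_gt0 //; apply: ltW; apply: le_lt_trans h.
rewrite -normfV -normrM distrC le_eqVlt; apply/orP; left; apply/eqP; congr Num.norm.
by rewrite /derive; field.
Qed.

Lemma cdiff2_x (u v : R -> R) x0 y0 (du dv : R) :
  is_derive x0 (1 : R) u du -> is_derive x0 (1 : R) v dv ->
  cdiff2 (fun x _ => Complex (u x) (v x)) x0 y0 (Complex du dv) 0.
Proof.
move=> hu hv eps e0; have e2 : 0 < eps / 2 by rewrite divr_gt0.
have [d1 d10 h1] := real_derive_o hu e2; have [d2 d20 h2] := real_derive_o hv e2.
exists (Num.min d1 d2); first by rewrite lt_min d10.
move=> x y; rewrite lt_min => /andP[/h1 {}h1 /h2 {}h2] _.
rewrite mul0r addr0.
have -> : Complex (u x) (v x) - (Complex (u x0) (v x0) + Complex du dv * (x - x0)%:C) =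
  (u x - (u x0 + du * (x - x0)))%:C + 'i%C * (v x - (v x0 + dv * (x - x0)))%:C.
  by simpc; congr Complex; ring.
apply: (le_trans (normcD _ _)); rewrite normcM !normc_real.
have -> : normc ('i%C : C) = 1 by rewrite /= expr0n expr1n add0r sqrtr1.
have : 0 <= eps * `|y - y0| by rewrite mulr_ge0 ?(ltW e0).
move: h1 h2; set a := `|u x - _|; set b := `|v x - _|; move=> h1 h2; rewrite mulrDr => h3.
by rewrite mul1r; nra.
Qed.

Lemma cdiff2_y (u v : R -> R) x0 y0 (du dv : R) :
  is_derive y0 (1 : R) u du -> is_derive y0 (1 : R) v dv ->
  cdiff2 (fun _ y => Complex (u y) (v y)) x0 y0 0 (Complex du dv).
Proof.
move=> hu hv eps e0; have [d d0 h] := @cdiff2_x u v y0 x0 du dv hu hv eps e0.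
exists d => // x y hx hy; have := h y x hy hx.
by rewrite !mul0r !addr0 [`|y - _| + _]addrC.
Qed.

Lemma cdiff1_inv (w : C) : w != 0 -> cdiff1 (fun v => v^-1) w (- (w ^- 2)).
Proof.
move=> w0 eps e0; set W := normc w.
have W0 : 0 < W.
  by rewrite lt_def normc_ge0 andbT; apply: contra w0 => /eqP/eq0_normc ->.
(* The remainder is (v - w)^2 / (w^2 v), and |v| >= W / 2 within the first radius. *)
exists (Num.min (W / 2) (eps * W ^+ 3 / 2)).
  by rewrite lt_min !divr_gt0 // mulr_gt0 // exprn_gt0.
move=> v; rewrite lt_min => /andP[v1 v2].
have nv : W / 2 <= normc v.
  have := normcD (w - v) v; rewrite subrK -/W normcB; lra.
have nv0 : 0 < normc v by lra.
have v0 : v != 0 by apply: contraTN nv0 => /eqP ->; rewrite normc0 ltxx.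
have -> : v^-1 - (w^-1 + - w ^- 2 * (v - w)) = (v - w) * ((v - w) * (w ^- 2 * v^-1)).
  by field; rewrite v0 w0.
rewrite normcM mulrC ler_wpM2r ?normc_ge0 // !normcM !normcV.
have -> : normc (w ^+ 2) = W ^+ 2 by rewrite expr2 normcM.
rewrite mulrA ler_pdivrMr // ler_pdivrMr ?exprn_gt0 //.
apply: (@le_trans _ _ (eps * W ^+ 3 / 2)); first exact: ltW.
have -> : eps * W ^+ 3 / 2 = eps * (W / 2) * W ^+ 2 by field.
by rewrite ler_wpM2r ?sqr_ge0 // ler_wpM2l ?(ltW e0).
Qed.

Lemma derivable_cdiff1 F w : derivable (F : C^o -> C^o) w 1 -> exists D, cdiff1 F w D.
Proof.
move=> dF; exists (derive (F : C^o -> C^o) w 1) => eps e0.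
have e0C : 0 < eps%:C :> C by rewrite ltcR.
have /cvgrPdist_lt /(_ _ e0C) := dF.
move=> /nbhs_ballP[d /= d0 h].
have dE : d = (complex.Re d)%:C by rewrite RRe_real // gtr0_real.
have d0' : 0 < complex.Re d by rewrite -ltcR -dE.
exists (complex.Re d) => // v vw.
have [->|vw0] := eqVneq v w; first by rewrite subrr mulr0 addr0 subrr normc0 mulr0.
have vn : v - w != 0 by rewrite subr_eq0.
have := h (v - w); rewrite /ball /= sub0r normrN {1}dE normcE ltcR => /(_ vw vn).
rewrite /GRing.scale /= mulr1 subrK normcE ltcR => {}h.
have nv0 : 0 < normc (v - w).
  by rewrite lt_def normc_ge0 andbT; apply: contra vn => /eqP/eq0_normc ->.
rewrite -ler_pdivrMr //; apply: ltW; apply: le_lt_trans h.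
rewrite -normcV -normcM normcB le_eqVlt; apply/orP; left; apply/eqP; congr normc.
by rewrite /derive; field.
Qed.

End ComplexDifferential.

Section CauchyFormula.
Variable R : realType.
Local Notation C := R[i].

Definition expi (t : R) : C := Complex (cos t) (sin t).

Lemma expi_conj t : expi t * conjc (expi t) = 1.
Proof. by rewrite mulcJ sqr_normc /= cos2Dsin2. Qed.

Lemma normc_expi t : normc (expi t) = 1.
Proof. by rewrite /= cos2Dsin2 sqrtr1. Qed.

Lemma expi_2pi : expi (2 * pi) = expi 0.
Proof. by rewrite /expi mulrC mulr_natr cos2pi sin2pi cos0 sin0. Qed.

Lemma cdiff2_ccontinuous (f : R -> R -> C) x : (forall t, exists A B, cdiff2 f x t A B) ->
  ccontinuous (f x).
Proof.
move=> h t; have [A [B hf]] := h t; split.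
  exact: diff2_continuous (diff2_swap (cdiff2_Re hf)).
exact: diff2_continuous (diff2_swap (cdiff2_Im hf)).
Qed.

Lemma ccontinuous_cdiff1 (F : C -> C) (g : R -> C) : ccontinuous g ->
  (forall t, exists D, cdiff1 F (g t) D) -> ccontinuous (fun t => F (g t)).
Proof.
move=> /ccontinuousP hg hF; apply/ccontinuousP => t eps e0.
have [D /(_ _ ltr01)[d d0 h]] := hF t.
have k0 : 0 < normc D + 1 by rewrite ltr_wpDl ?normc_ge0.
have [|d' d'0 h'] := hg t (Num.min d (eps / (normc D + 1))).
  by rewrite lt_min d0 divr_gt0.
exists d' => // s /h'; rewrite lt_min => /andP[/h {}h]; rewrite ltr_pdivlMr // => hs.
apply: le_lt_trans hs.
have -> : F (g s) - F (g t) = (F (g s) - (F (g t) + D * (g s - g t))) + D * (g s - g t).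
  by ring.
by apply: (le_trans (normcD _ _)); rewrite normcM; lra.
Qed.

Lemma ccontinuous_bounded (g : R -> C) : ccontinuous g ->
  exists2 M : R, 0 < M & forall t, angles t -> normc (g t) <= M.
Proof.
move=> hg; pose f t := normc (g t) ^+ 2.
have hf : {within `[0, 2 * pi], continuous f}.
  apply: cont_on_within => t _; rewrite /f.
  have -> : (fun t => normc (g t) ^+ 2) =
      (fun t => complex.Re (g t) * complex.Re (g t) + complex.Im (g t) * complex.Im (g t)).
    by apply/funext => s; rewrite sqr_normc !expr2.
  by have [h1 h2] := hg t; apply: continuousD; apply: continuousM.
have [c _ hc] := EVT_max (ltW (twopi_gt0 R)) hf.
exists (normc (g c) + 1); first by rewrite ltr_wpDl ?normc_ge0.
move=> t /hc; rewrite /f ler_pXn2r ?nnegrE ?normc_ge0 // => h.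
by apply: (le_trans h); rewrite lerDl.
Qed.

Lemma normc_1B (x : C) : 1 - normc x <= normc (1 - x).
Proof.
rewrite lerBlDr -(@normc1 R); apply: le_trans (normcD _ _).
by rewrite subrK.
Qed.

Lemma eq_cmean_ri (f g : R -> C) :
  ri 0 (2 * pi) (fun t => complex.Re (f t)) = ri 0 (2 * pi) (fun t => complex.Re (g t)) ->
  ri 0 (2 * pi) (fun t => complex.Im (f t)) = ri 0 (2 * pi) (fun t => complex.Im (g t)) ->
  circle_mean f = circle_mean g.
Proof. by rewrite !cmeanE /rmean /ri => -> ->. Qed.

Section Formula.
Variables (F : C -> C) (r : R) (a : C).
Hypotheses (hF : forall w, disk w -> exists D, cdiff1 F w D).
Hypotheses (r01 : 0 < r < 1) (a1 : normc a < 1).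

(* [G x] shrinks the circle of radius [r] to the point [c] as [x] goes to -oo.
   As a function of [G], the form [P dx + Q dt] is [(F - F c) / (G - c) dG],
   since ['i * kbar t] is [(dG/dt) / (dG/dx)]; hence the circulation of it
   around the rectangle vanishes. *)
Let c := r%:C * a.
Let G (x t : R) : C := c + (expR x)%:C * (r%:C * expi t - c).
Let P x t := F (G x t) - F c.
Let kbar t : C := (1 - a * conjc (expi t))^-1.
Let Q x t := P x t * ('i%C * kbar t).

Let kbar_neq0 t : 1 - a * conjc (expi t) != 0.
Proof.
apply/eqP => /eqP; rewrite subr_eq0 => /eqP h.
have := congr1 (@normc R) h; rewrite normcM normc_conj normc_expi mulr1 normc1 => h1.
by move: a1; rewrite -h1 ltxx.
Qed.

Let G_disk x t : x <= 0 -> disk (G x t).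
Proof.
move=> x0; rewrite /disk /=; set s := expR x.
have s0 : 0 < s by exact: expR_gt0.
have s1 : s <= 1 by rewrite /s -[leRHS]expR0 ler_expR.
have -> : G x t = (1 - s)%:C * c + s%:C * (r%:C * expi t).
  by rewrite /G rmorphB rmorph1; ring.
apply: (le_lt_trans (normcD _ _)).
have /andP[r0 r1] := r01.
rewrite !normcM !normc_real normc_expi mulr1 !ger0_norm ?subr_ge0 ?(ltW r0) ?(ltW s0) //.
have h1 : r * normc a <= r by rewrite ler_piMr ?ltW.
have h2 : (1 - s) * (r * normc a) <= (1 - s) * r by rewrite ler_wpM2l ?subr_ge0.
by apply: (le_lt_trans (lerD h2 (lexx _))); rewrite -mulrDl subrK mul1r.
Qed.

Let cd_exp x t : cdiff2 (fun x (_ : R) => (expR x)%:C) x t (expR x)%:C 0.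
Proof. exact: cdiff2_x. Qed.

Let cd_expi x t : cdiff2 (fun (_ : R) t => expi t) x t 0 ('i%C * expi t).
Proof.
have -> : 'i%C * expi t = Complex (- sin t) (cos t) by rewrite /expi; simpc.
exact: cdiff2_y.
Qed.

Let cd_conj x t : cdiff2 (fun (_ : R) t => conjc (expi t)) x t 0 (- 'i%C * conjc (expi t)).
Proof.
have -> : - 'i%C * conjc (expi t) = Complex (- sin t) (- cos t).
  by rewrite /expi; simpc.
exact: cdiff2_y.
Qed.

Let cd_kbar x t : exists B, cdiff2 (fun (_ : R) t => 'i%C * kbar t) x t 0 B.
Proof.
have h1 := cdiff2_add (cdiff2_cst 1 x t) (cdiff2_mul (cdiff2_cst (- a) x t) (cd_conj x t)).
have w0 : 1 + - a * conjc (expi t) != 0 by rewrite mulNr; exact: kbar_neq0.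
have h3 := cdiff2_mul (cdiff2_cst 'i%C x t) (cdiff2_comp h1 (cdiff1_inv w0)).
eexists; apply: eq_cdiff2 h3 => [x' t'||].
- by rewrite /kbar mulNr.
- by rewrite !(mul0r, mulr0, addr0, add0r).
- by [].
Qed.

Let cd_P x t : x <= 0 -> exists D, cdiff2 P x t
  (D * ((expR x)%:C * (r%:C * expi t - c))) (D * ((expR x)%:C * (r%:C * ('i%C * expi t)))).
Proof.
move=> x0; have [D hD] := hF (G_disk t x0); exists D.
have hz := cdiff2_add (cdiff2_mul (cdiff2_cst r%:C x t) (cd_expi x t)) (cdiff2_cst (- c) x t).
have hG := cdiff2_add (cdiff2_cst c x t) (cdiff2_mul (cd_exp x t) hz).
have hFG := cdiff2_add (cdiff2_comp hG hD) (cdiff2_cst (- F c) x t).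
apply: eq_cdiff2 hFG => [x' t'||].
- by [].
- by rewrite !(mul0r, mulr0, addr0, add0r).
- by rewrite !(mul0r, mulr0, addr0, add0r).
Qed.

Let closed x t : x <= 0 -> exists A M B, cdiff2 P x t A M /\ cdiff2 Q x t M B.
Proof.
move=> x0; have [D hP] := cd_P t x0; have [B hk] := cd_kbar x t.
have hQ := cdiff2_mul hP hk.
eexists; eexists; eexists; split; first exact: hP.
apply: eq_cdiff2 hQ; [by []| |by reflexivity].
(* The factorization r e^(it) - c = r e^(it) (1 - a e^(-it)) cancels [kbar] and leaves the
   t-derivative of [P]. *)
have -> : r%:C * expi t - c = r%:C * (expi t - a) by rewrite /c mulrBr.
have e1 : expi t - a = expi t * (1 - a * conjc (expi t)).
  by rewrite mulrBr mulr1 mulrCA expi_conj mulr1.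
rewrite e1 mulr0 addr0 /kbar.
by have := kbar_neq0 t; move: (1 - _) => k k0; field.
Qed.

Let P_2pi x : P x (2 * pi) = P x 0.
Proof. by rewrite /P /G expi_2pi. Qed.

(** In the vanishing circulation the sides t = 0 and t = 2 pi cancel by periodicity of [P], so the
    integrals over the sides x = -A and x = 0 agree. *)
Let mean_Q A : 0 <= A -> circle_mean (Q 0) = circle_mean (Q (- A)).
Proof.
move=> A0.
have A0' : - A <= 0 by rewrite oppr_le0.
have hR : circulation (fun x t => complex.Re (P x t)) (fun x t => complex.Re (Q x t))
    (- A) 0 0 (2 * pi) = 0.
  apply: green_closed => // [|x t /andP[_ x0] _]; first exact: ltW (twopi_gt0 R).
  have [p [m [q [h1 h2]]]] := closed t x0.
  by exists (complex.Re p), (complex.Re m), (complex.Re q); split; exact: cdiff2_Re.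
have hI : circulation (fun x t => complex.Im (P x t)) (fun x t => complex.Im (Q x t))
    (- A) 0 0 (2 * pi) = 0.
  apply: green_closed => // [|x t /andP[_ x0] _]; first exact: ltW (twopi_gt0 R).
  have [p [m [q [h1 h2]]]] := closed t x0.
  by exists (complex.Im p), (complex.Im m), (complex.Im q); split; exact: cdiff2_Im.
have ePR : ri (- A) 0 (fun x => complex.Re (P x (2 * pi))) =
    ri (- A) 0 (fun x => complex.Re (P x 0)).
  by congr (ri _ _ _); apply/funext => x; rewrite P_2pi.
have ePI : ri (- A) 0 (fun x => complex.Im (P x (2 * pi))) =
    ri (- A) 0 (fun x => complex.Im (P x 0)).
  by congr (ri _ _ _); apply/funext => x; rewrite P_2pi.
have cancel (u v w : R) : u + v - u - w = 0 -> v = w.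
  by move=> /eqP; rewrite [u + v]addrC addrK subr_eq0 => /eqP.
move: hR hI; rewrite /circulation ePR ePI => /cancel hR /cancel hI.
exact: (eq_cmean_ri hR hI).
Qed.

Let Q_continuous x : x <= 0 -> ccontinuous (Q x).
Proof.
move=> x0; apply: cdiff2_ccontinuous => t.
by have [p [m [q [_ h]]]] := closed t x0; exists m, q.
Qed.

Let normc_kbar t : normc (kbar t) <= (1 - normc a)^-1.
Proof.
rewrite normcV lef_pV2 ?posrE ?subr_gt0 //; last first.
  by rewrite lt_def normc_ge0 andbT; apply: contra (kbar_neq0 t) => /eqP/eq0_normc ->.
by have := normc_1B (a * conjc (expi t)); rewrite normcM normc_conj normc_expi mulr1.
Qed.

(** As A grows, [G (- A)] tends to [c] uniformly in t and [P] tends to 0, so the mean, which does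
    not depend on A, is 0. *)
Let mean_Q0 : circle_mean (Q 0) = 0.
Proof.
apply: eq0_normc; apply/eqP; rewrite -normr_le0 ger0_norm ?normc_ge0 //.
apply/ler_addgt0Pr => eps e0; rewrite add0r.
have hc : disk c.
  rewrite /disk /= /c normcM normc_real; move: r01 => /andP[r0 r1].
  by rewrite ger0_norm ?(ltW r0) //; apply: le_lt_trans r1; rewrite ler_piMr // ltW.
have [D hD] := hF hc.
have [d d0 h] := hD 1 ltr01.
have a0 : 0 < 1 - normc a by rewrite subr_gt0.
pose K := normc D + 1.
have K0 : 0 < K by rewrite ltr_wpDl ?normc_ge0.
(* [d / 2] keeps [G] strictly within the radius [d], where |F - F c| is at most K times the distance
   to [c]; the second bound absorbs K and |kbar| <= 1 / (1 - |a|). Since |r e^(it) - c| <= 2, [A]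
   has to make [expR (- A)] at most del / 2. *)
pose del := Num.min (d / 2) (eps * (1 - normc a) / K).
have del0 : 0 < del by rewrite lt_min !divr_gt0 // mulr_gt0.
pose A := Num.max 0 (- ln (del / 2)).
have A0 : 0 <= A by rewrite le_max lexx.
rewrite (mean_Q A0).
have xA : - A <= 0 by rewrite oppr_le0.
have eA : expR (- A) <= del / 2.
  rewrite -[leRHS]lnK ?posrE ?divr_gt0 // ler_expR lerNl.
  by rewrite /A le_max lexx orbT.
have hG t : normc (G (- A) t - c) <= del.
  rewrite /G addrC addKr normcM normc_real ger0_norm ?expR_ge0 //.
  have : normc (r%:C * expi t - c) <= 2.
    apply: (le_trans (normcD _ _)); rewrite normcN /c !normcM normc_real normc_expi.
    move: r01 => /andP[r0 r1]; rewrite ger0_norm ?(ltW r0) //.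
    by have := normc_ge0 a; nra.
  have := expR_ge0 (- A); have := normc_ge0 (r%:C * expi t - c).
  by move: (normc _) (expR _) eA => u v; nra.
rewrite -[leRHS](rmean_cst (R := R)).
apply: cmean_bound; [by apply: ccontinuous_cint; exact: Q_continuous|exact: IR_cst|].
move=> t _; rewrite /Q !normcM.
have -> : normc ('i%C : C) = 1 by rewrite /= expr0n expr1n add0r sqrtr1.
rewrite mul1r.
have hP : normc (P (- A) t) <= K * del.
  have hd : normc (G (- A) t - c) < d.
    apply: le_lt_trans (hG t) _; rewrite gt_min; apply/orP; left; lra.
  have := h _ hd; have := hG t; rewrite /P /K.
  have -> : F (G (- A) t) - F c = (F (G (- A) t) - (F c + D * (G (- A) t - c))) +
     D * (G (- A) t - c) by ring.
  move=> h1 h2; apply: (le_trans (normcD _ _)); rewrite normcM.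
  have := normc_ge0 D; move: (normc (_ - (_ + _))) (normc (_ - c)) h1 h2 => u v h1 h2; nra.
have hdel : K * del <= eps * (1 - normc a).
  by rewrite mulrC -ler_pdivlMr // /del ge_min lexx orbT.
apply: (@le_trans _ _ ((K * del) * (1 - normc a)^-1)).
  by apply: ler_pM; rewrite ?normc_ge0.
by rewrite ler_pdivrMr.
Qed.

(** Cauchy's formula in disguise: with zeta = r e^(it), the kernel is zeta / (zeta - r a). It
    follows from [mean_Q0] by splitting F into F c and F - F c; that the remaining mean is 1 is seen
    later from the geometric series. *)
Lemma cauchy_kernel :
  circle_mean (fun t => F (r%:C * expi t) * (1 - a * conjc (expi t))^-1) =
  F (r%:C * a) * circle_mean (fun t => (1 - a * conjc (expi t))^-1).
Proof.
have ck : ccontinuous kbar.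
  have h : ccontinuous (fun t => 'i%C * kbar t).
    by apply: (@cdiff2_ccontinuous (fun _ t => 'i%C * kbar t) 0) => t;
      have [B hB] := cd_kbar 0 t; exists 0, B.
  have -> : kbar = (fun t => (- 'i%C) * ('i%C * kbar t)).
    by apply/funext => t; rewrite mulrA mulNr -expr2 sqr_i opprK mul1r.
  move=> t; have [B hB] := cd_kbar 0 t.
  have h3 := cdiff2_mul (cdiff2_cst (- 'i%C) 0 t) hB; split.
    exact: diff2_continuous (diff2_swap (cdiff2_Re h3)).
  exact: diff2_continuous (diff2_swap (cdiff2_Im h3)).
have E : (fun t => F (r%:C * expi t) * kbar t) = (fun t => F c * kbar t + (- 'i%C) * Q 0 t).
  apply/funext => t; have G0 : G 0 t = r%:C * expi t by rewrite /G expR0 mul1r addrC subrK.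
  rewrite /Q /P G0.
  have -> : - 'i%C * ((F (r%:C * expi t) - F c) * ('i%C * kbar t)) =
     - ('i%C ^+ 2) * ((F (r%:C * expi t) - F c) * kbar t) by ring.
  rewrite sqr_i; ring.
have h1 : cint (fun t => F c * kbar t) by apply: cintZ; exact: ccontinuous_cint.
have h2 : cint (Q 0) by apply: ccontinuous_cint; exact: Q_continuous.
rewrite -/kbar E cmeanD //; last exact: cintZ.
by rewrite !cmeanZ ?mean_Q0 ?mulr0 ?addr0 //; exact: ccontinuous_cint.
Qed.

End Formula.
End CauchyFormula.

(** * Fourier and Taylor coefficients *)

Section Fourier.
Variable R : realType.
Local Notation C := R[i].
Implicit Types (f g : R -> C).

Lemma ccontinuousM f g : ccontinuous f -> ccontinuous g -> ccontinuous (fun t => f t * g t).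
Proof.
move=> hf hg t; have [f1 f2] := hf t; have [g1 g2] := hg t; split.
  have -> : (fun t => complex.Re (f t * g t)) = (fun t =>
     complex.Re (f t) * complex.Re (g t) - complex.Im (f t) * complex.Im (g t)).
    by apply/funext => s; case: (f s) (g s) => x y [x' y'].
  by apply: continuousB; exact: continuousM.
have -> : (fun t => complex.Im (f t * g t)) = (fun t =>
   complex.Re (f t) * complex.Im (g t) + complex.Im (f t) * complex.Re (g t)).
  by apply/funext => s; case: (f s) (g s) => x y [x' y'].
by apply: continuousD; exact: continuousM.
Qed.

Lemma ccontinuousD f g : ccontinuous f -> ccontinuous g -> ccontinuous (fun t => f t + g t).
Proof.
move=> hf hg t; have [f1 f2] := hf t; have [g1 g2] := hg t; split.
  have -> : (fun t => complex.Re (f t + g t)) = (fun t =>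
     complex.Re (f t) + complex.Re (g t)).
    by apply/funext => s; case: (f s) (g s) => x y [x' y'].
  exact: continuousD.
have -> : (fun t => complex.Im (f t + g t)) = (fun t =>
   complex.Im (f t) + complex.Im (g t)).
  by apply/funext => s; case: (f s) (g s) => x y [x' y'].
exact: continuousD.
Qed.

Lemma ccontinuous_cst (c : C) : ccontinuous (fun _ : R => c).
Proof. by move=> t; split; exact: cst_continuous. Qed.

Lemma ccontinuousX f n : ccontinuous f -> ccontinuous (fun t => f t ^+ n).
Proof.
move=> hf; elim: n => [|n IH]; first exact: (ccontinuous_cst 1).
have -> : (fun t => f t ^+ n.+1) = (fun t => f t * f t ^+ n).
  by apply/funext => t; rewrite exprS.
exact: ccontinuousM.
Qed.

Lemma ccontinuous_conj f : ccontinuous f -> ccontinuous (fun t => conjc (f t)).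
Proof.
move=> hf t; have [f1 f2] := hf t; split.
  have -> : (fun t => complex.Re (conjc (f t))) = (fun t => complex.Re (f t)) by
    apply/funext => s; case: (f s).
  by [].
have -> : (fun t => complex.Im (conjc (f t))) = (fun t => - complex.Im (f t)) by
  apply/funext => s; case: (f s).
exact: continuousN.
Qed.

Lemma ccontinuous_expi : ccontinuous (@expi R).
Proof. by move=> t; split; [exact: continuous_cos|exact: continuous_sin]. Qed.

Lemma expiX t n : expi t ^+ n = expi (n%:R * t) :> C.
Proof.
elim: n => [|n IH]; first by rewrite mul0r expr0 /expi cos0 sin0.
rewrite exprS IH /expi -natr1 mulrDl mul1r [_ + t]addrC cosD sinD; simpc.
by congr Complex; ring.
Qed.

Lemma conj_expiX (t : R) n : conjc (expi t) ^+ n = conjc (expi t ^+ n).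
Proof. by rewrite rmorphXn. Qed.

Lemma expi_2npi n : expi (n%:R * (2 * pi)) = 1 :> C.
Proof. by rewrite -expiX expi_2pi /expi cos0 sin0 expr1n. Qed.

Lemma rmean_cos n : rmean (fun t : R => cos (n.+1%:R * t)) = 0.
Proof.
have n0 : n.+1%:R != 0 :> R by rewrite pnatr_eq0.
have dF (t : R) : is_derive t (1 : R) (fun t => (n.+1%:R)^-1 * sin (n.+1%:R * t)) (cos (n.+1%:R * t)).
  by apply: is_derive_eq; rewrite /GRing.scale /=; field; rewrite -natr1 in n0 *.
have hc : cont_on 0 (2 * pi) (fun t : R => cos (n.+1%:R * t)).
  move=> t _; apply: (continuous_comp (f := fun t : R => n.+1%:R * t) (g := @cos R)).
    by apply: continuousM => //; exact: cst_continuous.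
  exact: continuous_cos.
rewrite /rmean -/(ri 0 (2 * pi) _) (ri_FTC (ltW (twopi_gt0 R)) hc dF).
by case: (expi_2npi n.+1) => _ ->; rewrite !mulr0 sin0 mulr0 subrr mulr0.
Qed.

Lemma rmean_sin n : rmean (fun t : R => sin (n.+1%:R * t)) = 0.
Proof.
have n0 : n.+1%:R != 0 :> R by rewrite pnatr_eq0.
have dF (t : R) : is_derive t (1 : R) (fun t => - (n.+1%:R)^-1 * cos (n.+1%:R * t)) (sin (n.+1%:R * t)).
  by apply: is_derive_eq; rewrite /GRing.scale /=; field; rewrite -natr1 in n0 *.
have hc : cont_on 0 (2 * pi) (fun t : R => sin (n.+1%:R * t)).
  move=> t _; apply: (continuous_comp (f := fun t : R => n.+1%:R * t) (g := @sin R)).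
    by apply: continuousM => //; exact: cst_continuous.
  exact: continuous_sin.
rewrite /rmean -/(ri 0 (2 * pi) _) (ri_FTC (ltW (twopi_gt0 R)) hc dF).
by case: (expi_2npi n.+1) => -> _; rewrite !mulr0 cos0 subrr mulr0.
Qed.

Lemma cmean_expiX n : circle_mean (fun t : R => expi t ^+ n) = (n == 0)%:R :> C.
Proof.
case: n => [|n]; first by under eq_fun do rewrite expr0; rewrite cmean_cst.
under eq_fun do rewrite expiX.
by rewrite cmeanE /= rmean_cos rmean_sin.
Qed.

Lemma cmean_expi_orth m n :
  circle_mean (fun t : R => expi t ^+ m * conjc (expi t) ^+ n) = (m == n)%:R :> C.
Proof.
have key k l : circle_mean (fun t : R => expi t ^+ (k + l) * conjc (expi t) ^+ k) = (l == 0)%:R :> C.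
  rewrite -cmean_expiX; congr circle_mean; apply/funext => t.
  by rewrite exprD mulrAC -exprMn expi_conj expr1n mul1r.
have [mn|mn] := leqP n m.
  rewrite -(subnKC mn) key; congr (_%:R); apply/eqP/eqP; lia.
have E : (fun t : R => expi t ^+ m * conjc (expi t) ^+ n) =
    (fun t => conjc (expi t ^+ n * conjc (expi t) ^+ m)) :> (R -> C).
  by apply/funext => t; rewrite conjcM !conj_expiX conjcK mulrC.
rewrite E cmean_conj; last first.
  apply: ccontinuous_cint; apply: ccontinuousM; apply: ccontinuousX.
    exact: ccontinuous_expi.
  exact: ccontinuous_conj ccontinuous_expi.
rewrite -(subnKC (ltnW mn)) key conjc_nat; congr (_%:R); apply/eqP/eqP; lia.
Qed.

Lemma geometric_limit (x K q : R) n0 : 0 <= x -> 0 <= q -> q < 1 ->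
  (forall n, (n0 <= n)%N -> x <= K * q ^+ n) -> x = 0.
Proof.
move=> x0 q0 q1 h; apply/eqP; rewrite eq_le x0 andbT.
have hl : (fun n => K * q ^+ n) @ \oo --> (0 : R).
  rewrite -[0](mulr0 K); apply: cvgM; first exact: cvg_cst.
  by apply: cvg_expr; rewrite ger0_norm.
rewrite -(cvg_lim (@Rhausdorff R) hl); apply: limr_ge; first by apply/cvg_ex; exists 0.
by exists n0 => // n /h.
Qed.

Lemma geometric_tail (x : C) N : 1 - x != 0 ->
  (1 - x)^-1 - \sum_(n < N) x ^+ n = x ^+ N * (1 - x)^-1.
Proof.
move=> x1; apply: (mulIf x1); rewrite mulrBl mulVf // -mulrA mulVf // mulr1.
elim: N => [|N IH]; first by rewrite big_ord0 mul0r subr0 expr0.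
by rewrite big_ord_recr /= mulrDl opprD addrA IH exprSr; ring.
Qed.

Lemma kernel_neq0 (a : C) t : normc a < 1 -> 1 - a * conjc (expi t) != 0.
Proof.
move=> a1; apply: contraTneq a1 => h.
have := normc_1B (a * conjc (expi t)); rewrite h normc0 normcM normc_conj normc_expi mulr1.
by rewrite subr_le0 -leNgt.
Qed.

Lemma normc_kernel (a : C) t : normc a < 1 ->
  normc (1 - a * conjc (expi t))^-1 <= (1 - normc a)^-1.
Proof.
move=> a1; rewrite normcV lef_pV2 ?posrE ?subr_gt0 //.
  by have := normc_1B (a * conjc (expi t)); rewrite normcM normc_conj normc_expi mulr1.
rewrite lt_def normc_ge0 andbT.
by apply: contra (kernel_neq0 t a1) => /eqP/eq0_normc ->.
Qed.

Lemma ccontinuous_kernel (a : C) : normc a < 1 ->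
  ccontinuous (fun t => (1 - a * conjc (expi t))^-1).
Proof.
move=> a1; apply: (@ccontinuous_cdiff1 _ (fun v => v^-1) (fun t => 1 - a * conjc (expi t))).
  have -> : (fun t => 1 - a * conjc (expi t)) = (fun t => 1 + (- a) * conjc (expi t)).
    by apply/funext => t; rewrite mulNr.
  apply: ccontinuousD; first exact: ccontinuous_cst.
  apply: ccontinuousM; first exact: ccontinuous_cst.
  exact: ccontinuous_conj ccontinuous_expi.
by move=> t; eexists; apply: cdiff1_inv; exact: kernel_neq0.
Qed.

Definition fcoef g n := circle_mean (fun t => g t * conjc (expi t) ^+ n).

Lemma cint_fcoef g n : ccontinuous g -> cint (fun t => g t * conjc (expi t) ^+ n).
Proof.
move=> hg; apply: ccontinuous_cint; apply: ccontinuousM => //.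
by apply: ccontinuousX; exact: ccontinuous_conj ccontinuous_expi.
Qed.

(** The tail of the geometric series is (a e^(-it))^N times the kernel, of modulus at most |a|^N /
    (1 - |a|). *)
Lemma cmean_kernel_expand g (M : R) (a : C) N : ccontinuous g -> normc a < 1 ->
  (forall t, angles t -> normc (g t) <= M) ->
  normc (circle_mean (fun t => g t * (1 - a * conjc (expi t))^-1) -
     \sum_(n < N) a ^+ n * fcoef g n) <= M * (normc a ^+ N / (1 - normc a)).
Proof.
move=> hg a1 hM.
have M0 : 0 <= M.
  apply: le_trans (normc_ge0 (g 0)) (hM 0 _).
  by rewrite /angles /= in_itv /= lexx ltW ?twopi_gt0.
have E : circle_mean (fun t => g t * (1 - a * conjc (expi t))^-1) -
     \sum_(n < N) a ^+ n * fcoef g n =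
   circle_mean (fun t => g t * ((a * conjc (expi t)) ^+ N * (1 - a * conjc (expi t))^-1)).
  have -> : \sum_(n < N) a ^+ n * fcoef g n =
     circle_mean (fun t => \sum_(n < N) a ^+ n * (g t * conjc (expi t) ^+ n)).
    rewrite (@cmean_sum R 'I_N _ (fun n t => a ^+ n * (g t * conjc (expi t) ^+ n))).
      by apply: eq_bigr => n _; rewrite cmeanZ //; exact: cint_fcoef.
    by move=> n; apply: cintZ; exact: cint_fcoef.
  rewrite -cmeanB.
  - congr circle_mean; apply/funext => t; rewrite -geometric_tail ?kernel_neq0 //.
    rewrite mulrBr mulr_sumr; congr (_ - _); apply: eq_bigr => n _.
    by rewrite exprMn; ring.
  - apply: ccontinuous_cint; apply: ccontinuousM => //; exact: ccontinuous_kernel.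
  - apply: cint_sum => n; apply: cintZ; exact: cint_fcoef.
rewrite E -[leRHS](rmean_cst (R := R)); apply: cmean_bound; last 1 first.
- move=> t /hM ht; rewrite !normcM.
  have -> : normc ((a * conjc (expi t)) ^+ N) = normc a ^+ N.
    elim: N {E} => [|N IH]; first by rewrite !expr0 normc1.
    by rewrite exprS normcM IH normcM normc_conj normc_expi mulr1 exprS.
  apply: ler_pM => //; first exact: normc_ge0.
    by rewrite mulr_ge0 ?exprn_ge0 ?normc_ge0.
  by rewrite ler_wpM2l ?exprn_ge0 ?normc_ge0 // normc_kernel.
- apply: ccontinuous_cint; apply: ccontinuousM => //.
  apply: ccontinuousM; last exact: ccontinuous_kernel.
  apply: ccontinuousX; apply: ccontinuousM; first exact: ccontinuous_cst.
  exact: ccontinuous_conj ccontinuous_expi.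
- exact: IR_cst.
Qed.

Lemma cmean_kernel1 (a : C) : normc a < 1 ->
  circle_mean (fun t => (1 - a * conjc (expi t))^-1) = 1.
Proof.
move=> a1; apply/eqP; rewrite -subr_eq0; apply/eqP/eq0_normc.
apply: (@geometric_limit _ (1 - normc a)^-1 (normc a) 1) => //; try exact: normc_ge0.
move=> [//|N] _.
have := @cmean_kernel_expand (fun=> 1) 1 a N.+1 (ccontinuous_cst 1) a1.
have -> : (fun t => 1 * (1 - a * conjc (expi t))^-1) = (fun t => (1 - a * conjc (expi t))^-1).
  by apply/funext => t; rewrite mul1r.
have -> : \sum_(n < N.+1) a ^+ n * fcoef (fun=> 1) n = 1.
  have f1 n : fcoef (fun=> 1) n = (n == 0)%:R by rewrite eq_sym; exact: (cmean_expi_orth 0 n).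
  rewrite big_ord_recl big1 => [|n _]; first by rewrite f1 expr0 mulr1 addr0.
  by rewrite f1 mulr0.
move=> h; apply: le_trans (h _) _; first by move=> t _; rewrite normc1.
by rewrite mul1r mulrC.
Qed.

End Fourier.

(** * Taylor coefficients of holomorphic functions *)

Section Taylor.
Variable R : realType.
Local Notation C := R[i].

Definition cholo (F : C -> C) := forall w, disk w -> exists D, cdiff1 F w D.

Lemma holomorphic_cholo (F : C -> C) : holomorphic F -> cholo F.
Proof. by move=> h w /h; exact: derivable_cdiff1. Qed.

Lemma dilateE (F : C -> C) r t : dilate F r t = F (r%:C * expi t).
Proof. by []. Qed.

Lemma normc_circle (r t : R) : normc (r%:C * expi t) = `|r|.
Proof. by rewrite normcM normc_real normc_expi mulr1. Qed.

Lemma disk_circle (r t : R) : 0 <= r < 1 -> disk (r%:C * expi t).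
Proof. by move=> /andP[r0 r1]; rewrite /disk /mkset normc_circle ger0_norm. Qed.

Section Expansion.
Variable F : C -> C.
Hypothesis hF : cholo F.

Lemma dilate_continuous r : 0 <= r < 1 -> ccontinuous (dilate F r).
Proof.
move=> r01; apply: (@ccontinuous_cdiff1 _ F (fun t => r%:C * expi t)).
  by apply: ccontinuousM; [exact: ccontinuous_cst|exact: ccontinuous_expi].
by move=> t; apply: hF; exact: disk_circle.
Qed.

Lemma taylor_bound r (M : R) (a : C) N : 0 < r < 1 -> normc a < 1 ->
  (forall t, angles t -> normc (dilate F r t) <= M) ->
  normc (F (r%:C * a) - \sum_(n < N) a ^+ n * fcoef (dilate F r) n) <=
    M * (normc a ^+ N / (1 - normc a)).
Proof.
move=> r01 a1 hM.
have r01' : 0 <= r < 1 by case/andP: r01 => r0 ->; rewrite ltW.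
have := cmean_kernel_expand N (dilate_continuous r01') a1 hM.
have := cauchy_kernel hF r01 a1; rewrite (cmean_kernel1 a1) mulr1.
by rewrite -/(dilate F r _) => ->.
Qed.

(** With q = r' / r < 1, F (r' e^(it)) = F (r (q e^(it))) is the uniform limit of the polynomials
    [S] in q e^(it) whose coefficients are those at radius r; taking the n-th coefficient gives the
    factor q^n. *)
Lemma fcoef_scale r r' n : 0 < r -> r' < r -> r < 1 -> 0 < r' ->
  fcoef (dilate F r') n = fcoef (dilate F r) n * (r' / r)%:C ^+ n.
Proof.
move=> r0 r'r r1 r'0.
have r01 : 0 < r < 1 by rewrite r0.
have r01' : 0 <= r' < 1 by rewrite (ltW r'0) (lt_trans r'r r1).
have r01'' : 0 <= r < 1 by rewrite (ltW r0) r1.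
have [M M0 hM] := ccontinuous_bounded (dilate_continuous r01'').
set q := r' / r.
have q0 : 0 <= q by rewrite divr_ge0 // ltW.
have q1 : q < 1 by rewrite /q ltr_pdivrMr // mul1r.
have q1' : 0 < 1 - q by rewrite subr_gt0.
apply/eqP; rewrite -subr_eq0; apply/eqP/eq0_normc.
apply: (@geometric_limit _ _ (M / (1 - q)) q n.+1) => // [|N nN]; first exact: normc_ge0.
pose S t := \sum_(m < N) (q%:C * expi t) ^+ m * fcoef (dilate F r) m.
have cS : ccontinuous S.
  rewrite /S; elim: N {nN S} => [|N IH].
    by under eq_fun do rewrite big_ord0; exact: ccontinuous_cst.
  under eq_fun do rewrite big_ord_recr /=.
  apply: ccontinuousD => //; apply: ccontinuousM; last exact: ccontinuous_cst.
  apply: ccontinuousX; apply: ccontinuousM; last exact: ccontinuous_expi.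
  exact: ccontinuous_cst.
have E : fcoef S n = fcoef (dilate F r) n * q%:C ^+ n.
  rewrite /fcoef.
  have -> : (fun t => S t * conjc (expi t) ^+ n) = (fun t => \sum_(m < N)
     (q%:C ^+ m * fcoef (dilate F r) m) * (expi t ^+ m * conjc (expi t) ^+ n)).
    apply/funext => t; rewrite /S mulr_suml; apply: eq_bigr => m _.
    by rewrite exprMn; ring.
  have ci m : cint (fun t : R => expi t ^+ m * conjc (expi t) ^+ n : C).
    by apply: cint_fcoef; apply: ccontinuousX; exact: ccontinuous_expi.
  rewrite (@cmean_sum R 'I_N _ (fun m t => (q%:C ^+ m * fcoef (dilate F r) m) *
    (expi t ^+ m * conjc (expi t) ^+ n))) => [|m]; last exact: cintZ.
  rewrite (bigD1 (Ordinal nN)) //= cmeanZ // cmean_expi_orth eqxx mulr1 big1 ?addr0 => [|m mn].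
    by rewrite mulrC.
  rewrite cmeanZ // cmean_expi_orth -[(m : nat) == n]/(m == Ordinal nN) (negbTE mn).
  by rewrite mulr0.
rewrite -E /fcoef -cmeanB; [|exact: cint_fcoef (dilate_continuous r01')|exact: cint_fcoef].
have -> : M / (1 - q) * q ^+ N = M * (q ^+ N / (1 - q)) by ring.
rewrite -[leRHS](rmean_cst (R := R)).
apply: cmean_bound; [|exact: IR_cst|].
  by apply: cintB; apply: cint_fcoef => //; exact: dilate_continuous.
move=> t _; rewrite -mulrBl normcM.
have -> : normc (conjc (expi t) ^+ n) = 1.
  by rewrite conj_expiX normc_conj expiX normc_expi.
rewrite mulr1.
have nq : normc (q%:C * expi t) = q by rewrite normc_circle ger0_norm.
have := @taylor_bound r M (q%:C * expi t) N r01; rewrite nq => /(_ q1 hM).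
rewrite mulrA -rmorphM /q mulrCA divff ?mulr1 ?gt_eqF // -/q -dilateE.
Qed.

(** Read off at the radius 1/2 and rescaled; [fcoefE] shows that every other radius gives the same
    value. *)
Definition taylor n := fcoef (dilate F (1 / 2)) n * 2 ^+ n.

Lemma half01 : 0 < (1 / 2 : R) /\ (1 / 2 : R) < 1.
Proof. by split; lra. Qed.

Lemma fcoefE r n : 0 < r -> r < 1 -> fcoef (dilate F r) n = taylor n * r%:C ^+ n.
Proof.
move=> r0 r1; rewrite /taylor; have [h0 h1] := half01.
have c2 : (2 : C) = (2 : R)%:C by rewrite rmorph_nat.
have [h|h|->] := ltrgtP r (1 / 2).
- rewrite (fcoef_scale n h0 h) // -mulrA c2 -exprMn -rmorphM.
  by congr (_ * _%:C ^+ _); field.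
- rewrite (fcoef_scale n r0 h) // c2; set q := 1 / 2 / r; rewrite -!mulrA -!exprMn -!rmorphM.
  have -> : q * (2 * r) = 1 by rewrite /q; field; rewrite gt_eqF.
  by rewrite rmorph1 expr1n mulr1.
- rewrite -mulrA c2 -exprMn -rmorphM; have -> : 2 * (1 / 2) = 1 :> R by field.
  by rewrite rmorph1 expr1n mulr1.
Qed.

Lemma taylor_expand r : 0 < r -> r < 1 -> exists2 M : R, 0 < M & forall w N, normc w < r ->
  normc (F w - \sum_(n < N) taylor n * w ^+ n) <= M * ((normc w / r) ^+ N / (1 - normc w / r)).
Proof.
move=> r0 r1; have r01 : 0 <= r < 1 by rewrite ltW.
have [M M0 hM] := ccontinuous_bounded (dilate_continuous r01).
exists M => // w N wr.
have rC : r%:C != 0 :> C by apply/eqP => -[] /eqP; rewrite gt_eqF.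
have nw : normc (w / r%:C) = normc w / r.
  by rewrite normcM normcV normc_real ger0_norm ?(ltW r0).
have := @taylor_bound r M (w / r%:C) N; rewrite r0 r1 nw ltr_pdivrMr // mul1r => /(_ isT wr hM).
have -> : r%:C * (w / r%:C) = w by rewrite mulrCA divff ?mulr1.
have -> // : \sum_(n < N) (w / r%:C) ^+ n * fcoef (dilate F r) n = \sum_(n < N) taylor n * w ^+ n.
apply: eq_bigr => n _; rewrite fcoefE // mulrCA -exprMn divfK //.
Qed.

End Expansion.

(** [b] are the coefficients of a uniformly convergent analytic trigonometric series with sum [g];
    uniformity makes Parseval's identity a limit of finite sums. *)
Definition usum (g : R -> C) (b : nat -> C) := ccontinuous g /\
  forall eps : R, 0 < eps -> exists n0, forall N t, (n0 <= N)%N ->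
    normc (g t - \sum_(n < N) b n * expi t ^+ n) <= eps.

Lemma usum_lin (a : C) g g' b b' : usum g b -> usum g' b' ->
  usum (fun t => a * g t + g' t) (fun n => a * b n + b' n).
Proof.
move=> [cg hg] [cg' hg']; split.
  by apply: ccontinuousD => //; apply: ccontinuousM => //; exact: ccontinuous_cst.
move=> eps e0; have a1 : 0 < 2 * (normc a + 1) by rewrite mulr_gt0 // ltr_wpDl ?normc_ge0.
have [|n0 h0] := hg (eps / (2 * (normc a + 1))); first by rewrite divr_gt0.
have [|n1 h1] := hg' (eps / 2); first by rewrite divr_gt0.
exists (maxn n0 n1) => N t; rewrite geq_max => /andP[/(h0 _ t) {}h0 /(h1 _ t) {}h1].
have -> : a * g t + g' t - \sum_(n < N) (a * b n + b' n) * expi t ^+ n =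
   a * (g t - \sum_(n < N) b n * expi t ^+ n) + (g' t - \sum_(n < N) b' n * expi t ^+ n).
  rewrite mulrBr mulr_sumr addrACA -opprD -big_split /=; congr (_ - _).
  by apply: eq_bigr => n _; rewrite mulrDl mulrA.
apply: (le_trans (normcD _ _)); rewrite normcM.
move: h0; rewrite ler_pdivlMr // => h0.
have := normc_ge0 a; have := normc_ge0 (g t - \sum_(n < N) b n * expi t ^+ n).
move: (normc a) (normc (g t - _)) h0 => x y; nra.
Qed.

Lemma usum_dilate F r : cholo F -> 0 <= r -> r < 1 ->
  usum (dilate F r) (fun n => taylor F n * r%:C ^+ n).
Proof.
move=> hF r0 r1; split; first by apply: dilate_continuous => //; rewrite r0.
move=> eps e0; pose s := (1 + r) / 2.
have s0 : 0 < s by rewrite /s; lra.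
have s1 : s < 1 by rewrite /s; lra.
have rs : r < s by rewrite /s; lra.
have [M M0 h] := taylor_expand hF s0 s1.
pose q := r / s.
have q0 : 0 <= q by rewrite divr_ge0 // ltW.
have q1 : q < 1 by rewrite /q ltr_pdivrMr // mul1r.
have q1' : 0 < 1 - q by rewrite subr_gt0.
have nq : `|q| < 1 by rewrite ger0_norm.
have /cvgrPdist_lt hc := cvg_expr nq.
have [|n0 _ hn] := hc (eps * (1 - q) / M); first by rewrite !mulr_gt0 ?invr_gt0.
exists n0 => N t /hn /=; rewrite sub0r normrN ger0_norm ?exprn_ge0 // => {}hn.
rewrite dilateE.
have := h (r%:C * expi t) N; rewrite normc_circle ger0_norm // -/q => /(_ rs).
have -> : \sum_(n < N) taylor F n * (r%:C * expi t) ^+ n =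
   \sum_(n < N) taylor F n * r%:C ^+ n * expi t ^+ n.
  by apply: eq_bigr => n _; rewrite exprMn mulrA.
move=> {}h; apply: (le_trans h); rewrite mulrA ler_pdivrMr // -ler_pdivlMl //.
by rewrite mulrC; exact: ltW.
Qed.

End Taylor.

(** * Completeness of L^2 of the circle *)

Section L2Complete.
Variable R : realType.
Local Notation C := R[i].
Local Notation Om := (@angles R).
Local Notation mu := (@lebesgue_measure R).
Local Notation N := (hnorm (@L2_ip R)).
Implicit Types (f g : R -> C).

Lemma IR_of_integral (f : R -> R) (B : R) : measurable_fun Om f -> (forall t, 0 <= f t) ->
  (\int[mu]_(t in Om) (f t)%:E <= (2 * pi * B)%:E)%E -> IR f /\ rmean f <= B.
Proof.
move=> mf f0 h.
have If : IR f by apply: IR_ltoo => //; apply: (le_lt_trans h); rewrite ltry.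
split=> //; rewrite -lee_fin -rmean_EFin //.
have c0 := twopi_gt0 R.
apply: (@le_trans _ _ ((2 * pi)^-1%:E * (2 * pi * B)%:E)%E).
  by apply: lee_wpmul2l => //; rewrite lee_fin invr_ge0 ltW.
by rewrite -EFinM lee_fin mulrA mulVf ?mul1r // gt_eqF.
Qed.

Lemma integral_rmean (f : R -> R) : IR f ->
  (\int[mu]_(t in Om) (f t)%:E)%E = (2 * pi * rmean f)%:E.
Proof.
move=> If; rewrite /rmean mulrA divff ?mul1r ?gt_eqF ?twopi_gt0 //.
by rewrite /Rintegral fineK //; apply: integrable_fin_num => //; exact: measurable_angles.
Qed.

Lemma aeS (P Q : R -> Prop) : (forall t, P t -> Q t) ->
  {ae mu, forall t, P t} -> {ae mu, forall t, Q t}.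
Proof.
by move=> PQ; apply: filterS => //; exact: (ae_filter_ringOfSetsType mu).
Qed.

Lemma ae_L2 f g : cmeasurable f -> {ae mu, forall t, Om t -> f t = g t} -> L2 g ->
  L2 f /\ N f = N g.
Proof.
move=> mf fg /[dup] /L2P[mg ig] hg.
have E : (\int[mu]_(t in Om) (normc (f t) ^+ 2)%:E =
    \int[mu]_(t in Om) (normc (g t) ^+ 2)%:E)%E.
  apply: ge0_ae_eq_integral.
  - exact: measurable_angles.
  - by apply/measurable_EFinP; exact: cmeasurable_normc.
  - by apply/measurable_EFinP; exact: cmeasurable_normc.
  - by move=> t _; rewrite lee_fin sqr_ge0.
  - by move=> t _; rewrite lee_fin sqr_ge0.
  - by apply: aeS fg => t h Ot; rewrite h.
have hf : L2 f.
  apply/L2P; split => //; apply: IR_ltoo; [exact: cmeasurable_normc|by move=> t; rewrite sqr_ge0|].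
  by rewrite E integral_rmean // ltry.
split=> //; apply: (@pexpIrn _ 2) => //; rewrite ?nnegrE ?hnorm_ge0 // !L2_norm_sqr.
by rewrite /rmean /Rintegral E.
Qed.

Lemma rmean_of_ae (f : R -> R) : IR f -> (forall t, 0 <= f t) -> rmean f <= 0 ->
  {ae mu, forall t, Om t -> f t = 0}.
Proof.
move=> If f0 h.
have mE : measurable_fun Om (EFin \o f) by exact: measurable_int If.
have [hae _] := ae_eq_integral_abs (@lebesgue_measure R) (@measurable_angles R) mE.
have /hae : (\int[mu]_(t in Om) `|(EFin \o f) t|)%E = 0%E.
  under eq_integral do rewrite /= ger0_norm //.
  rewrite integral_rmean //; congr _%:E; apply/eqP; rewrite mulf_eq0; apply/orP; right.
  by rewrite eq_le h rmean_ge0.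
by apply: aeS => t ht /ht [].
Qed.

Definition absRI f t := `|complex.Re (f t)| + `|complex.Im (f t)|.

Lemma measurable_absRI f : cmeasurable f -> measurable_fun Om (absRI f).
Proof. by move=> [m1 m2]; apply: measurable_funD; exact: measurableT_comp. Qed.

(** |Re f| + |Im f| is at most |f|^2 / l + l, a weighted arithmetic-geometric inequality; both terms
    have mean at most l when the L^2 norm of f is at most l. *)
Lemma rmean_absRI f (l : R) : L2 f -> 0 < l -> N f <= l ->
  IR (absRI f) /\ rmean (absRI f) <= 2 * l.
Proof.
move=> /L2P[mf hf] l0 fl.
have b t : absRI f t <= l^-1 * normc (f t) ^+ 2 + l.
  rewrite /absRI; have -> : l^-1 * normc (f t) ^+ 2 + l = (normc (f t) ^+ 2 + l ^+ 2) / l.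
    by field; rewrite gt_eqF.
  rewrite ler_pdivlMr // sqr_normc; case: (f t) => x y /=.
  rewrite -(real_normK (num_real x)) -(real_normK (num_real y)).
  have := sqr_ge0 (`|x| - l / 2); have := sqr_ge0 (`|y| - l / 2).
  move: `|x| `|y| => u v; have := sqr_ge0 l; nra.
have ib : IR (fun t => l^-1 * normc (f t) ^+ 2 + l) by apply: IR_lin => //; exact: IR_cst.
have ia : IR (absRI f).
  apply: IR_dominated ib; first exact: measurable_absRI.
  by move=> t _; rewrite ger0_norm ?b // addr_ge0.
split=> //; apply: (le_trans (le_rmean ia ib _)) => [t _|]; first exact: b.
rewrite rmean_lin //; last exact: IR_cst.
rewrite rmean_cst -L2_norm_sqr.
have h : l^-1 * N f ^+ 2 <= l.
  by rewrite mulrC ler_pdivrMr // -expr2 ler_pXn2r ?nnegrE ?hnorm_ge0 // ltW.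
by rewrite mulr2n mulrDl mul1r lerD2r.
Qed.

Lemma half_sum n : \sum_(k < n) (2 : R) ^- k <= 2.
Proof.
suff -> : \sum_(k < n) (2 : R) ^- k = 2 - 2 * 2 ^- n.
  by rewrite lerBlDr lerDl mulr_ge0 // invr_ge0 exprn_ge0.
elim: n => [|n IH]; first by rewrite big_ord0 expr0; field.
by rewrite big_ord_recr /= IH exprS; field; rewrite expf_neq0.
Qed.

Lemma half_pow_small (eps : R) : 0 < eps -> exists k, 2 * 2 ^- k <= eps.
Proof.
move=> e0; exists (Num.bound (2 / eps)); rewrite ler_pdivrMr ?exprn_gt0 // mulrC -ler_pdivrMr //.
apply: ltW; apply: lt_trans (archi_boundP _) _; first by rewrite divr_ge0 // ltW.
by rewrite -natrX ltr_nat ltn_expl.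
Qed.

(** Riesz-Fischer: for a rapidly Cauchy sequence the increments are absolutely summable almost
    everywhere, which defines the limit pointwise, and Fatou's lemma gives the rate. *)
Lemma L2_fast_limit (u : nat -> R -> C) : (forall k, L2 (u k)) ->
  (forall k m, (k <= m)%N -> N (u m - u k) <= 2 ^- k) ->
  exists2 g, L2 g & forall k, N (u k - g) <= 2 ^- k.
Proof.
move=> Lu hu.
have mu_ k : cmeasurable (u k) by case/L2P: (Lu k).
pose w k := absRI (u k.+1 - u k).
have Ld k m : L2 (u m - u k) by exact: L2_B.
have hw k : IR (w k) /\ rmean (w k) <= 2 * 2 ^- k.
  by apply: rmean_absRI => //; exact: hu.
have mw k : measurable_fun Om (w k) by exact: IR_measurable (hw k).1.
have w0 k t : 0 <= w k t by rewrite addr_ge0.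
(* The sum of the increments. The means of the [w k] add up to at most 4, so its integral is finite
   and it is finite almost everywhere. *)
pose T t := (\sum_(k <oo) (w k t)%:E)%E.
have mT : measurable_fun Om T.
  apply: (@ge0_emeasurable_sum _ _ _ Om (fun k t => (w k t)%:E) xpredT) => [k t _ _|k _].
    by rewrite lee_fin.
  by apply/measurable_EFinP; exact: mw.
have T0 t : (0 <= T t)%E by apply: nneseries_ge0 => k _ _; rewrite lee_fin.
have iT : (\int[mu]_(t in Om) T t <= (2 * pi * 4)%:E)%E.
  have mwE k : measurable_fun Om (fun t => (w k t)%:E) by apply/measurable_EFinP; exact: mw.
  have w0E k t : Om t -> (0 <= (w k t)%:E)%E by rewrite lee_fin.
  rewrite /T (integral_nneseries (@lebesgue_measure R) (@measurable_angles R) mwE w0E).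
  apply: lime_le; first by apply: is_cvg_nneseries => k _ _; apply: integral_ge0 => t _; rewrite lee_fin.
  apply: nearW => n /=; under eq_bigr do rewrite integral_rmean ?(hw _).1 //.
  rewrite sumEFin lee_fin -mulr_sumr ler_wpM2l ?(ltW (twopi_gt0 R)) //.
  apply: (@le_trans _ _ (\sum_(0 <= k < n) 2 * 2 ^- k)).
    by apply: ler_sum => k _; exact: (hw k).2.
  by rewrite -mulr_sumr big_mkord; have := half_sum n; lra.
have aeT : {ae mu, forall t, Om t -> T t \is a fin_num}.
  apply: integrable_ae; first exact: measurable_angles.
  apply/integrableP; split => //.
  under eq_integral do rewrite gee0_abs //.
  by apply: le_lt_trans iT _; rewrite ltry.
pose A := Om `&` [set t | T t \is a fin_num].
have mA : measurable (A : set (measurableTypeR R)).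
  exact: (emeasurable_fin_num (@measurable_angles R) mT).
(* Cutting off to the set [A] where [T] is finite makes the sequence [v] converge at every angle, so
   that its limit is measurable. *)
pose chi t : C := (\1_A t : R)%:C.
have mchi : cmeasurable chi.
  split; first exact: measurable_indic.
  exact: measurable_cst.
pose v k t := chi t * u k t.
have mv k : cmeasurable (v k) by exact: cmeasurableM.
have chiA t : A t -> chi t = 1 by move=> h; rewrite /chi indicE mem_set.
have chiN t : ~ A t -> chi t = 0 by move=> h; rewrite /chi indicE memNset.
have chi1 t : normc (chi t) <= 1.
  have [/chiA ->|/chiN ->] := pselect (A t); by rewrite ?normc1 ?normc0.
have cvg_part (p : C -> R) t : (forall x y, p (x - y) = p x - p y) ->
    (forall k, `|p (u k.+1 t - u k t)| <= w k t) -> p 0 = 0 ->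
    cvgn (fun k => p (v k t)).
  move=> pB pw p0; have [At|At] := pselect (A t); last first.
    rewrite /v chiN //; under eq_fun do rewrite mul0r p0; exact: is_cvg_cst.
  rewrite /v chiA //; under eq_fun do rewrite mul1r.
  have cw : cvgn (series (fun k => w k t)).
    apply: nondecreasing_is_cvgn.
      move=> m n mn; rewrite /series /= (big_cat_nat (leq0n m) mn) /= lerDl.
      by apply: sumr_ge0.
    exists (fine (T t)) => _ [n _ <-]; rewrite -lee_fin fineK; last by case: At.
    rewrite /series /= -sumEFin; apply: nneseries_lim_ge => k _ _; by rewrite lee_fin.
  have cd : cvgn (series (fun k => p (u k.+1 t) - p (u k t))).
    apply: normed_cvg; apply: (@series_le_cvg _ _ (fun k => w k t)) => //= k.
    by rewrite -pB.
  have -> : (fun k => p (u k t)) = (fun k => series (fun k => p (u k.+1 t) - p (u k t)) k + p (u 0%N t)).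
    by apply/funext => k; rewrite /series /= telescope_sumr // subrK.
  by apply: is_cvgD => //; exact: is_cvg_cst.
have cRe t : cvgn (fun k => complex.Re (v k t)).
  apply: cvg_part => //; first by move=> x y; rewrite ReD ReN.
  by move=> k; rewrite /w /absRI lerDl.
have cIm t : cvgn (fun k => complex.Im (v k t)).
  apply: cvg_part => //; first by move=> [x y] [x' y'].
  by move=> k; rewrite /w /absRI lerDr.
pose g t := Complex (limn (fun k => complex.Re (v k t))) (limn (fun k => complex.Im (v k t))).
have mg : cmeasurable g.
  by split; [apply: (measurable_fun_cvg (fun k => (mv k).1)) => t _; exact: cRe|
             apply: (measurable_fun_cvg (fun k => (mv k).2)) => t _; exact: cIm].
have mgv k : cmeasurable (g - v k).
  have -> : g - v k = (fun t => -1 * v k t + g t) by apply/funext => t; rewrite mulN1r addrC.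
  exact: cmeasurable_lin.
(* Fatou's lemma in m for |v m - v k|^2, whose integrals are bounded for m >= k. *)
have key k : L2 (g - v k) /\ N (g - v k) <= 2 ^- k.
  have p2 : 0 <= (2 : R) ^- k by rewrite invr_ge0 exprn_ge0.
  pose f m t := (normc (v m t - v k t) ^+ 2)%:E.
  have f0 m t : (0 <= f m t)%E by rewrite lee_fin sqr_ge0.
  have mf m : measurable_fun Om (f m).
    apply/measurable_EFinP; apply: (@cmeasurable_normc _ (fun t => v m t - v k t)).
    have -> : (fun t => v m t - v k t) = (fun t => -1 * v k t + v m t).
      by apply/funext => t; rewrite mulN1r addrC.
    exact: cmeasurable_lin.
  have hlim t : limn_einf (f^~ t) = (normc ((g - v k) t) ^+ 2)%:E.
    have /cvg_limn_einf_sup[->] // : f^~ t @ \oo --> (normc ((g - v k) t) ^+ 2)%:E.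
    apply: cvg_EFin; first by apply: nearW.
    have -> : fine \o f^~ t = (fun m =>
        (complex.Re (v m t) - complex.Re (v k t)) * (complex.Re (v m t) - complex.Re (v k t)) +
        (complex.Im (v m t) - complex.Im (v k t)) * (complex.Im (v m t) - complex.Im (v k t))).
      by apply/funext => m /=; rewrite sqr_normc !expr2; case: (v m t) (v k t) => x y [x' y'].
    have -> : normc ((g - v k) t) ^+ 2 =
        (complex.Re (g t) - complex.Re (v k t)) * (complex.Re (g t) - complex.Re (v k t)) +
        (complex.Im (g t) - complex.Im (v k t)) * (complex.Im (g t) - complex.Im (v k t)).
      by rewrite sqr_normc !expr2 -[(g - v k) t]/(g t - v k t); case: (g t) (v k t) => x y [x' y'].
    have cr : (fun m => complex.Re (v m t) - complex.Re (v k t)) @ \oo -->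
        complex.Re (g t) - complex.Re (v k t) by apply: cvgB; [exact: cRe|exact: cvg_cst].
    have ci : (fun m => complex.Im (v m t) - complex.Im (v k t)) @ \oo -->
        complex.Im (g t) - complex.Im (v k t) by apply: cvgB; [exact: cIm|exact: cvg_cst].
    by apply: cvgD; exact: cvgM.
  have fat := fatou (@lebesgue_measure R) (@measurable_angles R) mf (fun m t _ => f0 m t).
  have bnd m : (k <= m)%N -> (\int[mu]_(t in Om) f m t <= (2 * pi * (2 ^- k) ^+ 2)%:E)%E.
    move=> km; have /L2P[_ i2] := Ld k m.
    apply: (@le_trans _ _ (\int[mu]_(t in Om) (normc ((u m - u k) t) ^+ 2)%:E)%E).
      apply: ge0_le_integral => //.
      - exact: measurable_angles.
      - exact: mf.
      - by apply/measurable_EFinP; apply: cmeasurable_normc; case/L2P: (Ld k m).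
      - move=> t _; rewrite lee_fin /v -mulrBr normcM exprMn ler_piMl ?sqr_ge0 //.
        by rewrite expr_le1 ?normc_ge0.
    rewrite integral_rmean // lee_fin ler_wpM2l ?(ltW (twopi_gt0 R)) // -L2_norm_sqr.
    by rewrite ler_pXn2r ?nnegrE ?hnorm_ge0 // hu.
  have le_int : (\int[mu]_(t in Om) (normc ((g - v k) t) ^+ 2)%:E <= (2 * pi * (2 ^- k) ^+ 2)%:E)%E.
    under eq_integral do rewrite -hlim.
    apply: (le_trans fat); rewrite limn_einf_lim; apply: lime_le; first exact: is_cvg_einfs.
    apply: nearW => n; apply: le_trans (bnd (maxn n k) (leq_maxr _ _)).
    by apply: ereal_inf_lbound; exists (maxn n k) => //=; exact: leq_maxl.
  have [i1 i2] := IR_of_integral (cmeasurable_normc (mgv k)) (fun t => sqr_ge0 _) le_int.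
  split; first by apply/L2P; split.
  by rewrite -(@ler_pXn2r _ 2) ?nnegrE ?hnorm_ge0 // L2_norm_sqr.
(* Off a null set [v k] is [u k], so the bound carries over to the original sequence. *)
have aev k : {ae mu, forall t, Om t -> (u k - g) t = - (g - v k) t}.
  apply: aeS aeT => t hT Ot; have At : A t by split => //; exact: hT.
  by rewrite -[(u k - g) t]/(u k t - g t) -[(g - v k) t]/(g t - v k t) /v chiA // mul1r opprB.
have mug k : cmeasurable (u k - g).
  have -> : u k - g = (fun t => -1 * g t + u k t) by apply/funext => t; rewrite mulN1r addrC.
  exact: cmeasurable_lin.
have hug k : L2 (u k - g) /\ N (u k - g) <= 2 ^- k.
  have [L Nk] := key k.
  have LN : L2 (- (g - v k)) by rewrite -[- _]addr0 -scaleN1r; apply: L2_lin => //; exact: L2_0.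
  have [L' ->] := ae_L2 (mug k) (aev k) LN.
  by split => //; rewrite L2_hnormN.
exists g; last by move=> k; exact: (hug k).2.
have -> : g = u 0%N - (u 0%N - g) by rewrite opprB addrC subrK.
by apply: L2_B => //; exact: (hug 0%N).1.
Qed.

End L2Complete.

(** * Boundary functions *)

Section Parseval.
Variable R : realType.
Local Notation C := R[i].
Local Notation N := (hnorm (@L2_ip R)).
Implicit Types (g : R -> C) (b : nat -> C).

Lemma L2_norm_le g (M : R) : L2 g -> 0 <= M -> (forall t, angles t -> normc (g t) <= M) ->
  N g <= M.
Proof.
move=> /L2P[_ ig] M0 hM; rewrite -(@ler_pXn2r _ 2) ?nnegrE ?hnorm_ge0 // L2_norm_sqr.
rewrite -[leRHS](rmean_cst (R := R)); apply: le_rmean => //; first exact: IR_cst.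
by move=> t /hM h; rewrite ler_pXn2r ?nnegrE ?normc_ge0.
Qed.

Definition trig_sum b n : R -> C := fun t => \sum_(k < n) b k * expi t ^+ k.

Lemma trig_sum_continuous b n : ccontinuous (trig_sum b n).
Proof.
rewrite /trig_sum; elim: n => [|n IH].
  by under eq_fun do rewrite big_ord0; exact: ccontinuous_cst.
under eq_fun do rewrite big_ord_recr /=.
apply: ccontinuousD => //; apply: ccontinuousM; first exact: ccontinuous_cst.
by apply: ccontinuousX; exact: ccontinuous_expi.
Qed.

Lemma expiX_L2 n : L2 (fun t : R => expi t ^+ n).
Proof. by apply: ccontinuous_L2; apply: ccontinuousX; exact: ccontinuous_expi. Qed.

Lemma expi_porth : porth (sub_ip (@L2_ip R) (hK := L2_subspace R)) xpredT
  (fun k => to_sub (L2_subspace R) (fun t : R => expi t ^+ k)).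
Proof.
move=> i j; rewrite /sub_ip !to_subK ?andbT; [|exact: expiX_L2|exact: expiX_L2].
rewrite L2_ipE -cmean_expi_orth; congr circle_mean; apply/funext => t.
by rewrite conj_expiX.
Qed.

Lemma trig_sum_norm b n : N (trig_sum b n) ^+ 2 = \sum_(k < n) normc (b k) ^+ 2.
Proof.
pose e k := to_sub (L2_subspace R) (fun t : R => expi t ^+ k).
have := sqr_hnorm_porth (sub_L2_semi_ip R) b expi_porth (iota_uniq 0 n).
have -> : \sum_(i <- iota 0 n) normc (b i) ^+ 2 * (xpredT i)%:R = \sum_(k < n) normc (b k) ^+ 2.
  rewrite -(big_mkord xpredT (fun i => normc (b i) ^+ 2)) /index_iota subn0.
  by apply: eq_bigr => i _; rewrite mulr1.
move=> <-; set x := \sum_(_ <- _) _.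
rewrite -[hnorm (sub_ip _ (hK := _)) x]/(N (subspace_val x)); congr (N _ ^+ 2).
apply/esym; rewrite {}/x -psum_nat; etransitivity; first exact: sv_sum.
apply/funext => t; rewrite fct_sumE /trig_sum; apply: eq_bigr => i _.
have -> : subspace_val (b i *: e i) = b i *: subspace_val (e i) by exact: svZ.
by rewrite to_subK //; exact: expiX_L2.
Qed.

Lemma usum_L2 g b : usum g b -> L2 g.
Proof. by move=> [cg _]; exact: ccontinuous_L2. Qed.

Lemma usum_dist g b : usum g b -> forall eps : R, 0 < eps -> exists n0, forall n, (n0 <= n)%N ->
  `|N g - N (trig_sum b n)| <= eps.
Proof.
move=> hg eps e0; have [_ /(_ _ e0)[n0 h]] := hg; exists n0 => n nn.
have Lg := usum_L2 hg; have Lt : L2 (trig_sum b n) by apply: ccontinuous_L2; exact: trig_sum_continuous.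
have Ld : L2 (g - trig_sum b n) by exact: L2_B.
have hd : N (g - trig_sum b n) <= eps.
  by apply: L2_norm_le => //; [exact: ltW|move=> t _; exact: h].
have h1 := L2_hnormD Ld Lt; rewrite subrK in h1.
have h2 := L2_hnormD Lg (L2_B Lt Lg); rewrite addrC subrK in h2.
rewrite -L2_hnormN opprB in hd.
have h3 := L2_hnormN (trig_sum b n - g); rewrite opprB in h3.
by rewrite ler_norml; lra.
Qed.

(** With [usum_le], the two halves of Parseval's identity: the norms of the partial sums increase
    with n and tend to the norm of [g]. *)
Lemma usum_ge g b n : usum g b -> \sum_(k < n) normc (b k) ^+ 2 <= N g ^+ 2.
Proof.
move=> hg; rewrite -trig_sum_norm ler_pXn2r ?nnegrE ?hnorm_ge0 //.
apply/ler_addgt0Pr => eps e0; have [n0 h] := usum_dist hg e0.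
have {}h := h _ (leq_maxl n0 n).
have : N (trig_sum b n) <= N (trig_sum b (maxn n0 n)).
  rewrite -(@ler_pXn2r _ 2) ?nnegrE ?hnorm_ge0 // !trig_sum_norm.
  rewrite -!(big_mkord xpredT (fun i => normc (b i) ^+ 2)).
  rewrite (big_cat_nat (leq0n n) (leq_maxr n0 n)) /= lerDl.
  by apply: sumr_ge0 => i _; exact: sqr_ge0.
by move: h; rewrite ler_norml; lra.
Qed.

Lemma usum_le g b (B : R) : usum g b -> (forall n, \sum_(k < n) normc (b k) ^+ 2 <= B) ->
  N g ^+ 2 <= B.
Proof.
move=> hg hB.
have B0 : 0 <= B by have := hB 0%N; rewrite big_ord0.
suff : N g <= Num.sqrt B.
  by move=> h; rewrite -[leRHS](sqr_sqrtr B0) ler_pXn2r ?nnegrE ?hnorm_ge0 ?sqrtr_ge0.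
apply/ler_addgt0Pr => eps e0; have [n0 h] := usum_dist hg e0.
have {}h := h _ (leqnn n0).
have : N (trig_sum b n0) <= Num.sqrt B.
  rewrite -(@ler_pXn2r _ 2) ?nnegrE ?hnorm_ge0 ?sqrtr_ge0 // trig_sum_norm.
  by rewrite sqr_sqrtr.
by move: h; rewrite ler_norml; lra.
Qed.

End Parseval.

(** * Square summable Taylor coefficients and radial limits in L^2 *)

Section Boundary.
Variable R : realType.
Local Notation C := R[i].
Local Notation N := (hnorm (@L2_ip R)).
Implicit Types (g h : R -> C) (F G : C -> C).

Definition ell2_bound (a : nat -> C) (B : R) := forall n, \sum_(k < n) normc (a k) ^+ 2 <= B.

Lemma dilate_L2 F r : cholo F -> 0 <= r -> r < 1 -> L2 (dilate F r).
Proof. by move=> hF r0 r1; apply/ccontinuous_L2/dilate_continuous => //; rewrite r0. Qed.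

(** Bounds 1 - x^n by n (1 - x); the estimates of how fast r^n tends to 1 as r does rest on it. *)
Lemma bernoulli (x : R) n : 0 <= x -> 1 - n%:R * (1 - x) <= x ^+ n.
Proof.
move=> x0; elim: n => [|n IH]; first by rewrite mul0r subr0 expr0.
have [h|h] := leP 0 (1 - n%:R * (1 - x)).
  rewrite exprS -natr1; apply: (@le_trans _ _ (x * (1 - n%:R * (1 - x)))); last by rewrite ler_wpM2l.
  have : 0 <= n%:R * (1 - x) ^+ 2 by rewrite mulr_ge0 ?sqr_ge0.
  by move: n%:R {IH h} => m hm; nra.
have : 0 <= x ^+ n.+1 by rewrite exprn_ge0.
have [x1|x1] := leP x 1.
  by rewrite -natr1; move: n%:R h {IH} => m h hx; nra.
have : 0 <= n%:R :> R by [].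
by rewrite -natr1; move: n%:R h {IH} => m h hm hx; nra.
Qed.

Lemma taylor_ell2 F (B : R) : cholo F ->
  (forall r, 0 <= r -> r < 1 -> N (dilate F r) ^+ 2 <= B) -> ell2_bound (taylor F) B.
Proof.
move=> hF hB n; set S := \sum_(_ < _) _.
have S0 : 0 <= S by apply: sumr_ge0 => i _; exact: sqr_ge0.
apply/ler_addgt0Pr => eps e0.
(* At radius 1 - d every factor (1 - d)^(2k) with k < n is at least 1 - 2 n d, so the loss is at
   most 2 n d S <= d K <= eps. *)
pose K := (2 * n)%N%:R * S + 1.
have K0 : 0 < K by rewrite ltr_wpDl // mulr_ge0.
pose d := Num.min (1 / 2) (eps / K).
have d0 : 0 < d by rewrite lt_min !divr_gt0.
have d1 : d <= 1 / 2 by rewrite ge_min lexx.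
have dK : d * K <= eps by rewrite -ler_pdivlMr // ge_min lexx orbT.
have r0 : 0 <= 1 - d by lra.
have r1 : 1 - d < 1 by lra.
have h1 := hB _ r0 r1; have h2 := usum_ge n (usum_dilate hF r0 r1).
have h3 : (1 - d) ^+ (2 * n) * S <= \sum_(k < n) normc (taylor F k * (1 - d)%:C ^+ k) ^+ 2.
  rewrite mulr_sumr; apply: ler_sum => k _; rewrite (normcM (taylor F k)) (exprMn 2 (normc (taylor F k))) mulrC ler_wpM2l ?sqr_ge0 //.
  rewrite -rmorphXn normc_real ger0_norm ?exprn_ge0 // -exprM.
  apply: ler_wiXn2l => //; first lra.
  by rewrite mulnC leq_mul2l /= ltnW.
have h4 := bernoulli (2 * n) r0; rewrite opprB addrCA subrr addr0 in h4.
have h5 : (1 - (2 * n)%N%:R * d) * S <= (1 - d) ^+ (2 * n) * S by rewrite ler_wpM2r.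
have h6 : (2 * n)%N%:R * d * S <= d * K.
  have -> : d * K = (2 * n)%N%:R * d * S + d by rewrite /K; ring.
  by rewrite lerDl ltW.
move: h5; rewrite mulrBl mul1r; lra.
Qed.

(** Coefficients from [n0] on carry at most eps^2 / 2 of the square sum, and |r^k - s^k| <= 1; for k
    < n0, |r^k - s^k|^2 <= n0^2 d, which the choice of [d] makes small. *)
Lemma dilate_cauchy F (B : R) : cholo F -> ell2_bound (taylor F) B ->
  forall eps : R, 0 < eps -> exists2 d : R, 0 < d < 1 & forall r s,
    1 - d <= r -> r < 1 -> 1 - d <= s -> s < 1 -> N (dilate F r - dilate F s) <= eps.
Proof.
move=> hF hB eps e0; pose a := taylor F.
pose u n := \sum_(k < n) normc (a k) ^+ 2.
have hs : has_sup (range u) by split; [exists (u 0%N), 0%N|exists B => _ [n _ <-]; exact: hB].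
have e2 : 0 < eps ^+ 2 / 2 by rewrite divr_gt0 ?exprn_gt0.
have [_ [n0 _ <-] hn0] := sup_adherent e2 hs.
have le_sup n : u n <= sup (range u) by apply: ub_le_sup; [case: hs|exists n].
have u0 : 0 <= u n0 by apply: sumr_ge0 => i _; exact: sqr_ge0.
pose K := 2 * (n0%:R ^+ 2 * u n0 + 1).
have K0 : 0 < K by rewrite mulr_gt0 // ltr_wpDl // mulr_ge0 ?sqr_ge0.
pose d := Num.min (1 / 2) (eps ^+ 2 / K).
have d0 : 0 < d by rewrite lt_min !divr_gt0 ?exprn_gt0.
have d1 : d <= 1 / 2 by rewrite ge_min lexx.
have dK : d * K <= eps ^+ 2 by rewrite -ler_pdivlMr // ge_min lexx orbT.
exists d; first by apply/andP; split => //; lra.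
move=> r s hr r1 hs' s1.
have r0 : 0 <= r by lra.
have s0 : 0 <= s by lra.
rewrite -(@ler_pXn2r _ 2) ?nnegrE ?hnorm_ge0 ?(ltW e0) //.
have hu : usum (dilate F r - dilate F s) (fun n => a n * (r%:C ^+ n - s%:C ^+ n)).
  have := usum_lin (-1) (usum_dilate hF s0 s1) (usum_dilate hF r0 r1).
  have -> : (fun t => -1 * dilate F s t + dilate F r t) = dilate F r - dilate F s.
    by apply/funext => t; rewrite mulN1r addrC.
  have -> // : (fun n => -1 * (a n * s%:C ^+ n) + a n * r%:C ^+ n) =
     (fun n => a n * (r%:C ^+ n - s%:C ^+ n)).
  by apply/funext => n; ring.
apply: (usum_le hu) => n.
have dn k : normc (r%:C ^+ k - s%:C ^+ k) ^+ 2 <= Num.min 1 (k%:R ^+ 2 * d).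
  have -> : r%:C ^+ k - s%:C ^+ k = (r ^+ k - s ^+ k)%:C :> C by rewrite rmorphB !rmorphXn.
  rewrite normc_real real_normK ?num_real //.
  have rk0 : 0 <= r ^+ k by rewrite exprn_ge0.
  have rk1 : r ^+ k <= 1 by rewrite exprn_ile1 // ltW.
  have sk0 : 0 <= s ^+ k by rewrite exprn_ge0.
  have sk1 : s ^+ k <= 1 by rewrite exprn_ile1 // ltW.
  have br := bernoulli k r0; have bs := bernoulli k s0.
  have k0 : 0 <= k%:R :> R by [].
  have hk : k%:R * (1 - r) <= k%:R * d by rewrite ler_wpM2l //; lra.
  have hk' : k%:R * (1 - s) <= k%:R * d by rewrite ler_wpM2l //; lra.
  rewrite le_min; apply/andP; split.
    move: (r ^+ k) (s ^+ k) rk0 rk1 sk0 sk1 {br bs} => x y *; nra.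
  have h : `|r ^+ k - s ^+ k| <= k%:R * d by rewrite ler_norml; lra.
  rewrite -(real_normK (num_real _)); apply: (@le_trans _ _ ((k%:R * d) ^+ 2)).
    by rewrite ler_pXn2r ?nnegrE //; apply: le_trans h.
  rewrite exprMn [d ^+ 2]expr2; move: (sqr_ge0 (k%:R : R)); move: (_ ^+ 2) => q q0.
  have dd : d * d <= d by rewrite ler_piMr ?(ltW d0) //; lra.
  by rewrite ler_wpM2l.
apply: (@le_trans _ _ (\sum_(k < maxn n0 n) normc (a k * (r%:C ^+ k - s%:C ^+ k)) ^+ 2)).
  rewrite -!(big_mkord xpredT (fun k => normc (a k * (r%:C ^+ k - s%:C ^+ k)) ^+ 2)).
  rewrite [leRHS](big_cat_nat (leq0n n) (leq_maxr n0 n)) /= lerDl.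
  by apply: sumr_ge0 => i _; exact: sqr_ge0.
rewrite -(big_mkord xpredT (fun k => normc (a k * (r%:C ^+ k - s%:C ^+ k)) ^+ 2)).
rewrite (big_cat_nat (leq0n n0) (leq_maxl n0 n)) /=.
have t1 : \sum_(0 <= k < n0) normc (a k * (r%:C ^+ k - s%:C ^+ k)) ^+ 2 <= n0%:R ^+ 2 * u n0 * d.
  rewrite /u -(big_mkord xpredT (fun k => normc (a k) ^+ 2)) mulr_sumr mulr_suml.
  rewrite big_nat_cond [leRHS]big_nat_cond; apply: ler_sum => k /andP[/andP[_ kn] _].
  rewrite (normcM (a k)) (exprMn 2 (normc (a k))).
  have hy : normc (r%:C ^+ k - s%:C ^+ k) ^+ 2 <= n0%:R ^+ 2 * d.
    have := dn k; rewrite le_min => /andP[_ h]; apply: (le_trans h).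
    by rewrite ler_wpM2r ?(ltW d0) // ler_pXn2r ?nnegrE // ler_nat ltnW.
  rewrite [n0%:R ^+ 2 * _]mulrC -[leRHS]mulrA; apply: ler_wpM2l => //; exact: sqr_ge0.
have t2 : \sum_(n0 <= k < maxn n0 n) normc (a k * (r%:C ^+ k - s%:C ^+ k)) ^+ 2 <= eps ^+ 2 / 2.
  apply: (@le_trans _ _ (\sum_(n0 <= k < maxn n0 n) normc (a k) ^+ 2)).
    apply: ler_sum => k _; rewrite (normcM (a k)) (exprMn 2 (normc (a k))) ler_piMr ?sqr_ge0 //.
    by have := dn k; rewrite le_min => /andP[].
  have := le_sup (maxn n0 n); rewrite /u -(big_mkord xpredT (fun k => normc (a k) ^+ 2)).
  rewrite (big_cat_nat (leq0n n0) (leq_maxl n0 n)) /= big_mkord -/(u n0); lra.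
move: dK; rewrite /K; lra.
Qed.

(** The property by which [boundary] selects its value, in epsilon form. Keeping [g] arbitrary
    allows explicit boundary functions, such as that of the kernel, and linear combinations to stand
    in for the chosen one. *)
Definition bd F g := L2 g /\ forall eps : R, 0 < eps -> exists2 d : R, 0 < d < 1 & forall r,
  1 - d <= r -> r < 1 -> N (dilate F r - g) <= eps.

Lemma bd_ex F (B : R) : cholo F -> ell2_bound (taylor F) B -> exists g, bd F g.
Proof.
move=> hF hB.
have hk (k : nat) : exists d : R, (0 < d < 1) /\ forall r s,
    1 - d <= r -> r < 1 -> 1 - d <= s -> s < 1 -> N (dilate F r - dilate F s) <= 2 ^- k.
  have k0 : 0 < (2 : R) ^- k by rewrite invr_gt0 exprn_gt0.
  by have [d d01 h] := dilate_cauchy hF hB k0; exists d.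
have [d hd] := choice hk.
(* Increasing radii with 1 - d k <= rho k, so that the dilates at these radii are Cauchy at the rate
   2^-k required by [L2_fast_limit]. *)
pose rho := fix rho k := if k is k'.+1 then Num.max (rho k') (1 - d k) else 1 - d 0%N.
have rho1 k : rho k < 1.
  have r1 m : 1 - d m < 1 by have [/andP[dm _] _] := hd m; rewrite ltrBlDr ltrDl.
  by elim: k => [|k IH] /=; [exact: r1|rewrite gt_max IH r1].
have rhod k : 1 - d k <= rho k by case: k => [|k] /=; rewrite ?le_max ?lexx ?orbT.
have rhoS k m : (k <= m)%N -> rho k <= rho m.
  by apply: (@homo_leq R rho (fun x y => x <= y)) => // [x y z|i]; [exact: le_trans|rewrite /= le_max lexx].
have rho0 k : 0 <= rho k.
  by apply: le_trans (rhod k); have [/andP[? ?] _] := hd k; rewrite subr_ge0 ltW.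
have [||g Lg hg] := @L2_fast_limit R (fun k => dilate F (rho k)).
- by move=> k; exact: dilate_L2.
- move=> k m km; apply: (hd k).2 => //; exact: le_trans (rhod k) (rhoS _ _ km).
exists g; split => // eps e0.
have [k hk2] := half_pow_small e0.
have [/andP[dk0 dk1] hdk] := hd k.
exists (d k); first by rewrite dk0.
move=> r hr r1.
have r0 : 0 <= r by lra.
have L1 := dilate_L2 hF r0 r1; have L2_ := dilate_L2 hF (rho0 k) (rho1 k).
have := L2_hnormD (L2_B L1 L2_) (L2_B L2_ Lg); rewrite subrKA.
have := hdk r (rho k) hr r1 (rhod k) (rho1 k); have := hg k; lra.
Qed.

(** The usual way to an identity for boundary functions: prove it for the dilates up to an error,
    then let r tend to 1 by Cauchy-Schwarz. *)
Lemma bd_ip F g h c : cholo F -> bd F g -> L2 h ->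
  (forall eps : R, 0 < eps -> exists2 d : R, 0 < d & forall r, 1 - d <= r -> 0 <= r -> r < 1 ->
     normc (L2_ip (dilate F r) h - c) <= eps) -> L2_ip g h = c.
Proof.
move=> hF [Lg hg] Lh hc; apply/eqP; rewrite -subr_eq0; apply/eqP/eq0_normc/eqP.
rewrite eq_le normc_ge0 andbT; apply/ler_addgt0Pr => eps e0; rewrite add0r.
have e2 : 0 < eps / 2 by rewrite divr_gt0.
have Nh0 : 0 < N h + 1 by rewrite ltr_wpDl ?hnorm_ge0.
have [d d0 h1] := hc _ e2.
have [|d' /andP[d'0 d'1] h2] := hg (eps / 2 / (N h + 1)); first by rewrite divr_gt0.
pose m := Num.min d d'; have m0 : 0 < m by rewrite lt_min d0.
have md : m <= d by rewrite ge_min lexx.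
have md' : m <= d' by rewrite ge_min lexx orbT.
pose r := 1 - m / 2.
have r0 : 0 <= r by rewrite /r; lra.
have r1 : r < 1 by rewrite /r; lra.
have rd : 1 - d <= r by rewrite /r; lra.
have rd' : 1 - d' <= r by rewrite /r; lra.
have Lr := dilate_L2 hF r0 r1.
have := h1 r rd r0 r1; have := h2 r rd' r1; rewrite ler_pdivlMr // => q1 q2.
have := L2_cauchy_schwarz (L2_B Lr Lg) Lh; rewrite L2_ipBl // => q3.
have -> : L2_ip g h - c = (L2_ip (dilate F r) h - c) - (L2_ip (dilate F r) h - L2_ip g h) by ring.
apply: (le_trans (normcD _ _)); rewrite normcN.
have := hnorm_ge0 (@L2_ip R) h; have := hnorm_ge0 (@L2_ip R) (dilate F r - g); nra.
Qed.

End Boundary.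

(** * The Hardy space and its boundary functions *)

Section HardySpace.
Variable R : realType.
Local Notation C := R[i].
Local Notation N := (hnorm (@L2_ip R)).
Implicit Types (f g h : R -> C) (F G : C -> C).

Lemma at_left1P (P : R -> Prop) :
  (\forall r \near (1 : R)^'-, P r) <-> exists2 d : R, 0 < d < 1 & forall r, 1 - d <= r -> r < 1 -> P r.
Proof.
split=> [/nbhs_ballP[d /= d0 h]|[d /andP[d0 d1] h]].
  exists (Num.min (d / 2) (1 / 2)).
    by rewrite lt_min gt_min !divr_gt0 //=; apply/orP; right; lra.
  move=> r hr r1; apply: h => //=; rewrite /ball /= gtr0_norm ?subr_gt0 //.
  have : Num.min (d / 2) (1 / 2) <= d / 2 by rewrite ge_min lexx.
  lra.
apply/nbhs_ballP; exists d => //= r; rewrite /ball /= => hr r1; apply: h => //.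
by move: hr; rewrite gtr0_norm ?subr_gt0 //; lra.
Qed.

Lemma bdP F g : cholo F -> bd F g <->
  (L2 g /\ L2_energy (fun t => dilate F r t - g t) @[r --> (1 : R)^'-] --> 0%E).
Proof.
move=> hF.
have LB r : L2 g -> 0 <= r -> r < 1 -> L2 (dilate F r - g).
  by move=> Lg r0 r1; apply: L2_B => //; exact: dilate_L2.
split=> -[Lg hg]; split=> //.
  apply/fine_cvgP; split.
    apply/at_left1P; exists (1 / 2); first by apply/andP; split; lra.
    move=> r hr r1; have r0 : 0 <= r by lra.
    by rewrite (L2_energy_norm (LB r Lg r0 r1)).
  apply/(@cvgrPdist_le R R) => eps e0; apply/at_left1P.
  have [d /andP[d0 d1] h] := hg (Num.sqrt eps) (etrans (sqrtr_gt0 _) e0).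
  exists d; first by rewrite d0.
  move=> r hr r1; have r0 : 0 <= r by lra.
  rewrite /= (L2_energy_norm (LB r Lg r0 r1)) /= sub0r normrN ger0_norm ?sqr_ge0 //.
  by rewrite -[leRHS](sqr_sqrtr (ltW e0)) ler_pXn2r ?nnegrE ?hnorm_ge0 ?sqrtr_ge0 // h.
move=> eps e0; move/fine_cvgP: hg => -[_ /(@cvgrPdist_le R R)] /(_ (eps ^+ 2)).
rewrite exprn_gt0 // => /(_ isT) /at_left1P[d d01 h]; exists d => // r hr r1.
have r0 : 0 <= r by case/andP: d01; lra.
have := h r hr r1; rewrite /= (L2_energy_norm (LB r Lg r0 r1)) /= sub0r normrN.
by rewrite ger0_norm ?sqr_ge0 // ler_pXn2r ?nnegrE ?hnorm_ge0 // ltW.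
Qed.

Lemma boundary_L2 F : L2 (boundary F).
Proof.
rewrite /boundary; set S := (X in xget _ X).
have [[g Sg]|h] := pselect (exists g, S g); first by case: (xgetPex (fun=> 0) (ex_intro _ _ Sg)).
by rewrite xgetPN; [exact: L2_0|move=> g Sg; apply: h; exists g].
Qed.

(** The existence of one boundary function makes the choice in [boundary] genuine; otherwise it
    would be the default 0. *)
Lemma boundaryP F g : cholo F -> bd F g -> bd F (boundary F).
Proof.
move=> hF /(bdP _ hF) hg; apply/(bdP _ hF).
rewrite /boundary; set S := (X in xget _ X).
suff : S (xget (fun=> 0) S) by [].
by apply: xgetPex; exists g.
Qed.

Lemma bd_boundary F (B : R) : cholo F -> ell2_bound (taylor F) B -> bd F (boundary F).
Proof. by move=> hF hB; have [g] := bd_ex hF hB; exact: boundaryP. Qed.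

Lemma L2_norm0_ip g h : L2 g -> L2 h -> N g = 0 -> L2_ip g h = 0.
Proof.
move=> Lg Lh g0; apply: eq0_normc; apply/eqP; rewrite eq_le normc_ge0 andbT.
by have := L2_cauchy_schwarz Lg Lh; rewrite g0 mul0r.
Qed.

Lemma bd_uniq F g g' : cholo F -> bd F g -> bd F g' -> N (g - g') = 0.
Proof.
move=> hF [Lg hg] [Lg' hg']; apply/eqP; rewrite eq_le hnorm_ge0 andbT.
apply/ler_addgt0Pr => eps e0; rewrite add0r; have e2 : 0 < eps / 2 by rewrite divr_gt0.
have [d /andP[d0 d1] h] := hg _ e2; have [d' /andP[d'0 d'1] h'] := hg' _ e2.
pose m := Num.min d d'; have m0 : 0 < m by rewrite lt_min d0.
have md : m <= d by rewrite ge_min lexx.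
have md' : m <= d' by rewrite ge_min lexx orbT.
have r0 : 0 <= 1 - m by lra.
have r1 : 1 - m < 1 by lra.
have Lr := dilate_L2 hF r0 r1.
have := L2_hnormD (L2_B Lg Lr) (L2_B Lr Lg'); rewrite subrKA.
rewrite -[N (g - _)]L2_hnormN opprB => q.
by have := h (1 - m); have := h' (1 - m); lra.
Qed.

Lemma bd_ip_eq F g g' h : cholo F -> bd F g -> bd F g' -> L2 h -> L2_ip g h = L2_ip g' h.
Proof.
move=> hF hg hg' Lh; apply/eqP; rewrite -subr_eq0 -L2_ipBl //; [|by case: hg|by case: hg'].
by rewrite L2_norm0_ip ?(bd_uniq hF hg hg') //; apply: L2_B; [case: hg|case: hg'].
Qed.

Lemma dilate_lin a F G r : dilate (a *: F + G) r = a *: dilate F r + dilate G r.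
Proof. by []. Qed.

Lemma L2_hnormZ (a : C) f : L2 f -> N (a *: f) = normc a * N f.
Proof.
move=> Lf; have := hnormZ (sub_L2_semi_ip R) a (to_sub (L2_subspace R) f).
by rewrite /hnorm /sub_ip !svZ !to_subK.
Qed.

Lemma L2_Z (a : C) f : L2 f -> L2 (a *: f).
Proof. by move=> Lf; rewrite -[_ *: _]addr0; apply: L2_lin => //; exact: L2_0. Qed.

Lemma bd_lin a F G f g : cholo F -> cholo G -> bd F f -> bd G g ->
  bd (a *: F + G) (a *: f + g).
Proof.
move=> hF hG [Lf hf] [Lg hg]; split; first exact: L2_lin.
move=> eps e0; have e2 : 0 < eps / 2 by rewrite divr_gt0.
have a1 : 0 < normc a + 1 by rewrite ltr_wpDl ?normc_ge0.
have [d /andP[d0 d1] h] := hf _ (divr_gt0 e2 a1); have [d' /andP[d'0 d'1] h'] := hg _ e2.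
exists (Num.min d d'); first by rewrite lt_min gt_min d0 d'0 d1.
move=> r hr r1.
have md : Num.min d d' <= d by rewrite ge_min lexx.
have md' : Num.min d d' <= d' by rewrite ge_min lexx orbT.
have r0 : 0 <= r by lra.
have rd : 1 - d <= r by lra.
have rd' : 1 - d' <= r by lra.
rewrite dilate_lin; have -> : a *: dilate F r + dilate G r - (a *: f + g) =
  a *: (dilate F r - f) + (dilate G r - g) by rewrite scalerBr opprD addrACA.
have LF := L2_B (dilate_L2 hF r0 r1) Lf; have LG := L2_B (dilate_L2 hG r0 r1) Lg.
apply: (le_trans (L2_hnormD (L2_Z a LF) LG)); rewrite L2_hnormZ //.
have := h r rd r1; have := h' r rd' r1; rewrite [in X in _ -> X -> _]ler_pdivlMr // => q1 q2.
by have := hnorm_ge0 (@L2_ip R) (dilate F r - f); have := normc_ge0 a; nra.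
Qed.

Lemma bd_coef F g n : cholo F -> bd F g -> L2_ip g (fun t => expi t ^+ n) = taylor F n.
Proof.
move=> hF hg; apply: (bd_ip hF hg); first exact: expiX_L2.
move=> eps e0.
have t1 : 0 < n%:R * (normc (taylor F n) + 1) + 1.
  by rewrite ltr_wpDl // mulr_ge0 ?addr_ge0 ?normc_ge0.
(* By Bernoulli 1 - r^n <= n d, so the error |taylor F n| n d is at most eps; the outer + 1 keeps
   the denominator positive when n = 0. *)
pose d := Num.min (1 / 2) (eps / (n%:R * (normc (taylor F n) + 1) + 1)).
have d0 : 0 < d by rewrite lt_min !divr_gt0.
have dh : d <= 1 / 2 by rewrite ge_min lexx.
have : d <= eps / (n%:R * (normc (taylor F n) + 1) + 1) by rewrite ge_min lexx orbT.
rewrite ler_pdivlMr // => dE.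
exists d => // r hr r0 r1; have r0' : 0 < r by lra.
have -> : L2_ip (dilate F r) (fun t => expi t ^+ n) = taylor F n * r%:C ^+ n.
  rewrite -fcoefE // L2_ipE /fcoef; congr circle_mean; apply/funext => t.
  by rewrite conj_expiX.
rewrite -[X in _ - X]mulr1 -mulrBr normcM -rmorphXn.
have -> : (r ^+ n)%:C - 1 = (r ^+ n - 1)%:C :> C by rewrite rmorphB.
rewrite normc_real distrC ger0_norm ?subr_ge0 ?exprn_ile1 ?(ltW r1) //.
have := bernoulli n r0; have n0 : 0 <= n%:R :> R by [].
have nr : n%:R * (1 - r) <= n%:R * d by rewrite ler_wpM2l //; lra.
have T0 := normc_ge0 (taylor F n).
move: (normc _) n%:R (r ^+ n) T0 n0 dE nr => T m x T0 n0 dE nr hb.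
have : 0 <= m * d by rewrite mulr_ge0 // ltW.
have : T * (1 - x) <= T * (m * d) by rewrite ler_wpM2l //; lra.
nra.
Qed.

(** Bessel's inequality, since the Fourier coefficients of the boundary function are the Taylor
    coefficients. *)
Lemma bd_norm_ge F g : cholo F -> bd F g -> ell2_bound (taylor F) (N g ^+ 2).
Proof.
move=> hF hg n; have Lg := hg.1.
have := bessel_le (sub_L2_semi_ip R) (to_sub (L2_subspace R) g) (expi_porth R) (iota_uniq 0 n).
rewrite /hnorm /sub_ip to_subK // => h; apply: le_trans h.
rewrite -(big_mkord xpredT (fun i => normc (taylor F i) ^+ 2)) /index_iota subn0.
rewrite le_eqVlt; apply/orP; left; apply/eqP; apply: eq_bigr => i _.
by rewrite -(bd_coef i hF hg) to_subK //; exact: expiX_L2.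
Qed.

Lemma dilate_norm_le F (B : R) r : cholo F -> ell2_bound (taylor F) B -> 0 <= r -> r < 1 ->
  N (dilate F r) ^+ 2 <= B.
Proof.
move=> hF hB r0 r1; apply: (usum_le (usum_dilate hF r0 r1)) => n.
apply: le_trans (hB n); apply: ler_sum => k _.
rewrite (normcM (taylor F k)) (exprMn 2 (normc (taylor F k))) ler_piMr ?sqr_ge0 //.
have -> : r%:C ^+ k = (r ^+ k)%:C :> C by rewrite rmorphXn.
rewrite normc_real ger0_norm ?exprn_ge0 // -exprM exprn_ile1 //; exact: ltW.
Qed.

Lemma bd_norm_le F g (B : R) : cholo F -> bd F g -> 0 <= B ->
  (forall r, 0 <= r -> r < 1 -> N (dilate F r) <= B) -> N g <= B.
Proof.
move=> hF [Lg hg] B0 hB; apply/ler_addgt0Pr => eps e0.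
have [d /andP[d0 d1] h] := hg _ e0.
have r0 : 0 <= 1 - d by lra.
have r1 : 1 - d < 1 by lra.
have Lr := dilate_L2 hF r0 r1.
have := L2_hnormD (L2_B Lg Lr) Lr; rewrite subrK -[N (g - _)]L2_hnormN opprB.
by have := hB _ r0 r1; have := h (1 - d) (lexx _) r1; lra.
Qed.

Lemma dilate_norm_bd F g r : cholo F -> bd F g -> 0 <= r -> r < 1 -> N (dilate F r) <= N g.
Proof.
move=> hF hg r0 r1; rewrite -(@ler_pXn2r _ 2) ?nnegrE ?hnorm_ge0 //.
exact: dilate_norm_le hF (bd_norm_ge hF hg) r0 r1.
Qed.

Lemma H2_cholo F : H2 F -> cholo F.
Proof. by move=> [/holomorphic_cholo]. Qed.

Lemma H2_bd F : H2 F -> bd F (boundary F).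
Proof.
move=> hF; have hc := H2_cholo hF; have [_ _ [M hM]] := hF.
apply: (@bd_boundary _ M) => //; apply: taylor_ell2 => // r r0 r1.
have /hM : 0 <= r < 1 by rewrite r0.
by rewrite L2_energy_norm ?lee_fin //; exact: dilate_L2.
Qed.

Lemma taylor_eq0 F : cholo F -> (forall n, taylor F n = 0) -> forall w, disk w -> F w = 0.
Proof.
move=> hF h0 w hw; pose s := (1 + normc w) / 2; have w0 := normc_ge0 w.
have w1 : normc w < 1 by [].
have s0 : 0 < s by rewrite /s; lra.
have s1 : s < 1 by rewrite /s; lra.
have ws : normc w < s by rewrite /s; lra.
have [M M0 h] := taylor_expand hF s0 s1.
have q0 : 0 <= normc w / s by rewrite divr_ge0 // ltW.
have q1 : normc w / s < 1 by rewrite ltr_pdivrMr // mul1r.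
apply: eq0_normc; apply: (@geometric_limit _ _ (M / (1 - normc w / s)) (normc w / s) 0) => //.
  exact: normc_ge0.
move=> n _; have := h w n ws; rewrite big1 ?subr0 => [|i _]; last by rewrite h0 mul0r.
by move=> {}h; apply: (le_trans h); rewrite mulrA mulrAC.
Qed.

(** Definiteness holds for functions on the disk: a null boundary function has vanishing
    coefficients, so F is 0 on the disk, and the extension by 0 settles the rest of the plane. *)
Lemma H2_norm0 F : H2 F -> N (boundary F) = 0 -> F = 0.
Proof.
move=> hF h0; have hc := H2_cholo hF; have hb := H2_bd hF.
apply/funext => w; have [hw|hw] := pselect (disk w); last by case: hF => _ /(_ w hw) ->.
apply: (taylor_eq0 hc) => // n; rewrite -(bd_coef n hc hb).
by apply: L2_norm0_ip => //; [exact: boundary_L2|exact: expiX_L2].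
Qed.

End HardySpace.

(** * The model space *)

Section Completeness.
Variable R : realType.
Local Notation C := R[i].
Local Notation N := (hnorm (@L2_ip R)).
Implicit Types (f g h : R -> C) (F G : C -> C).

Lemma cdiff1_derivable F w D : cdiff1 F w D -> derivable (F : C^o -> C^o) w 1.
Proof.
move=> hF; apply/cvg_ex; exists (D : C^o); apply/cvgrPdist_lt => eps e0.
have eE : eps = (complex.Re eps)%:C by rewrite RRe_real // gtr0_real.
have e0' : 0 < complex.Re eps by rewrite -ltcR -eE.
have [|d d0 h] := hF (complex.Re eps / 2); first by rewrite divr_gt0.
apply/nbhs_ballP; exists d%:C; first by rewrite /= ltcR.
move=> v; rewrite /ball /= sub0r normrN normcE ltcR => vd v0.
have := h (v + w); rewrite addrK => /(_ vd) {}h.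
have nv0 : 0 < normc v by rewrite lt_def normc_ge0 andbT; apply: contra v0 => /eqP/eq0_normc ->.
rewrite eE normcE ltcR /GRing.scale /= mulr1 addrC.
apply: (@le_lt_trans _ _ (complex.Re eps / 2)); last lra.
rewrite -(ler_pM2r nv0); apply: le_trans h; rewrite -normcM normcB.
rewrite le_eqVlt; apply/orP; left; apply/eqP; congr normc.
by field.
Qed.

Lemma cholo_holomorphic F : cholo F -> holomorphic F.
Proof. by move=> hF w /hF[D]; exact: cdiff1_derivable. Qed.

Lemma normc_1BM (c w : C) : normc c <= 1 -> 1 - normc w <= normc (1 - c * w).
Proof.
move=> c1; apply: le_trans (normc_1B _); rewrite lerD2l lerN2 normcM.
by rewrite ler_piMl ?normc_ge0.
Qed.

Lemma normc1BM_gt0 (c w : C) : normc c <= 1 -> normc w < 1 -> 1 - c * w != 0.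
Proof.
move=> c1 w1; apply: contraTneq (normc_1BM w c1) => ->.
by rewrite normc0 -ltNge subr_gt0.
Qed.

(** The remainder is exactly c^2 (v - w)^2 / ((1 - c v) (1 - c w)^2). Its bound is uniform in |c| <=
    1, which covers both a fixed kernel and, with c on the circle, differentiation under the
    integral. *)
Lemma kernel_diff (c w v : C) : normc c <= 1 -> normc w < 1 -> normc (v - w) < (1 - normc w) / 2 ->
  normc ((1 - c * v)^-1 - ((1 - c * w)^-1 + c / (1 - c * w) ^+ 2 * (v - w))) <=
    2 / (1 - normc w) ^+ 3 * normc (v - w) ^+ 2.
Proof.
move=> c1 w1 hv; set e := 1 - normc w; have e0 : 0 < e by rewrite subr_gt0.
have nv : e / 2 <= 1 - normc v.
  have : normc v <= normc (v - w) + normc w by rewrite -[X in normc X <= _](subrK w) normcD.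
  by rewrite /e in hv *; lra.
have v1 : normc v < 1 by have := divr_gt0 e0 (ltr0Sn R 1); lra.
have nz := normc1BM_gt0 c1 v1; have nw := normc1BM_gt0 c1 w1.
have -> : (1 - c * v)^-1 - ((1 - c * w)^-1 + c / (1 - c * w) ^+ 2 * (v - w)) =
   c ^+ 2 * (v - w) ^+ 2 * ((1 - c * v)^-1 * (1 - c * w)^-1 * (1 - c * w)^-1).
  by field; rewrite nz nw.
have iv : normc (1 - c * v)^-1 <= 2 / e.
  rewrite normcV -[2 / e]invrK invf_div lef_pV2 ?posrE ?divr_gt0 //.
    by apply: le_trans nv _; exact: normc_1BM.
  by apply: lt_le_trans (normc_1BM v c1); rewrite subr_gt0.
have iw : normc (1 - c * w)^-1 <= e^-1.
  rewrite normcV lef_pV2 ?posrE //; first exact: normc_1BM.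
  by apply: lt_le_trans (normc_1BM w c1).
rewrite 2!normcM.
have cc : normc (c ^+ 2) <= 1 by rewrite expr2 normcM mulr_ile1 ?normc_ge0.
have -> : normc ((v - w) ^+ 2) = normc (v - w) ^+ 2 by rewrite expr2 normcM expr2.
rewrite [leRHS]mulrC; apply: ler_pM; rewrite ?mulr_ge0 ?normc_ge0 ?sqr_ge0 //.
  by rewrite ler_piMl ?sqr_ge0.
have -> : 2 / e ^+ 3 = 2 / e * e^-1 * e^-1 by field; rewrite gt_eqF.
by rewrite !normcM; apply: ler_pM; rewrite ?mulr_ge0 ?normc_ge0 //; apply: ler_pM; rewrite ?normc_ge0.
Qed.

Lemma rkernel_cholo (a : C) : normc a <= 1 -> cholo (rkernel a).
Proof.
move=> a1 w w1; pose c := conjc a; have c1 : normc c <= 1 by rewrite normc_conj.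
have e0 : 0 < 1 - normc w by rewrite subr_gt0.
exists (c / (1 - c * w) ^+ 2) => eps eps0.
pose K := 2 / (1 - normc w) ^+ 3; have K0 : 0 < K by rewrite divr_gt0 ?exprn_gt0.
exists (Num.min ((1 - normc w) / 2) (eps / K)); first by rewrite lt_min (divr_gt0 e0) ?(divr_gt0 eps0 K0).
move=> v; rewrite lt_min (ltr_pdivlMr _ _ K0) => /andP[hv hv2].
have v1 : normc v < 1.
  have : normc v <= normc (v - w) + normc w by rewrite -[X in normc X <= _](subrK w) normcD.
  by lra.
have -> : rkernel a v = (1 - c * v)^-1 by rewrite /rkernel v1.
have -> : rkernel a w = (1 - c * w)^-1 by rewrite /rkernel (w1 : normc w < 1).
apply: (le_trans (kernel_diff c1 w1 hv)); rewrite -/K expr2 mulrA ler_wpM2r ?normc_ge0 //.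
by rewrite mulrC ltW.
Qed.

(** The Cauchy integral of [g], that is, its Szego projection evaluated at w. *)
Definition szego g (w : C) : C := circle_mean (fun t => g t * (1 - w * conjc (expi t))^-1).

Lemma kernel_cmeasurable w : normc w < 1 -> cmeasurable (fun t : R => (1 - w * conjc (expi t))^-1).
Proof. by move=> w1; apply/cint_cmeasurable/ccontinuous_cint/ccontinuous_kernel. Qed.

Lemma szego_ip g w : szego g w = L2_ip g (fun t => conjc (1 - w * conjc (expi t))^-1).
Proof. by rewrite L2_ipE; congr circle_mean; apply/funext => t; rewrite conjcK. Qed.

Lemma L2_kernel w : normc w < 1 -> L2 (fun t : R => conjc (1 - w * conjc (expi t))^-1).
Proof. by move=> w1; apply/L2_conj/ccontinuous_L2/ccontinuous_kernel. Qed.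

Lemma L2_one : L2 (fun _ : R => 1 : C).
Proof. by apply/ccontinuous_L2/ccontinuous_cst. Qed.

Lemma L2_mean g (M : R) f : L2 g -> cmeasurable f -> 0 <= M ->
  (forall t, angles t -> normc (f t) <= M) ->
  cint (fun t => g t * f t) /\ normc (circle_mean (fun t => g t * f t)) <= M * N g.
Proof.
move=> Lg mf M0 hM; have Lf := L2_mul_bounded mf hM Lg.
have E : (fun t => g t * f t) = (fun t => (f t * g t) * conjc 1).
  by apply/funext => t; rewrite conjc1 mulr1 mulrC.
rewrite E -L2_ipE; split; first exact: (L2_cint Lf L2_one).
apply: (le_trans (L2_cauchy_schwarz Lf L2_one)).
have -> : N (fun=> 1) = 1.
  apply: (@pexpIrn _ 2) => //; rewrite ?nnegrE ?hnorm_ge0 // L2_norm_sqr expr1n.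
  by under eq_fun do rewrite normc1 expr1n; rewrite rmean_cst.
by rewrite mulr1; exact: L2_norm_mul.
Qed.

(** Differentiation under the integral: the remainder of the kernel is bounded uniformly in t by a
    multiple of |v - w|^2, and [L2_mean] turns this into a bound on the integral. *)
Lemma szego_cholo g F : L2 g -> (forall w, normc w < 1 -> F w = szego g w) -> cholo F.
Proof.
move=> Lg FE w w1; have e0 : 0 < 1 - normc w by rewrite subr_gt0.
pose k v t : C := (1 - v * conjc (expi t))^-1.
(* The derivative of the kernel with respect to w. *)
pose l t : C := conjc (expi t) / (1 - w * conjc (expi t)) ^+ 2.
have mk v : normc v < 1 -> cmeasurable (k v) by exact: kernel_cmeasurable.
have mc : cmeasurable (fun t : R => conjc (expi t)).
  by apply/cint_cmeasurable/ccontinuous_cint/ccontinuous_conj/ccontinuous_expi.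
have ml : cmeasurable l.
  have -> : l = (fun t => conjc (expi t) * (k w t * k w t)).
    by apply/funext => t; rewrite /l /k -invfM expr2.
  by apply: cmeasurableM => //; apply: cmeasurableM; exact: mk.
have nc t : normc (conjc (expi t) : C) <= 1 by rewrite normc_conj normc_expi.
have kb v t : normc v < 1 -> normc (k v t) <= (1 - normc v)^-1 by exact: normc_kernel.
have lb t : normc (l t) <= (1 - normc w)^-1 * (1 - normc w)^-1.
  have -> : l t = conjc (expi t) * (k w t * k w t) by rewrite /l /k -invfM expr2.
  rewrite !normcM -[leRHS]mul1r; apply: ler_pM; rewrite ?mulr_ge0 ?normc_ge0 //.
  by apply: ler_pM; rewrite ?normc_ge0 ?kb.
exists (circle_mean (fun t => g t * l t)) => eps eps0.
pose K := 2 / (1 - normc w) ^+ 3 * (N g + 1).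
have K0 : 0 < K by rewrite mulr_gt0 ?divr_gt0 ?exprn_gt0 // ltr_wpDl ?hnorm_ge0.
exists (Num.min ((1 - normc w) / 2) (eps / K)); first by rewrite lt_min (divr_gt0 e0) ?(divr_gt0 eps0 K0).
move=> v; rewrite lt_min (ltr_pdivlMr _ _ K0) => /andP[hv hv2].
have v1 : normc v < 1.
  have : normc v <= normc (v - w) + normc w by rewrite -[X in normc X <= _](subrK w) normcD.
  by lra.
have ik u : normc u < 1 -> cint (fun t => g t * k u t).
  move=> u1; apply: (L2_mean Lg (mk u u1) _ (fun t _ => kb u t u1)).1.
  by rewrite invr_ge0 subr_ge0 ltW.
have il : cint (fun t => g t * l t).
  by apply: (L2_mean Lg ml _ (fun t _ => lb t)).1; rewrite mulr_ge0 ?invr_ge0 ?(ltW e0).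
pose rem t := k v t - (k w t + l t * (v - w)).
have mrem : cmeasurable rem.
  have -> : rem = (fun t => -1 * ((v - w) * l t + k w t) + k v t).
    by apply/funext => t; rewrite /rem; ring.
  by apply: cmeasurable_lin; [apply: cmeasurable_lin => //; exact: mk|exact: mk].
have hrem t : normc (rem t) <= 2 / (1 - normc w) ^+ 3 * normc (v - w) ^+ 2.
  rewrite /rem /k /l ![_ * conjc (expi t)]mulrC; exact: kernel_diff.
have E : F v - (F w + circle_mean (fun t => g t * l t) * (v - w)) = circle_mean (fun t => g t * rem t).
  rewrite !FE // /szego -/(k v) -/(k w).
  have -> : (fun t => g t * rem t) =
     (fun t => g t * k v t - ((v - w) * (g t * l t) + g t * k w t)).
    by apply/funext => t; rewrite /rem; ring.
  rewrite cmeanB; [|exact: ik|apply: cint_lin => //; exact: ik].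
  by rewrite cmean_lin //; [ring|exact: ik].
rewrite E; have c0 : 0 <= 2 / (1 - normc w) ^+ 3 * normc (v - w) ^+ 2.
  by rewrite mulr_ge0 ?sqr_ge0 // ltW // divr_gt0 ?exprn_gt0.
apply: (le_trans (L2_mean Lg mrem c0 (fun t _ => hrem t)).2).
move: hv2; rewrite /K; have := normc_ge0 (v - w); have := hnorm_ge0 (@L2_ip R) g.
have : 0 < 2 / (1 - normc w) ^+ 3 by rewrite divr_gt0 ?exprn_gt0.
move: (2 / _) (normc (v - w)) (N g) => p q m p0 m0 q0 h.
have : q * (p * (m + 1)) * q <= eps * q by rewrite ler_wpM2r // ltW.
have : 0 <= p * q ^+ 2 by rewrite mulr_ge0 ?sqr_ge0 // ltW.
nra.
Qed.

End Completeness.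

(** * Reproducing property and completeness of H^2 *)

Section HardyComplete.
Variable R : realType.
Local Notation C := R[i].
Local Notation N := (hnorm (@L2_ip R)).
Implicit Types (f g h : R -> C) (F G : C -> C).

Lemma choloM F G : cholo F -> cholo G -> cholo (fun w => F w * G w).
Proof.
move=> /cholo_holomorphic hF /cholo_holomorphic hG; apply: holomorphic_cholo => w hw.
exact: (derivableM (hF w hw) (hG w hw)).
Qed.

Lemma cholo_lin (a : C) F G : cholo F -> cholo G -> cholo (a *: F + G).
Proof.
move=> /cholo_holomorphic hF /cholo_holomorphic hG; apply: holomorphic_cholo => w hw.
exact: (derivableD (derivableZ (k := a) (hF w hw)) (hG w hw)).
Qed.

Lemma choloB F G : cholo F -> cholo G -> cholo (F - G).
Proof. by move=> hF hG; rewrite -[- G]scaleN1r addrC; exact: cholo_lin. Qed.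

Lemma bdB F G f g : cholo F -> cholo G -> bd F f -> bd G g -> bd (F - G) (f - g).
Proof.
by move=> hF hG bF bG; rewrite -[- G]scaleN1r -[- g]scaleN1r addrC [f + _]addrC; exact: bd_lin.
Qed.

Lemma szego_dilate F r a : cholo F -> 0 < r -> r < 1 -> disk a ->
  szego (dilate F r) a = F (r%:C * a).
Proof.
move=> hF r0 r1 ha; have r01 : 0 < r < 1 by rewrite r0.
by have := cauchy_kernel hF r01 ha; rewrite (cmean_kernel1 ha) mulr1.
Qed.

Lemma cholo_dilate_limit F (a : C) (eps : R) : cholo F -> disk a -> 0 < eps ->
  exists2 d : R, 0 < d & forall r, 1 - d <= r -> 0 <= r -> r < 1 -> normc (F (r%:C * a) - F a) <= eps.
Proof.
move=> hF ha e0; have [D hD] := hF a ha; have [d d0 h] := hD 1 ltr01.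
have D1 : 0 < normc D + 1 by rewrite ltr_wpDl ?normc_ge0.
exists (Num.min (d / 2) (eps / (normc D + 1))); first by rewrite lt_min !divr_gt0.
move=> r hr r0 r1.
have m1 : Num.min (d / 2) (eps / (normc D + 1)) <= d / 2 by rewrite ge_min lexx.
have : Num.min (d / 2) (eps / (normc D + 1)) <= eps / (normc D + 1) by rewrite ge_min lexx orbT.
move=> m2; have {}m2 : 1 - r <= eps / (normc D + 1) by lra.
rewrite ler_pdivlMr // in m2.
have nv : normc (r%:C * a - a) <= 1 - r.
  have -> : r%:C * a - a = (r - 1)%:C * a by rewrite rmorphB mulrBl mul1r.
  rewrite normcM normc_real distrC ger0_norm ?subr_ge0 ?(ltW r1) //.
  by rewrite ler_piMr ?subr_ge0 ?(ltW r1) // ltW.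
have := h (r%:C * a); have hd : normc (r%:C * a - a) < d by lra.
move=> /(_ hd).
have -> : F (r%:C * a) - F a = (F (r%:C * a) - (F a + D * (r%:C * a - a))) + D * (r%:C * a - a) by ring.
move=> q; apply: (le_trans (normcD _ _)); rewrite normcM.
have := normc_ge0 D; have := normc_ge0 (r%:C * a - a).
move: (normc (_ - (_ + _))) (normc (_ - a)) (normc D) q nv m2 => x y z q nv m2 y0 z0; nra.
Qed.

(** The reproducing property of H^2: Cauchy's formula expresses F (r a) by the dilate, and both
    sides pass to the limit as r tends to 1. *)
Lemma szego_bd F f a : cholo F -> bd F f -> disk a -> szego f a = F a.
Proof.
move=> hF hf ha; rewrite szego_ip; apply: (bd_ip hF hf); first exact: L2_kernel.
move=> eps e0; have [d d0 h] := cholo_dilate_limit hF ha e0.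
exists (Num.min d (1 / 2)); first by rewrite lt_min d0 /=.
move=> r hr r0 r1; rewrite -szego_ip.
have m1 : Num.min d (1 / 2) <= d by rewrite ge_min lexx.
have m2 : Num.min d (1 / 2) <= 1 / 2 by rewrite ge_min lexx orbT.
by rewrite szego_dilate //; [apply: h => //; lra|lra].
Qed.

Lemma szego_bound g a : L2 g -> disk a -> normc (szego g a) <= (1 - normc a)^-1 * N g.
Proof.
move=> Lg ha; apply: (L2_mean Lg (kernel_cmeasurable ha) _ _).2.
  by rewrite invr_ge0 subr_ge0 ltW.
by move=> t _; exact: normc_kernel.
Qed.

Lemma L2_hnorm_sub f g : L2 f -> L2 g -> N f <= N g + N (f - g).
Proof. by move=> Lf Lg; have := L2_hnormD Lg (L2_B Lf Lg); rewrite addrC subrK. Qed.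

Lemma L2_cauchy_cvg (u : nat -> R -> C) : (forall n, L2 (u n)) ->
  (forall eps : R, 0 < eps -> exists n0, forall m n, (n0 <= m)%N -> (n0 <= n)%N -> N (u m - u n) <= eps) ->
  exists2 g, L2 g & forall eps : R, 0 < eps -> exists n0, forall n, (n0 <= n)%N -> N (u n - g) <= eps.
Proof.
move=> Lu hu.
have hk (k : nat) : exists n0, forall m n, (n0 <= m)%N -> (n0 <= n)%N -> N (u m - u n) <= 2 ^- k.
  by apply: hu; rewrite invr_gt0 exprn_gt0.
have [d hd] := choice hk.
pose s := fix s k := if k is k'.+1 then maxn (s k') (d k) else d 0%N.
have sd k : (d k <= s k)%N by case: k => [|k] //=; exact: leq_maxr.
have sS k m : (k <= m)%N -> (s k <= s m)%N.
  by apply: (@homo_leq nat s leq) => // [x y z|i]; [exact: leq_trans|exact: leq_maxl].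
have [k|k m km|g Lg hg] := @L2_fast_limit R (fun k => u (s k)); first exact: Lu.
  by apply: (hd k); [exact: leq_trans (sd k) (sS _ _ km)|exact: sd].
exists g => // eps e0.
have [k hk2] := half_pow_small e0.
exists (d k) => n dn.
have := L2_hnormD (L2_B (Lu n) (Lu (s k))) (L2_B (Lu (s k)) Lg); rewrite subrKA.
by have := hd k n (s k) dn (sd k); have := hg k; lra.
Qed.

(* The limit is the Cauchy integral of the limit of the boundary functions. *)
Lemma H2_complete (F : nat -> C -> C) : (forall n, H2 (F n)) ->
  (forall eps : R, 0 < eps -> exists n0, forall m n, (n0 <= m)%N -> (n0 <= n)%N ->
    N (boundary (F m) - boundary (F n)) <= eps) ->
  exists2 G, H2 G & forall eps : R, 0 < eps -> exists n0, forall n, (n0 <= n)%N ->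
    N (boundary (F n) - boundary G) <= eps.
Proof.
move=> hF hc; have cF n := H2_cholo (hF n); have bF n := H2_bd (hF n).
have Lb n : L2 (boundary (F n)) := boundary_L2 _.
have [g Lg hg] := L2_cauchy_cvg Lb hc.
pose G w := if normc w < 1 then szego g w else 0.
have cG : cholo G by apply: (szego_cholo Lg) => w w1; rewrite /G w1.
have ptw n w : disk w -> normc (F n w - G w) <= (1 - normc w)^-1 * N (boundary (F n) - g).
  move=> hw; rewrite /G (hw : normc w < 1) -(szego_bd (cF n) (bF n) hw) !szego_ip.
  rewrite -L2_ipBl //; last exact: L2_kernel.
  by rewrite -szego_ip; apply: szego_bound => //; exact: L2_B.
have dil n r : 0 <= r -> r < 1 -> N (dilate (F n) r - dilate G r) <= (1 - r)^-1 * N (boundary (F n) - g).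
  move=> r0 r1; apply: L2_norm_le.
  - by apply: L2_B; exact: dilate_L2.
  - by rewrite mulr_ge0 ?hnorm_ge0 // invr_ge0 subr_ge0 ltW.
  move=> t _; have r01 : 0 <= r < 1 by rewrite r0.
  have := ptw n _ (disk_circle t r01); rewrite normc_circle ger0_norm //.
(* The bound [dil] blows up as r tends to 1. Comparing with [F k] for a large k depending on r, and
   using that dilation does not increase the norm of F n - F k, gives a bound uniform in r. *)
have unif (eps : R) : 0 < eps -> exists n0, forall n, (n0 <= n)%N -> forall r, 0 <= r -> r < 1 ->
    N (dilate (F n) r - dilate G r) <= eps.
  move=> e0; have [n0 h0] := hc _ e0; exists n0 => n nn r r0 r1.
  apply/ler_addgt0Pr => e e0'.
  have r1' : 0 < 1 - r by rewrite subr_gt0.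
  have [|n1 h1] := hg (e * (1 - r)); first by rewrite mulr_gt0.
  pose k := maxn n0 n1.
  have := dilate_norm_bd (choloB (cF n) (cF k)) (bdB (cF n) (cF k) (bF n) (bF k)) r0 r1.
  rewrite -[dilate (F n - F k) r]/(dilate (F n) r - dilate (F k) r) => q1.
  have q2 := h0 n k nn (leq_maxl _ _).
  have q3 := dil k r r0 r1.
  have q4 : (1 - r)^-1 * N (boundary (F k) - g) <= e.
    by rewrite mulrC ler_pdivrMr // h1 // leq_maxr.
  have LF m : L2 (dilate (F m) r) by exact: dilate_L2.
  have := L2_hnormD (L2_B (LF n) (LF k)) (L2_B (LF k) (dilate_L2 cG r0 r1)); rewrite subrKA; lra.
have HG : H2 G.
  split; first exact: cholo_holomorphic.
    by move=> w hw; rewrite /G; case: ifP.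
  have [n0 h0] := unif 1 ltr01.
  exists ((N (boundary (F n0)) + 1) ^+ 2) => r /andP[r0 r1].
  have LG := dilate_L2 cG r0 r1; have LF := dilate_L2 (cF n0) r0 r1.
  rewrite (L2_energy_norm LG) lee_fin ler_pXn2r ?nnegrE ?addr_ge0 ?hnorm_ge0 //.
  have := L2_hnorm_sub LG LF; rewrite -[N (dilate G r - _)]L2_hnormN opprB.
  have := h0 _ (leqnn n0) _ r0 r1; have := dilate_norm_bd (cF n0) (bF n0) r0 r1; lra.
exists G => // eps e0; have [n0 h0] := unif _ e0; exists n0 => n nn.
apply: (bd_norm_le (choloB (cF n) cG) (bdB (cF n) cG (bF n) (H2_bd HG)) (ltW e0)) => r r0 r1.
exact: (h0 n nn r r0 r1).
Qed.

End HardyComplete.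

(** * The model space as a Hilbert space *)

Section ModelSpace.
Variables (R : realType) (u : R[i] -> R[i]).
Local Notation C := R[i].
Local Notation N := (hnorm (@L2_ip R)).
Implicit Types (f g h : R -> C) (F G : C -> C).

Lemma L2_norm0 : N 0 = 0.
Proof.
apply/eqP; rewrite eq_le hnorm_ge0 andbT.
by apply: L2_norm_le => //; [exact: L2_0|move=> t _; rewrite normc0].
Qed.

Lemma H2_0 : H2 (0 : C -> C).
Proof.
split; [by move=> w _; exact: derivable_cst|by []|].
exists 0 => r _; rewrite -[dilate _ _]/(0 : R -> C) (L2_energy_norm (L2_0 R)) lee_fin.
by rewrite L2_norm0 expr0n.
Qed.

(** The representative chosen for the zero function is only determined up to a null set, so it need
    not be 0 pointwise. *)
Lemma boundary0_norm : N (boundary (0 : C -> C)) = 0.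
Proof.
apply/eqP; rewrite eq_le hnorm_ge0 andbT.
by apply: (bd_norm_le (H2_cholo H2_0) (H2_bd H2_0)) => // r r0 r1; rewrite L2_norm0.
Qed.

(** [boundary] need not be linear pointwise; the combination of the two boundary functions is
    another boundary function of the combination, and pairings do not see the difference. *)
Lemma H2_ip_lin (a : C) F G h : H2 F -> H2 G -> L2 h ->
  L2_ip (boundary (a *: F + G)) h = a * L2_ip (boundary F) h + L2_ip (boundary G) h.
Proof.
move=> hF hG Lh; have cF := H2_cholo hF; have cG := H2_cholo hG.
have b := bd_lin a cF cG (H2_bd hF) (H2_bd hG).
have c := cholo_lin a cF cG.
rewrite (bd_ip_eq c (boundaryP c b) b Lh) L2_ip_lin //; exact: boundary_L2.
Qed.

Lemma H2_lin (a : C) F G : H2 F -> H2 G -> H2 (a *: F + G).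
Proof.
move=> hF hG; have cF := H2_cholo hF; have cG := H2_cholo hG.
have b := bd_lin a cF cG (H2_bd hF) (H2_bd hG); have c := cholo_lin a cF cG.
split; first exact: cholo_holomorphic.
  move=> w hw; rewrite -[(_ + _) w]/(a * F w + G w).
  by case: hF hG => _ /(_ w hw) -> _ [_ /(_ w hw) -> _]; rewrite mulr0 addr0.
exists (N (a *: boundary F + boundary G) ^+ 2) => r /andP[r0 r1].
rewrite (L2_energy_norm (dilate_L2 c r0 r1)) lee_fin.
by rewrite ler_pXn2r ?nnegrE ?hnorm_ge0 // dilate_norm_bd.
Qed.

Lemma model_subspace : subspace (model_space u).
Proof.
split.
  split; first exact: H2_0.
  by move=> G hG; apply: L2_norm0_ip; rewrite ?boundary0_norm //; exact: boundary_L2.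
move=> a F G [hF oF] [hG oG]; split; first exact: H2_lin.
move=> H hH; rewrite /H2_ip H2_ip_lin //; last exact: boundary_L2.
by rewrite -/(H2_ip F _) -/(H2_ip G _) oF // oG // mulr0 addr0.
Qed.

Local Notation mip := (sub_ip (@H2_ip R) (hK := model_subspace)).
Local Notation sv := (@subspace_val R _ _ model_subspace).

Lemma model_H2 (x : subspace_type model_subspace) : H2 (sv x).
Proof. by case: (val_in x). Qed.

Lemma model_norm_sub x y : hnorm mip (x - y) = N (boundary (sv x) - boundary (sv y)).
Proof.
have hx := model_H2 x; have hy := model_H2 y.
have cx := H2_cholo hx; have cy := H2_cholo hy.
have c := choloB cx cy; have b := bdB cx cy (H2_bd hx) (H2_bd hy).
have b' := boundaryP c b.
have Lb := boundary_L2 (sv x - sv y).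
have Ld : L2 (boundary (sv x) - boundary (sv y)) by case: b.
rewrite -[LHS]/(N (boundary (sv (x - y)))) svB.
have e1 := L2_hnorm_sub Lb Ld; have e2 := L2_hnorm_sub Ld Lb.
rewrite (bd_uniq c b' b) in e1; rewrite (bd_uniq c b b') in e2; lra.
Qed.

Lemma model_hilbert : hilbert mip.
Proof.
split.
- split=> [a x y z|x y|x].
  + rewrite /sub_ip svD svZ /H2_ip H2_ip_lin //; try exact: model_H2; exact: boundary_L2.
  + by apply: L2_ip_conj; exact: boundary_L2.
  + by rewrite /sub_ip /H2_ip L2_ipxx; apply: rmean_ge0 => t _; exact: sqr_ge0.
- move=> x hx; apply: sv_inj; rewrite sv0; apply: H2_norm0; first exact: model_H2.
  exact: hx.
- move=> x hx.
  have [|eps e0|G hG hcv] := @H2_complete R (fun n => sv (x n)).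
  + by move=> n; exact: model_H2.
  + have [n0 h] := hx _ e0; exists n0 => m n hm hn; rewrite -model_norm_sub ltW //.
    exact: h.
  (* Orthogonality to u H^2 passes to the limit by Cauchy-Schwarz against the fixed vector [h]. *)
  have KG : model_space u G.
    split=> // H hH; rewrite /H2_ip; set h := boundary (fun w => u w * H w).
    have Lh : L2 h by exact: boundary_L2.
    have h0 n : L2_ip (boundary (sv (x n))) h = 0 by have [_ /(_ H hH)] := val_in (x n).
    apply: eq0_normc; apply/eqP; rewrite eq_le normc_ge0 andbT; apply/ler_addgt0Pr => eps e0.
    have N1 : 0 < N h + 1 by rewrite ltr_wpDl ?hnorm_ge0.
    have [n0 /(_ _ (leqnn _)) hn] := hcv _ (divr_gt0 e0 N1).
    have -> : L2_ip (boundary G) h = - L2_ip (boundary (sv (x n0)) - boundary G) h.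
      have := L2_ipBl (boundary_L2 (sv (x n0))) (boundary_L2 G) Lh.
      by rewrite h0 sub0r => ->; rewrite opprK.
    rewrite add0r normcN; apply: (le_trans (L2_cauchy_schwarz _ Lh)); first by apply: L2_B; exact: boundary_L2.
    rewrite ler_pdivlMr // in hn.
    by have := hnorm_ge0 (@L2_ip R) (boundary (sv (x n0)) - boundary G); nra.
  exists (to_sub model_subspace G) => eps e0.
  have [|n0 h] := hcv (eps / 2); first by rewrite divr_gt0.
  exists n0 => n /h; rewrite model_norm_sub to_subK //; lra.
Qed.

End ModelSpace.

(** * Bounded multipliers *)

Section Multipliers.
Variable R : realType.
Local Notation C := R[i].
Local Notation Om := (@angles R).
Local Notation mu := (@lebesgue_measure R).
Local Notation N := (hnorm (@L2_ip R)).
Implicit Types (f g h m p : R -> C) (F G phi : C -> C).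

Lemma measurable_normc f : cmeasurable f -> measurable_fun Om (fun t => normc (f t)).
Proof.
move=> mf; have -> : (fun t => normc (f t)) = (@Num.sqrt R) \o (fun t => normc (f t) ^+ 2).
  by apply/funext => t /=; rewrite sqrtr_sqr ger0_norm ?normc_ge0.
apply: measurableT_comp; last exact: cmeasurable_normc.
by apply: continuous_measurable_fun; exact: sqrt_continuous.
Qed.

(** The bound is asked only almost everywhere, because boundary functions are chosen
    representatives. *)
Definition multiplier m (M : R) :=
  [/\ cmeasurable m, 0 <= M & {ae mu, forall t, Om t -> normc (m t) <= M}].

(** Setting [m] to 0 where the bound fails changes the product on a null set only, and reduces to a
    function bounded at every angle. *)
Lemma multiplier_L2 m M g : multiplier m M -> L2 g ->
  L2 (fun t => m t * g t) /\ N (fun t => m t * g t) <= M * N g.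
Proof.
move=> [mm M0 hM] Lg.
pose A := Om `&` [set t | normc (m t) <= M].
have mA : measurable (A : set (measurableTypeR R)).
  have := measurable_normc mm (@measurable_angles R) (measurable_itv `]-oo, M]).
  by congr measurable; apply/seteqP; split => t /= [Ot]; rewrite in_itv.
pose chi t : C := (\1_A t : R)%:C.
have mchi : cmeasurable chi by split; [exact: measurable_indic|exact: measurable_cst].
pose m0 t := chi t * m t.
have mm0 : cmeasurable m0 by exact: cmeasurableM.
have b0 t : Om t -> normc (m0 t) <= M.
  move=> Ot; rewrite /m0 normcM /chi normc_real indicE.
  have [h|h] := boolP (normc (m t) <= M).
    by rewrite mem_set // normr1 mul1r.
  rewrite memNset ?normr0 ?mul0r //.
  by case=> _ /=; rewrite (negbTE h).
have ae : {ae mu, forall t, Om t -> m t * g t = m0 t * g t}.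
  apply: aeS hM => t ht Ot; rewrite /m0 /chi indicE mem_set ?mul1r //.
  by split => //; exact: ht.
have L0 := L2_mul_bounded mm0 b0 Lg.
have mmg : cmeasurable (fun t => m t * g t) by apply: cmeasurableM => //; case/L2P: Lg.
have [L ->] := ae_L2 mmg ae L0.
by split=> //; exact: L2_norm_mul.
Qed.

Lemma multiplier_conj m M : multiplier m M -> multiplier (fun t => conjc (m t)) M.
Proof.
move=> [mm M0 hM]; split=> //; first exact: cmeasurable_conj.
by apply: aeS hM => t h /h; rewrite normc_conj.
Qed.

(* The negligible excess of [p] over [M] is estimated by [p - dilate phi r],
   as [dilate phi r] is bounded by [M]. *)
Lemma bd_multiplier phi p (M : R) : cholo phi -> bd phi p ->
  (forall w, disk w -> normc (phi w) <= M) -> multiplier p M.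
Proof.
move=> hphi [Lp hp] hM; have /L2P[mp ip] := Lp.
have M0 : 0 <= M.
  by apply: le_trans (normc_ge0 _) (hM 0 _); rewrite /disk /mkset normc0.
split=> //.
pose f t := Num.max 0 (normc (p t) - M) ^+ 2.
have f0 t : 0 <= f t by exact: sqr_ge0.
have mf : measurable_fun Om f.
  apply: measurable_funX; apply: measurable_maxr; first exact: measurable_cst.
  by apply: measurable_funB; [exact: measurable_normc|exact: measurable_cst].
have If : IR f.
  apply: IR_dominated ip => // t _; rewrite ger0_norm //.
  rewrite /f ler_pXn2r ?nnegrE ?normc_ge0 ?le_max ?lexx //.
  by rewrite ge_max normc_ge0 lerBlDr lerDl.
have rf : rmean f <= 0.
  apply/ler_addgt0Pr => eps e0; rewrite add0r.
  have [|d /andP[d0 d1] h] := hp (Num.sqrt eps); first by rewrite sqrtr_gt0.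
  have r0 : 0 <= 1 - d by lra.
  have r1 : 1 - d < 1 by lra.
  have LB := L2_B (dilate_L2 hphi r0 r1) Lp.
  have {}h := h (1 - d) (lexx _) r1.
  apply: (@le_trans _ _ (N (dilate phi (1 - d) - p) ^+ 2)).
    rewrite L2_norm_sqr; apply: le_rmean => //; first by case/L2P: LB.
    move=> t _; rewrite /f ler_pXn2r ?nnegrE ?normc_ge0 ?le_max ?lexx //.
    rewrite ge_max normc_ge0 /=.
    have r01 : 0 <= 1 - d < 1 by rewrite r0.
    have := hM _ (disk_circle t r01); rewrite -dilateE => q.
    have := normcD (dilate phi (1 - d) t) (- (dilate phi (1 - d) - p) t).
    rewrite normcN -[(dilate phi _ - p) t]/(dilate phi (1 - d) t - p t) opprB addrC subrK.
    by lra.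
  by rewrite -[leRHS](sqr_sqrtr (ltW e0)) ler_pXn2r ?nnegrE ?hnorm_ge0 ?sqrtr_ge0.
apply: aeS (rmean_of_ae If f0 rf) => t ht /ht /eqP.
rewrite /f sqrf_eq0 => /eqP h.
by rewrite -subr_le0 -h le_max lexx orbT.
Qed.

Lemma Hoo_multiplier phi : Hoo phi -> bd phi (boundary phi) /\
  exists2 M, multiplier (boundary phi) M & forall w, disk w -> normc (phi w) <= M.
Proof.
move=> [/holomorphic_cholo hphi [M hM]].
have M0 : 0 <= M.
  by apply: le_trans (normc_ge0 _) (hM 0 _); rewrite /disk /mkset normc0.
have hb : bd phi (boundary phi).
  apply: (@bd_boundary _ _ (M ^+ 2)) => //; apply: taylor_ell2 => // r r0 r1.
  rewrite ler_pXn2r ?nnegrE ?hnorm_ge0 //; apply: L2_norm_le => //; first exact: dilate_L2.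
  by move=> t _; apply: hM; apply: disk_circle; rewrite r0.
by split=> //; exists M => //; exact: bd_multiplier hM.
Qed.

Lemma szego_lin (c : C) f g a : disk a -> L2 f -> L2 g ->
  szego (c *: f + g) a = c * szego f a + szego g a.
Proof. by move=> ha Lf Lg; rewrite !szego_ip L2_ip_lin //; exact: L2_kernel. Qed.

Lemma szegoD f g a : disk a -> L2 f -> L2 g -> szego (f + g) a = szego f a + szego g a.
Proof. by move=> ha Lf Lg; rewrite -[f]scale1r szego_lin // scale1r mul1r. Qed.

Lemma szegoB f g a : disk a -> L2 f -> L2 g -> szego (f - g) a = szego f a - szego g a.
Proof. by move=> ha Lf Lg; rewrite !szego_ip L2_ipBl //; exact: L2_kernel. Qed.

(** Avoids identifying p f as the boundary function of phi F. For the dilates, phi_r F_r - p f =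
    phi_r (F_r - f) + (phi_r - p) f; the first term is small in L^2 since phi_r is bounded by M, and
    the second is paired with [h], a bounded kernel times the conjugate of f, which is in L^2. *)
Lemma szego_mul phi p (M : R) F f a : cholo phi -> cholo F -> bd phi p -> bd F f ->
  (forall w, disk w -> normc (phi w) <= M) -> disk a ->
  szego (fun t => p t * f t) a = phi a * F a.
Proof.
move=> hphi hF bp bf hM ha.
have mp := bd_multiplier hphi bp hM; have M0 : 0 <= M by case: mp.
have [Lp hp] := bp; have [Lf hf] := bf.
pose K t : C := conjc (1 - a * conjc (expi t))^-1.
have LK : L2 K by exact: L2_kernel.
pose h t := K t * conjc (f t).
have kb t : normc (K t) <= (1 - normc a)^-1 by rewrite normc_conj; exact: normc_kernel.
have Lh : L2 h.
  apply: (L2_mul_bounded _ (fun t _ => kb t) (L2_conj Lf)).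
  by case/L2P: LK.
have hG := choloM hphi hF.
have Lpf := (multiplier_L2 mp Lf).1.
apply/eqP; rewrite -subr_eq0; apply/eqP/eq0_normc/eqP.
rewrite eq_le normc_ge0 andbT; apply/ler_addgt0Pr => eps e0; rewrite add0r.
have e3 : 0 < eps / 3 by rewrite divr_gt0.
have a1 : 0 < 1 - normc a by rewrite subr_gt0.
have k1 : 0 < (1 - normc a)^-1 * M + 1 by rewrite ltr_wpDl // mulr_ge0 // invr_ge0 ltW.
have k2 : 0 < N h + 1 by rewrite ltr_wpDl ?hnorm_ge0.
have [d1 d10 h1] := cholo_dilate_limit hG ha e3.
have [d2 /andP[d20 d21] h2] := hf _ (divr_gt0 e3 k1).
have [d3 /andP[d30 d31] h3] := hp _ (divr_gt0 e3 k2).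
(* The bound 1 / 2 keeps r positive, as [szego_dilate] requires. *)
pose d := Num.min (1 / 2) (Num.min d1 (Num.min d2 d3)).
have d0 : 0 < d by rewrite !lt_min d10 d20 d30 !divr_gt0.
have q0 : d <= 1 / 2 by rewrite ge_min lexx.
have q1 : d <= d1 by rewrite /d !ge_min lexx !orbT.
have q2 : d <= d2 by rewrite /d !ge_min lexx !orbT.
have q3 : d <= d3 by rewrite /d !ge_min lexx !orbT.
pose r := 1 - d.
have r0 : 0 < r by rewrite /r; lra.
have r1 : r < 1 by rewrite /r; lra.
have {}h1 : normc (phi (r%:C * a) * F (r%:C * a) - phi a * F a) <= eps / 3.
  by apply: h1 => //; [rewrite /r; lra|exact: ltW].
have {}h2 : N (dilate F r - f) <= eps / 3 / ((1 - normc a)^-1 * M + 1).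
  by apply: h2 => //; rewrite /r; lra.
have {}h3 : N (dilate phi r - p) <= eps / 3 / (N h + 1).
  by apply: h3 => //; rewrite /r; lra.
have r01 : 0 <= r < 1 by rewrite ltW.
have Lphi := dilate_L2 hphi (ltW r0) r1; have LF := dilate_L2 hF (ltW r0) r1.
have mphi : cmeasurable (dilate phi r) by case/L2P: Lphi.
have bphi t : normc (dilate phi r t) <= M by exact/hM/disk_circle.
have LX := L2_mul_bounded mphi (fun t _ => bphi t) (L2_B LF Lf).
have LfG := L2_mul_bounded mphi (fun t _ => bphi t) Lf.
have LY : L2 ((fun t => dilate phi r t * f t) - (fun t => p t * f t)) by exact: L2_B.
have E : phi (r%:C * a) * F (r%:C * a) - szego (fun t => p t * f t) a =
    szego (fun t => dilate phi r t * (dilate F r - f) t) a + L2_ip (dilate phi r - p) h.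
  rewrite -(szego_dilate hG r0 r1 ha).
  have -> : L2_ip (dilate phi r - p) h =
      szego ((fun t => dilate phi r t * f t) - (fun t => p t * f t)) a.
    rewrite L2_ipE /szego; congr circle_mean; apply/funext => t.
    rewrite /h /K conjcM !conjcK -[(_ - _) t]/(dilate phi r t - p t).
    by rewrite -[(_ - _) t]/(dilate phi r t * f t - p t * f t); ring.
  rewrite -szegoD // -szegoB //; last first.
    have := L2_D LX LfG; congr L2; apply/funext => t.
    rewrite -[(_ + _) t]/(dilate phi r t * (dilate F r t - f t) + dilate phi r t * f t).
    by rewrite -mulrDr subrK.
  congr szego; apply/funext => t.
  rewrite -[LHS]/(dilate phi r t * dilate F r t - p t * f t).
  by rewrite -[RHS]/(dilate phi r t * (dilate F r t - f t) + (dilate phi r t * f t - p t * f t)); ring.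
have s1 : normc (szego (fun t => dilate phi r t * (dilate F r - f) t) a) <= eps / 3.
  apply: (le_trans (szego_bound LX ha)).
  have := L2_norm_mul mphi (fun t _ => bphi t) M0 (L2_B LF Lf).
  rewrite ler_pdivlMr // in h2; have := hnorm_ge0 (@L2_ip R) (dilate F r - f).
  have i0 : 0 < (1 - normc a)^-1 by rewrite invr_gt0.
  move=> x0 yx; apply: le_trans h2.
  apply: (@le_trans _ _ ((1 - normc a)^-1 * (M * N (dilate F r - f)))).
    by rewrite ler_wpM2l // ltW.
  by rewrite mulrDr mulr1 mulrA mulrC lerDl.
have s2 : normc (L2_ip (dilate phi r - p) h) <= eps / 3.
  apply: (le_trans (L2_cauchy_schwarz (L2_B Lphi Lp) Lh)).
  rewrite ler_pdivlMr // in h3.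
  by have := hnorm_ge0 (@L2_ip R) h; have := hnorm_ge0 (@L2_ip R) (dilate phi r - p); nra.
have -> : szego (fun t => p t * f t) a - phi a * F a =
   (phi (r%:C * a) * F (r%:C * a) - phi a * F a) -
   (phi (r%:C * a) * F (r%:C * a) - szego (fun t => p t * f t) a) by ring.
apply: (le_trans (normcD _ _)); rewrite normcN E.
have := normcD (szego (fun t => dilate phi r t * (dilate F r - f) t) a) (L2_ip (dilate phi r - p) h).
lra.
Qed.

(** The formula of the kernel makes sense on the circle, and the dilate at radius r differs from it
    there by at most (1 - r) / (1 - |a|)^2, uniformly in the angle. *)
Lemma rkernel_bd (a : C) : disk a -> bd (rkernel a) (fun t => conjc (1 - a * conjc (expi t))^-1).
Proof.
move=> ha; split; first exact: L2_kernel.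
have a1 : 0 < 1 - normc a by rewrite subr_gt0.
move=> eps e0; pose Q := (1 - normc a) ^- 2.
have Q0 : 0 < Q by rewrite invr_gt0 exprn_gt0.
exists (Num.min (1 / 2) (eps / Q)).
  rewrite lt_min gt_min (divr_gt0 e0 Q0) andbT; apply/andP; split; first lra.
  by apply/orP; left; lra.
move=> r hr r1.
have m1 : Num.min (1 / 2) (eps / Q) <= 1 / 2 by rewrite ge_min lexx.
have m2 : Num.min (1 / 2) (eps / Q) <= eps / Q by rewrite ge_min lexx orbT.
have r0 : 0 <= r by lra.
have {}m2 : 1 - r <= eps / Q by lra.
rewrite ler_pdivlMr // in m2.
have r01 : 0 <= r < 1 by rewrite r0.
have cr : cholo (rkernel a) by apply: rkernel_cholo; exact: ltW.
apply: L2_norm_le; [|exact: ltW|].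
  by apply: L2_B; [exact: dilate_L2|exact: L2_kernel].
move=> t _; rewrite -[(_ - _) t]/(dilate (rkernel a) r t - conjc (1 - a * conjc (expi t))^-1).
rewrite dilateE /rkernel (disk_circle t r01 : normc _ < 1) -/(conjc a).
have e1 : normc (conjc a) < 1 by rewrite normc_conj.
have ne : normc (expi t) <= 1 by rewrite normc_expi.
have -> : conjc (1 - a * conjc (expi t))^-1 = (1 - expi t * conjc a)^-1.
  rewrite conjc_inv rmorphB rmorph1 rmorphM mulrC; congr ((1 - _ * _)^-1).
  exact: conjcK.
set c := conjc a in e1 *; set x := expi t in ne *.
have nx : 1 - x * c != 0 by exact: normc1BM_gt0.
have nrx : normc (r%:C * x) <= 1 by rewrite normcM normc_real ger0_norm // mulr_ile1 ?normc_ge0 // ltW.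
have nr : 1 - r%:C * x * c != 0 by exact: normc1BM_gt0.
have b1 : normc (1 - x * c)^-1 <= (1 - normc a)^-1.
  rewrite normcV -[normc a]normc_conj lef_pV2 ?posrE ?subr_gt0 //; first exact: normc_1BM.
  by apply: lt_le_trans (normc_1BM c ne); rewrite subr_gt0.
have b2 : normc (1 - r%:C * x * c)^-1 <= (1 - normc a)^-1.
  rewrite normcV -[normc a]normc_conj lef_pV2 ?posrE ?subr_gt0 //; first exact: normc_1BM.
  by apply: lt_le_trans (normc_1BM c nrx); rewrite subr_gt0.
rewrite [c * _]mulrC.
have -> : (1 - r%:C * x * c)^-1 - (1 - x * c)^-1 =
   (r - 1)%:C * (x * c) * ((1 - r%:C * x * c)^-1 * (1 - x * c)^-1).
  by rewrite rmorphB rmorph1; field; rewrite nx nr.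
apply: le_trans m2; rewrite 2!normcM; apply: ler_pM; rewrite ?mulr_ge0 ?normc_ge0 //.
  rewrite normc_real distrC ger0_norm ?subr_ge0 ?(ltW r1) //.
  by rewrite ler_piMr ?subr_ge0 ?(ltW r1) // normcM mulr_ile1 ?normc_ge0 // ltW.
rewrite /Q expr2 invfM normcM.
by apply: ler_pM; rewrite ?normc_ge0.
Qed.

End Multipliers.

(** * Truncated Toeplitz operators *)

Section Toeplitz.
Variables (R : realType) (u : R[i] -> R[i]).
Local Notation C := R[i].
Local Notation N := (hnorm (@L2_ip R)).
Local Notation hK := (model_subspace u).
Local Notation W := (subspace_type hK).
Local Notation mip := (sub_ip (@H2_ip R) (hK := hK)).
Local Notation sv := (@subspace_val R _ _ hK).
Local Notation H := (model_hilbert u).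
Implicit Types (f g h m : R -> C) (x y : W) (a : C).

Lemma model_ip_lin a x y h : L2 h ->
  L2_ip (boundary (sv (a *: x + y))) h = a * L2_ip (boundary (sv x)) h + L2_ip (boundary (sv y)) h.
Proof. by move=> Lh; rewrite svD svZ H2_ip_lin //; exact: model_H2. Qed.

(** The operator is described by its form: pairing with [y] in the model space absorbs the
    orthogonal projection. *)
Definition toeplitz m (T : W -> W) :=
  forall x y, mip (T x) y = L2_ip (fun t => m t * boundary (sv x) t) (boundary (sv y)).

(** Riesz representation takes the place of the projection of L^2, and the basis [e] makes it
    available. Linearity follows by moving the multiplier to the other side of the form. *)
Lemma toeplitz_ex e m M : orthonormal_basis mip setT e -> multiplier m M ->
  exists T : {linear W -> W}, bdd mip T /\ toeplitz m T.
Proof.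
move=> he hm.
have Lm x : L2 (fun t => m t * boundary (sv x) t) := (multiplier_L2 hm (boundary_L2 _)).1.
have hz x : exists z, forall y, L2_ip (boundary (sv y)) (fun t => m t * boundary (sv x) t) = mip y z.
  apply: (riesz_rep H he (M := N (fun t => m t * boundary (sv x) t))) => [a y y'|y].
    exact: model_ip_lin.
  by rewrite mulrC; exact: (L2_cauchy_schwarz (boundary_L2 _) (Lm x)).
have [T hT] := choice hz.
have tT : toeplitz m T.
  move=> x y; rewrite (ip_conj H) -hT -L2_ip_conj //; exact: boundary_L2.
have linT : linear_op setT T.
  split=> // a x y _ _; apply: (ip_eql H) => z.
  have E v : mip (T v) z = L2_ip (boundary (sv v)) (fun t => conjc (m t) * boundary (sv z) t).
    by rewrite tT; exact: L2_ip_mulr.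
  rewrite (ip_lin H) !E; apply: model_ip_lin.
  exact: (multiplier_L2 (multiplier_conj hm) (boundary_L2 (sv z))).1.
have [T' T'E] := linear_packE linT.
exists T'; rewrite T'E; split=> //; have [_ M0 _] := hm.
exists (M + 1) => [|x]; first by rewrite ltr_wpDl.
have [h0|h0] := eqVneq (hnorm mip (T x)) 0.
  by rewrite h0 mulr_ge0 ?hnorm_ge0 ?addr_ge0.
have h1 : 0 < hnorm mip (T x) by rewrite lt_def h0 hnorm_ge0.
rewrite -(ler_pM2l h1) -expr2 (hnorm_sqr H) tT.
apply: (le_trans (ler_norm _)); apply: (le_trans (normc_Re _)).
apply: (le_trans (L2_cauchy_schwarz (Lm x) (boundary_L2 _))).
rewrite mulrC ler_wpM2l ?hnorm_ge0 //; apply: (le_trans (multiplier_L2 hm (boundary_L2 _)).2).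
by rewrite ler_wpM2r ?hnorm_ge0 // lerDl.
Qed.

Lemma toeplitz_adjoint m M (T T' : W -> W) : multiplier m M -> toeplitz m T ->
  toeplitz (fun t => conjc (m t)) T' -> forall x y, mip (T x) y = mip x (T' y).
Proof.
move=> hm hT hT' x y; rewrite hT L2_ip_mulr (ip_conj H) hT' L2_ip_conj //; first exact: boundary_L2.
exact: (multiplier_L2 (multiplier_conj hm) (boundary_L2 _)).1.
Qed.

(** Pairing with the kernel evaluates the Cauchy integral at a. The computation uses the explicit
    boundary function of the kernel, which may replace the chosen one under the pairing. *)
Lemma unit_rkernel_ip a h : disk a -> H2 (unit_rkernel a) -> L2 h ->
  L2_ip (boundary (unit_rkernel a)) h =
  (hnorm (@H2_ip R) (rkernel a))^-1%:C * conjc (szego h a).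
Proof.
move=> ha hH Lh; set c := _%:C; have LK := L2_kernel ha.
have c0 : cholo (0 : C -> C) := H2_cholo (H2_0 R).
have cr : cholo (rkernel a) by apply: rkernel_cholo; exact: ltW.
have b := bd_lin c cr c0 (rkernel_bd ha) (H2_bd (H2_0 R)).
have E : c *: rkernel a + 0 = unit_rkernel a by rewrite addr0.
rewrite E in b; rewrite (bd_ip_eq (H2_cholo hH) (H2_bd hH) b Lh).
rewrite L2_ip_lin //; last exact: boundary_L2.
rewrite [X in _ + X]L2_norm0_ip ?addr0 ?boundary0_norm //; last exact: boundary_L2.
by rewrite szego_ip -L2_ip_conj.
Qed.

(** Paired with any [y] of the model space, both sides are the normalizing factor times the
    conjugate of phi(a) y(a): on the left because the Cauchy integral of the product of boundary
    functions at a is phi(a) y(a). *)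
Lemma toeplitz_eigen phi a (T : W -> W) : Hoo phi -> disk a -> model_space u (unit_rkernel a) ->
  toeplitz (fun t => conjc (boundary phi t)) T ->
  T (to_sub hK (unit_rkernel a)) = conjc (phi a) *: to_sub hK (unit_rkernel a).
Proof.
move=> hphi ha Ka hT; have [bphi [M hm hM]] := Hoo_multiplier hphi.
apply: (ip_eql H) => y; rewrite hT (ipZl H) /sub_ip to_subK // /H2_ip.
have hy := model_H2 y; have Lb := boundary_L2 (sv y).
rewrite L2_ip_mulr !unit_rkernel_ip //; try by case: Ka.
  have -> : (fun t => conjc (conjc (boundary phi t)) * boundary (sv y) t) =
      (fun t => boundary phi t * boundary (sv y) t) by apply/funext => t; rewrite conjcK.
  rewrite (szego_mul (holomorphic_cholo hphi.1) (H2_cholo hy) bphi (H2_bd hy) hM ha).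
  by rewrite (szego_bd (H2_cholo hy) (H2_bd hy) ha) conjcM; ring.
exact: (multiplier_L2 (multiplier_conj (multiplier_conj hm)) Lb).1.
Qed.

(** [model_proj] is a choice by [xget], so [S] has to be shown to be the only element of the model
    space with the projection property; definiteness gives this. *)
Lemma tto_eq f F (S : W) : L2 (fun t => f t * boundary F t) ->
  (forall y, mip S y = L2_ip (fun t => f t * boundary F t) (boundary (sv y))) ->
  tto u f F = sv S.
Proof.
move=> Lf hS; rewrite /tto /model_proj; apply: xget_unique.
  split; first exact: val_in.
  move=> G KG; have := hS (to_sub hK G); rewrite /sub_ip to_subK // => q.
  have := L2_ipBl Lf (boundary_L2 (sv S)) (boundary_L2 G).
  by rewrite -q subrr.
move=> F' [KF' h]; rewrite -(to_subK hK KF'); congr sv; apply: (ip_eql H) => y.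
rewrite hS {1}/sub_ip to_subK // /H2_ip; have := h (sv y) (val_in y).
move=> h0; have := L2_ipBl Lf (boundary_L2 F') (boundary_L2 (sv y)).
by move/(etrans (esym h0))/esym/eqP; rewrite subr_eq0 => /eqP/esym.
Qed.

End Toeplitz.

Lemma cvg_normc (R : realType) (c : nat -> R[i]) :
  (fun n => normc (c n)) @ \oo --> (0 : R) <-> (c : nat -> R[i]^o) @ \oo --> (0 : R[i]^o).
Proof.
split=> [/(@cvgrPdist_lt R R) h|/(@cvgrPdist_lt R[i] R[i]^o) h].
  apply/(@cvgrPdist_lt R[i] R[i]^o) => eps e0.
  have eE : eps = (complex.Re eps)%:C by rewrite RRe_real // gtr0_real.
  have /h[n0 _ hn] : 0 < complex.Re eps by rewrite -ltcR -eE.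
  exists n0 => // n /hn /=; rewrite !sub0r !normrN ger0_norm ?normc_ge0 // => hc.
  by rewrite eE normcE ltcR.
apply/(@cvgrPdist_lt R R) => eps e0.
have /h[n0 _ hn] : 0 < eps%:C :> R[i] by rewrite ltcR.
exists n0 => // n /hn /=; rewrite !sub0r !normrN normcE ltcR => hc.
by rewrite ger0_norm ?normc_ge0.
Qed.

(** * The equivalence on the model space *)

Section Main.
Variables (R : realType) (u : R[i] -> R[i]) (z : nat -> R[i]) (phi psi : R[i] -> R[i]).
Hypotheses (hz : forall n, disk (z n)) (hphi : Hoo phi) (hpsi : Hoo psi).
Local Notation C := R[i].
Local Notation hK := (model_subspace u).
Local Notation W := (subspace_type hK).
Local Notation mip := (sub_ip (@H2_ip R) (hK := hK)).
Local Notation sv := (@subspace_val R _ _ hK).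
Local Notation khat n := (to_sub hK (unit_rkernel (z n))).
Local Notation f := (fun t => boundary phi t + conjc (boundary psi t)).

(** The co-analytic part is [A1], diagonal along the kernels with entries conj (psi (z n)); the
    analytic part is [A2], diagonalized through its adjoint [A2']. Hence the order of the summands
    in conj (psi (z n)) + phi (z n). *)
Lemma model_core (e : nat -> W) (A : (C -> C) -> C -> C) : orthonormal_basis mip setT e ->
  (forall n, model_space u (unit_rkernel (z n))) ->
  (forall F, model_space u F -> A F = tto u f F) ->
  exists S : {linear W -> W}, related A S /\
    ((forall p : R, 1 <= p -> US_basis mip setT (schatten mip setT p) (fun n => khat n) ->
       (schatten mip setT p S <-> ell p (fun n => conjc (psi (z n)) + phi (z n)))) /\
     (US_basis mip setT (compact_op mip setT) (fun n => khat n) ->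
       (compact_op mip setT S <->
        (fun n => normc (conjc (psi (z n)) + phi (z n))) @ \oo --> (0 : R)))).
Proof.
move=> he Kk hA.
have [bphi [M hm hM]] := Hoo_multiplier hphi; have [bpsi [M' hm' hM']] := Hoo_multiplier hpsi.
have [A1 [bA1 tA1]] := toeplitz_ex he (multiplier_conj hm').
have [A1' [bA1' tA1']] := toeplitz_ex he hm'.
have [A2 [bA2 tA2]] := toeplitz_ex he hm.
have [A2' [bA2' tA2']] := toeplitz_ex he (multiplier_conj hm).
have [S hS] : exists S : {linear W -> W}, forall x, S x = A1 x + A2 x.
  have lS : linear_op setT (fun x => A1 x + A2 x).
    by split=> // a x y _ _; rewrite !linearP addrACA scalerDr.
  by have [S SE] := linear_packE lS; exists S => x; rewrite SE.
exists S; split.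
  move=> x; rewrite hA; last exact: val_in.
  have L1 := (multiplier_L2 (multiplier_conj hm') (boundary_L2 (sv x))).1.
  have L2_ := (multiplier_L2 hm (boundary_L2 (sv x))).1.
  have E : (fun t => f t * boundary (sv x) t) = (fun t => conjc (boundary psi t) * boundary (sv x) t) +
     (fun t => boundary phi t * boundary (sv x) t).
    by apply/funext => t; rewrite mulrDl addrC.
  apply/esym; apply: tto_eq; first by rewrite E; exact: L2_D.
  move=> y; rewrite hS (ipDl (model_hilbert u)) tA1 tA2 E.
  have := L2_ip_lin 1 L1 L2_ (boundary_L2 (sv y)).
  by rewrite scale1r mul1r.
have bM n : normc (conjc (psi (z n))) <= Num.max M M'.
  by rewrite normc_conj le_max hM' ?orbT.
have bM' n : normc (phi (z n)) <= Num.max M M' by rewrite le_max hM.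
apply: (abstract_main (model_hilbert u) bA1 bA2' (A1' := A1') _ _ bM bM' _ _ hS).
- apply: (toeplitz_adjoint (multiplier_conj hm') tA1) => x y.
  by rewrite tA1'; under [in RHS]eq_fun do rewrite conjcK.
- exact: (toeplitz_adjoint hm tA2 tA2').
- move=> n; exact (toeplitz_eigen hpsi (hz n) (Kk n) tA1).
- move=> n; exact (toeplitz_eigen hphi (hz n) (Kk n) tA2').
Qed.

End Main.
Unset Implicit Arguments.

Theorem theorem4 (R : realType) (u : R[i] -> R[i]) (z : nat -> R[i])
    (phi psi : R[i] -> R[i]) (A : (R[i] -> R[i]) -> (R[i] -> R[i]))
    (hu : is_blaschke u z) (hphi : Hoo phi) (hpsi : Hoo psi)
    (hA : forall F, model_space u F ->
       A F = tto u (fun t => boundary phi t + (boundary psi t)^*) F) :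
  let Ku := model_space u in
  let khat := fun n => unit_rkernel (z n) in
  let fz := fun n => phi (z n) + (psi (z n))^* in
  (forall p : R, 1 <= p ->
     US_basis (@H2_ip R) Ku (schatten (@H2_ip R) Ku p) khat ->
     (schatten (@H2_ip R) Ku p A <-> ell p fz)) /\
  (US_basis (@H2_ip R) Ku (compact_op (@H2_ip R) Ku) khat ->
     (compact_op (@H2_ip R) Ku A <-> (fz : nat -> R[i]^o) @ \oo --> (0 : R[i]^o))).
Proof.
move=> Ku khat fz; have [_ hz _ _] := hu.
have fzE : fz = (fun n => conjc (psi (z n)) + phi (z n)).
  by apply/funext => n; rewrite addrC.
split=> [p p1 hUS|hUS].
  (* The hypothesis is moved to the type of the model space; on the way it yields [Kk], the
     membership of the kernels, and then the orthonormal basis [e]. *)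
  have [||Kk] := @related_US_basis R _ _ _ (model_subspace u) _
      (schatten (sub_ip (@H2_ip R) (hK := model_subspace u)) setT p) _ _ _ hUS.
  - by move=> T [[]].
  - by move=> T S hTS; exact: (related_schatten _ _ hTS).1.
  move=> /[dup] hUS' [_ [_ [e [_ _ he _]]]].
  have [S [hS [core _]]] := model_core hz hphi hpsi he Kk hA.
  by rewrite fzE -(core p p1 hUS'); exact: related_schatten.
have [||Kk] := @related_US_basis R _ _ _ (model_subspace u) _
    (compact_op (sub_ip (@H2_ip R) (hK := model_subspace u)) setT) _ _ _ hUS.
- by move=> T [].
- by move=> T S hTS; exact: (related_compact _ hTS).1.
move=> /[dup] hUS' [_ [_ [e [_ _ he _]]]].
have [S [hS [_ core]]] := model_core hz hphi hpsi he Kk hA.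
rewrite fzE; apply: (iff_trans (related_compact _ hS)); apply: (iff_trans (core hUS')).
exact: cvg_normc.
Qed.
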